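(* Let $\mathcal{P}$ and $\mathcal{Q}$ be regular $n$-polytopes with isomorphic facets $\mathcal{K}$, let $\Pi=\Gamma(\mathcal{P})\ast_{\Gamma(\mathcal{K})}\Gamma(\mathcal{Q})=\langle\alpha_0,\dots,\alpha_{n-2},\alpha_{n-1},\beta_{n-1}\rangle$ be the amalgamated product described in the context, and let $\mathcal{U}_{\mathcal{P},\mathcal{Q}}:=\mathcal{S}(\Pi)$ be the coset poset defined in the context. Then: (1) $\mathcal{U}_{\mathcal{P},\mathcal{Q}}$ is a semiregular abstract $(n+1)$-polytope, and $\Pi$ is a group of automorphisms of it (acting by right multiplication). (2) The facets of $\mathcal{U}_{\mathcal{P},\mathcal{Q}}$ are copies of $\mathcal{P}$ and $\mathcal{Q}$ appearing alternately: each ridge (face of rank $n-1$) is a copy of $\mathcal{K}$ and lies in exactly one facet of type $\mathcal{P}$ and exactly one facet of type $\mathcal{Q}$. (3) For each $(n-2)$-face $\mathcal{R}$, the section $\mathcal{U}_{\mathcal{P},\mathcal{Q}}/\mathcal{R}$ (the co-face at $\mathcal{R}$) is an apeirogon $\{\infty\}$ (the infinite $2$-polytope). (4) $\mathcal{U}_{\mathcal{P},\mathcal{Q}}$ is regular if and only if $\mathcal{P}$ and $\mathcal{Q}$ are isomorphic. In this case $\Gamma(\mathcal{U}_{\mathcal{P},\mathcal{Q}})=\Pi\rtimes C_2$; otherwise $\Gamma(\mathcal{U}_{\mathcal{P},\mathcal{Q}})=\Pi$.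
   Context: **Polytopes.** An abstract $n$-polytope is a poset with: (A) a strictly monotone rank function with range $\{-1,0,\dots,n\}$, a unique least face $F_{-1}$, a unique greatest face $F_n$, and every maximal chain (flag) containing exactly $n+2$ faces; (B) whenever $F<G$ with $\mathrm{rank}(F)=j-1$, $\mathrm{rank}(G)=j+1$, there are exactly two $j$-faces $H$ with $F<H<G$; (C) for every section $G/F:=\{H: F\le H\le G\}$ the flag graph (flags adjacent when they differ in exactly one face) is connected. Faces of rank $0$, $n-1$, $n-2$ of an $n$-polytope are vertices, facets, ridges (so in an $(n+1)$-polytope facets have rank $n$ and ridges rank $n-1$). A face $G$ is identified with the section $G/F_{-1}$; the co-face at $F$ is the section $F_n/F$. $\Gamma(\mathcal{P})$ denotes the automorphism group (order-preserving bijections with order-preserving inverse) of a polytope $\mathcal{P}$. A polytope is regular if its automorphism group is transitive on flags, and semiregular if its facets are regular and its automorphism group is transitive on vertices. **Distinguished generators.** If $\mathcal{P}$ is a regular $n$-polytope with chosen base flag $\Phi$, then $\Gamma(\mathcal{P})$ is generated by involutions $\rho_0,\dots,\rho_{n-1}$, where $\rho_j$ is the unique automorphism mapping $\Phi$ to the flag differing from $\Phi$ exactly in its $j$-face. The subgroup $\langle\rho_0,\dots,\rho_{n-2}\rangle$ is (isomorphic to) the automorphism group of the base facet. **The group $\Pi$.** Fix base flags of $\mathcal{P}$ and $\mathcal{Q}$. The facets of $\mathcal{P}$ and $\mathcal{Q}$ being isomorphic (to $\mathcal{K}$) means that there is an isomorphism between the subgroups generated by the first $n-1$ distinguished generators of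 $\Gamma(\mathcal{P})$ and of $\Gamma(\mathcal{Q})$ matching these generators in order. Using it, identify both subgroups with $\Gamma(\mathcal{K})$ and form $\Pi=\Gamma(\mathcal{P})\ast_{\Gamma(\mathcal{K})}\Gamma(\mathcal{Q})$. Regard $\Gamma(\mathcal{P})=\langle\alpha_0,\dots,\alpha_{n-2},\alpha_{n-1}\rangle$, $\Gamma(\mathcal{Q})=\langle\alpha_0,\dots,\alpha_{n-2},\beta_{n-1}\rangle$, $\Gamma(\mathcal{K})=\langle\alpha_0,\dots,\alpha_{n-2}\rangle$ (distinguished generators in order) as subgroups of $\Pi$. **The poset $\mathcal{S}(\Pi)$.** Its improper faces are two distinct copies $\Pi_{-1},\Pi_{n+1}$ of $\Pi$. For $0\le j\le n-2$ the $j$-faces are all right cosets in $\Pi$ of $\Pi_j:=\langle\alpha_0,\dots,\alpha_{j-1},\alpha_{j+1},\dots,\alpha_{n-1},\beta_{n-1}\rangle$. The $(n-1)$-faces (ridges) are all right cosets of $\Pi_{n-1}:=\langle\alpha_0,\dots,\alpha_{n-2}\rangle$. The $n$-faces (facets) are all right cosets of $\Gamma(\mathcal{P})$ (facets of type $\mathcal{P}$) and all right cosets of $\Gamma(\mathcal{Q})$ (facets of type $\mathcal{Q}$); $\Pi_n$ denotes either of these two subgroups. Put $\Pi_j\nu<\Pi_k\mu$ iff $-1\le j<k\le n+1$ and $\Pi_j\nu\cap\Pi_k\mu\neq\emptyset$; and $\Pi_j\nu\le\Pi_k\mu$ iff $\Pi_j\nu<\Pi_k\mu$ or ($j=k$ and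 $\Pi_j\nu=\Pi_k\mu$). $\Pi$ acts on $\mathcal{S}(\Pi)$ by right multiplication. *)

(* Defs.v *)
From HB Require Import structures.
From mathcomp Require Import all_boot all_order all_algebra.
From mathcomp Require Import all_classical.
From Stdlib Require Import Relation_Operators.

Set Implicit Arguments.
Unset Strict Implicit.
Unset Printing Implicit Defensive.

Import Order.TTheory GRing.Theory Num.Theory.

Local Open Scope classical_set_scope.
Local Open Scope card_scope.

Section Groups.
Local Open Scope group_scope.
Variable G : groupType.
Implicit Types (A H N : set G).

Definition is_subgroup H : Prop :=
  [/\ H 1, (forall x y, H x -> H y -> H (x * y)) & (forall x, H x -> H x^-1)].

Definition generated A : set G := smallest is_subgroup A.

Definition is_normal N : Prop :=
  is_subgroup N /\ forall x g, N x -> N (x ^ g).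

Definition right_coset (A : set G) (g : G) : set G := [set a * g | a in A].

(* The whole group is the internal semidirect product of [N] by [H]. *)
Definition is_semidirect N H : Prop :=
  [/\ is_normal N, is_subgroup H, N `&` H = [set 1] &
      [set x * y | x in N & y in H] = [set: G]].

End Groups.

Definition subgroup_iso (G1 G2 : groupType) (H1 : set G1) (H2 : set G2)
    (phi : G1 -> G2) : Prop :=
  set_bij H1 H2 phi /\
  (forall x y, H1 x -> H1 y -> phi (x * y)%g = (phi x * phi y)%g).

(* [amalgam H phi] is the amalgamated product of [G1] and [G2] over the subgroup
   [H] of [G1]; [phi], of which only the restriction to [H] matters, identifies
   [H] with a subgroup of [G2].  It is the monoid of words in the letters
   [G1 + G2] modulo the congruence generated by the multiplication tables of [G1]
   and [G2] and by [h = phi h] for [h] in [H]. *)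

Section Amalgam.
Local Open Scope group_scope.
Local Open Scope quotient_scope.
Variables (G1 G2 : groupType) (H : set G1) (phi : G1 -> G2).
Implicit Types u v w : seq (G1 + G2).

Inductive amalgam_eq : seq (G1 + G2) -> seq (G1 + G2) -> Prop :=
| amalgam_refl u : amalgam_eq u u
| amalgam_sym u v : amalgam_eq u v -> amalgam_eq v u
| amalgam_trans u v w : amalgam_eq u v -> amalgam_eq v w -> amalgam_eq u w
| amalgam_cat u u' v v' :
    amalgam_eq u u' -> amalgam_eq v v' -> amalgam_eq (u ++ v) (u' ++ v')
| amalgam_one1 : amalgam_eq [:: inl 1] [::]
| amalgam_one2 : amalgam_eq [:: inr 1] [::]
| amalgam_mul1 x y : amalgam_eq [:: inl x; inl y] [:: inl (x * y)]
| amalgam_mul2 x y : amalgam_eq [:: inr x; inr y] [:: inr (x * y)]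
| amalgam_glue h : H h -> amalgam_eq [:: inl h] [:: inr (phi h)].

Definition amalgam_rel : rel (seq (G1 + G2)) := fun u v => `[< amalgam_eq u v >].

Fact amalgam_rel_refl : reflexive amalgam_rel.
Proof. by move=> u; apply/asboolP; exact: amalgam_refl. Qed.

Fact amalgam_rel_sym : symmetric amalgam_rel.
Proof. by move=> u v; apply/asboolP/asboolP; exact: amalgam_sym. Qed.

Fact amalgam_rel_trans : transitive amalgam_rel.
Proof.
by move=> v u w /asboolP uv /asboolP vw; apply/asboolP; exact: amalgam_trans uv vw.
Qed.

Canonical amalgam_equiv :=
  EquivRel amalgam_rel amalgam_rel_refl amalgam_rel_sym amalgam_rel_trans.

Definition amalgam := {eq_quot amalgam_equiv}.

HB.instance Definition _ := Choice.on amalgam.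

Definition amalgam_mul (x y : amalgam) : amalgam :=
  \pi_amalgam (repr x ++ repr y).

Definition amalgam_one : amalgam := \pi_amalgam [::].

Definition inv_letter (a : G1 + G2) : G1 + G2 :=
  match a with inl x => inl x^-1 | inr y => inr y^-1 end.

Definition amalgam_inv (x : amalgam) : amalgam :=
  \pi_amalgam (rev [seq inv_letter a | a <- repr x]).

Lemma amalgam_piP u v :
  \pi_amalgam u = \pi_amalgam v <-> amalgam_eq u v.
Proof. by split=> [/eqmodP/asboolP|uv] //; apply/eqmodP/asboolP. Qed.

Lemma amalgam_reprK u : amalgam_eq (repr (\pi_amalgam u)) u.
Proof. by apply/amalgam_piP; rewrite reprK. Qed.

Lemma amalgam_piM u v :
  amalgam_mul (\pi_amalgam u) (\pi_amalgam v) = \pi_amalgam (u ++ v).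
Proof. by apply/amalgam_piP/amalgam_cat; exact: amalgam_reprK. Qed.

Fact amalgam_mulA : associative amalgam_mul.
Proof.
elim/quotW=> u; elim/quotW=> v; elim/quotW=> w.
by rewrite (amalgam_piM v w) (amalgam_piM u v) !amalgam_piM catA.
Qed.

Fact amalgam_mul1g : left_id amalgam_one amalgam_mul.
Proof. by elim/quotW=> u; rewrite amalgam_piM. Qed.

Fact amalgam_mulg1 : right_id amalgam_one amalgam_mul.
Proof. by elim/quotW=> u; rewrite amalgam_piM cats0. Qed.

Lemma inv_letterK : involutive inv_letter.
Proof. by case=> x /=; rewrite invgK. Qed.

Lemma amalgam_letterV a : amalgam_eq [:: inv_letter a; a] [::].
Proof.
case: a => x /=; apply: amalgam_trans.
- exact: amalgam_mul1.
- by rewrite mulVg; exact: amalgam_one1.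
- exact: amalgam_mul2.
- by rewrite mulVg; exact: amalgam_one2.
Qed.

Lemma amalgam_wordV u :
  amalgam_eq (rev [seq inv_letter a | a <- u] ++ u) [::].
Proof.
elim: u => [|a u IHu]; first exact: amalgam_refl.
rewrite /= rev_cons cat_rcons.
apply: amalgam_trans IHu; apply: amalgam_cat; first exact: amalgam_refl.
rewrite -[inv_letter a :: _]/([:: inv_letter a; a] ++ u) -[X in amalgam_eq _ X]cat0s.
apply: amalgam_cat; [exact: amalgam_letterV | exact: amalgam_refl].
Qed.

Fact amalgam_mulVg : left_inverse amalgam_one amalgam_inv amalgam_mul.
Proof.
move=> x; rewrite -[X in amalgam_mul _ X]reprK amalgam_piM.
by apply/amalgam_piP; exact: amalgam_wordV.
Qed.

Fact amalgam_mulgV : right_inverse amalgam_one amalgam_inv amalgam_mul.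
Proof.
move=> x; rewrite -[X in amalgam_mul X _]reprK amalgam_piM; apply/amalgam_piP.
set u := repr x.
have {1}-> : u = rev [seq inv_letter a | a <- rev [seq inv_letter a | a <- u]].
  by rewrite map_rev revK mapK //; exact: inv_letterK.
exact: amalgam_wordV.
Qed.

HB.instance Definition _ := isGroup.Build amalgam
  amalgam_mulA amalgam_mul1g amalgam_mulg1 amalgam_mulVg amalgam_mulgV.

Definition amalgam_inl (x : G1) : amalgam := \pi_amalgam [:: inl x].
Definition amalgam_inr (y : G2) : amalgam := \pi_amalgam [:: inr y].

End Amalgam.

(* Raw data only: that [le] is a partial order is part of [is_polytope]. *)
Record rankedRel := RankedRel {
  face :> Type;
  le : face -> face -> Prop;
  rank : face -> int
}.
Arguments le {_}.
Arguments rank {_}.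

Section Polytopes.
Local Open Scope ring_scope.
Variable X : rankedRel.
Implicit Types (F G H : X) (C D : set X).

Definition lt F G : Prop := le F G /\ F <> G.

Definition is_partial_order : Prop :=
  [/\ (forall F, le F F),
      (forall F G, le F G -> le G F -> F = G) &
      (forall F G H, le F G -> le G H -> le F H)].

Definition is_least F : Prop := forall G, le F G.
Definition is_greatest F : Prop := forall G, le G F.

Definition is_flag C : Prop :=
  total_on C le /\
  forall D, total_on D le -> C `<=` D -> D `<=` C.

Definition flag_adjacent C D : Prop :=
  [/\ is_flag C, is_flag D &
      exists F G, C `\` D = [set F] /\ D `\` C = [set G]].

Definition flag_connected : Prop :=
  forall C D, is_flag C -> is_flag D -> clos_refl_trans (set X) flag_adjacent C D.

(* The section [G/F]; ranks are shifted so that [F] gets rank [-1]. *)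
Definition section F G : rankedRel :=
  {| face := {H : X | le F H /\ le H G};
     le := fun A B => le (sval A) (sval B);
     rank := fun A => rank (sval A) - rank F - 1 |}.

End Polytopes.

Section PolytopeAxioms.
Local Open Scope ring_scope.

Definition is_polytope (n : nat) (X : rankedRel) : Prop :=
  [/\ is_partial_order X,
      (forall F G : X, lt F G -> rank F < rank G) /\
        range (@rank X) = [set i : int | -1 <= i <= n%:Z],
      [/\ exists! F : X, is_least F,
          exists! F : X, is_greatest F &
          forall C : set X, is_flag C -> C #= `I_n.+2],
      (forall (j : int) (F G : X), lt F G -> rank F = j - 1 -> rank G = j + 1 ->
         [set H : X | [/\ rank H = j, lt F H & lt H G]] #= `I_2) &
      forall F G : X, le F G -> flag_connected (section F G)].

End PolytopeAxioms.

Definition isomorphic (X Y : rankedRel) : Prop :=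
  exists f : X -> Y, bijective f /\ forall F G, le (f F) (f G) <-> le F G.

Section Automorphisms.
Variable X : rankedRel.

Record aut := Aut {
  aut_fun :> X -> X;
  aut_inv_fun : X -> X;
  aut_funK : cancel aut_fun aut_inv_fun;
  aut_inv_funK : cancel aut_inv_fun aut_fun;
  aut_le : forall F G, le (aut_fun F) (aut_fun G) <-> le F G
}.

Lemma aut_eq (f g : aut) : f =1 g -> f = g.
Proof.
case: f g => [f f' fK f'K fle] [g g' gK g'K gle] /= /funext efg; subst g.
have efg' : f' = g' by apply: funext => F; rewrite -[F in LHS]g'K fK.
by subst g'; congr Aut; exact: Prop_irrelevance.
Qed.

HB.instance Definition _ := gen_eqMixin aut.
HB.instance Definition _ := gen_choiceMixin aut.

Definition aut_one : aut.
Proof. by exists id id. Defined.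

(* Automorphisms act on the right: [f * g] is [f] followed by [g]. *)
Definition aut_mul (f g : aut) : aut.
Proof.
exists (g \o f) (aut_inv_fun f \o aut_inv_fun g).
- exact: can_comp (aut_funK g) (aut_funK f).
- exact: can_comp (aut_inv_funK f) (aut_inv_funK g).
- by move=> F G; split=> [/aut_le/aut_le|] // FG; apply/aut_le/aut_le.
Defined.

Definition aut_inv (f : aut) : aut.
Proof.
exists (aut_inv_fun f) f; [exact: aut_inv_funK | exact: aut_funK |].
move=> F G; rewrite -[F in X in _ <-> X](aut_inv_funK f).
by rewrite -[G in X in _ <-> X](aut_inv_funK f); apply: iff_sym; exact: aut_le.
Defined.

Fact aut_mulA : associative aut_mul.
Proof. by move=> f g h; exact: aut_eq. Qed.

Fact aut_mul1 : left_id aut_one aut_mul.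
Proof. by move=> f; exact: aut_eq. Qed.

Fact aut_mulr1 : right_id aut_one aut_mul.
Proof. by move=> f; exact: aut_eq. Qed.

Fact aut_mulV : left_inverse aut_one aut_inv aut_mul.
Proof. by move=> f; apply: aut_eq => F /=; exact: aut_inv_funK. Qed.

Fact aut_mulrV : right_inverse aut_one aut_inv aut_mul.
Proof. by move=> f; apply: aut_eq => F /=; exact: aut_funK. Qed.

HB.instance Definition _ := isGroup.Build aut
  aut_mulA aut_mul1 aut_mulr1 aut_mulV aut_mulrV.

End Automorphisms.

Section Regularity.
Local Open Scope ring_scope.

Definition is_regular (n : nat) (X : rankedRel) : Prop :=
  is_polytope n X /\
  forall C D : set X, is_flag C -> is_flag D -> exists f : aut X, f @` C = D.

Definition is_semiregular (n : nat) (X : rankedRel) : Prop :=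
  [/\ is_polytope n X,
      (forall B F : X, is_least B -> rank F = n%:Z - 1 ->
         is_regular n.-1 (section B F)) &
      forall F G : X, rank F = 0 -> rank G = 0 -> exists f : aut X, f F = G].

Definition is_apeirogon (X : rankedRel) : Prop :=
  is_polytope 2 X /\ infinite_set [set: X].

(* [f] maps the flag [C] to the flag differing from it exactly in its [j]-face. *)
Definition is_distinguished (X : rankedRel) (C : set X) (j : nat) (f : aut X) : Prop :=
  f @` C <> C /\ forall F : X, rank F <> j%:Z -> ((f @` C) F <-> C F).

End Regularity.

(* [W] stands for the amalgamated product, [GP] and [GQ] for the two factors as subgroups
   of [W], [alpha j] ([j < n]) and [beta] for the generators. *)

Section CosetPoset.
Local Open Scope ring_scope.
Variables (W : groupType) (n : nat) (GP GQ : set W) (alpha : nat -> W) (beta : W).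

Definition low_subgroup (j : nat) : set W :=
  generated ([set alpha i | i in [set i | (i < n)%N /\ i <> j]] `|` [set beta]).

Definition ridge_subgroup : set W :=
  generated [set alpha i | i in [set i | (i.+1 < n)%N]].

Inductive is_coset_face : int -> set W -> Prop :=
| coset_face_least : is_coset_face (-1) setT
| coset_face_low j w :
    (j.+1 < n)%N -> is_coset_face j%:Z (right_coset (low_subgroup j) w)
| coset_face_ridge w : is_coset_face (n%:Z - 1) (right_coset ridge_subgroup w)
| coset_face_facetP w : is_coset_face n%:Z (right_coset GP w)
| coset_face_facetQ w : is_coset_face n%:Z (right_coset GQ w)
| coset_face_greatest : is_coset_face (n%:Z + 1) setT.

(* The rank is part of a face: equal subsets of different ranks are different faces. *)
Record coset_face := CosetFace {
  coset_rank : int;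
  coset_set : set W;
  coset_faceP : is_coset_face coset_rank coset_set
}.

Definition coset_lt (F G : coset_face) : Prop :=
  coset_rank F < coset_rank G /\ coset_set F `&` coset_set G !=set0.

Definition coset_le (F G : coset_face) : Prop :=
  coset_lt F G \/ (coset_rank F = coset_rank G /\ coset_set F = coset_set G).

Definition coset_poset : rankedRel :=
  {| face := coset_face; le := coset_le; rank := coset_rank |}.

Definition coset_bot : coset_poset := CosetFace coset_face_least.
Definition coset_top : coset_poset := CosetFace coset_face_greatest.

Definition typeP (F : coset_poset) : Prop :=
  rank F = n%:Z /\ exists w, coset_set F = right_coset GP w.

Definition typeQ (F : coset_poset) : Prop :=
  rank F = n%:Z /\ exists w, coset_set F = right_coset GQ w.

Definition acts_by_right_mul (act : W -> aut coset_poset) : Prop :=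
  forall (w : W) (F : coset_poset),
    rank (act w F) = rank F /\ coset_set (act w F) = right_coset (coset_set F) w.

End CosetPoset.

Section Universal.
Variables (n : nat) (P Q : rankedRel).
Variables (rho : nat -> aut P) (sigma : nat -> aut Q) (phi : aut P -> aut Q).

Definition facet_group (X : rankedRel) (gen : nat -> aut X) : set (aut X) :=
  generated [set gen j | j in [set j | (j.+1 < n)%N]].

Definition matches_facets : Prop :=
  subgroup_iso (facet_group rho) (facet_group sigma) phi /\
  forall j, (j.+1 < n)%N -> phi (rho j) = sigma j.

Definition Pi : groupType := amalgam (facet_group rho) phi.

Definition groupP : set Pi := range (amalgam_inl (facet_group rho) phi).
Definition groupQ : set Pi := range (amalgam_inr (facet_group rho) phi).

Definition universal : rankedRel :=
  coset_poset n groupP groupQ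
    (fun j => amalgam_inl (facet_group rho) phi (rho j))
    (amalgam_inr (facet_group rho) phi (sigma n.-1)).

End Universal.

(* Main.v *)
Require Import Defs.
From HB Require Import structures.
From mathcomp Require Import all_boot all_order all_algebra.
From mathcomp Require Import all_classical.
From mathcomp Require Import zify.
From Stdlib Require Import Relation_Operators Operators_Properties.
Import Order.TTheory GRing.Theory Num.Theory.
Local Open Scope classical_set_scope.
Local Open Scope card_scope.
Local Open Scope ring_scope.

Set Implicit Arguments.
Unset Strict Implicit.
Unset Printing Implicit Defensive.

(** The faces of the poset are cosets in the amalgam [W] of the automorphism groups of [P]
    and [Q] over that of their common facet, so everything comes down to how the face
    subgroups of [W] intersect each other and the two factors.

    About a single regular polytope four facts are used.  Polytopes are strongly
    flag-connected ([strong_connected]), automorphisms are determined by the image of one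
    flag ([aut_rigid]), the stabilizer of any set of base faces is generated by the
    distinguished generators that fix these faces ([stabilizer_generated]), and generators
    whose indices differ by at least two commute ([gen_comm]).  In particular a regular
    polytope is the coset poset of its own group.

    About the amalgam one needs that a reduced word of length at least two lies in neither
    factor ([amalgam_free]); this follows from the action on normal forms.  The subgroup of
    [W] attached to a face of low rank is generated by the stabilizers, in [P] and in [Q],
    of a base face, and these stabilizers have the same trace on the amalgamated subgroup.
    Cancelling words from the middle shows that two such subgroups [A] and [B] satisfy:
    what is in [A * B] and in a factor is already a product of an element of [A] and an
    element of [B] in this factor ([join_quotient]).

    Hence the faces below a facet form a copy of [P] or [Q] ([facet_iso]), and the
    polytope axioms only have to be checked for intervals that end at the greatest face.
    There are exactly two facets
    above a ridge, one of each type, and the co-faces are connected because the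
    subgroup of a face is generated by its intersections with the factors ([U_connected]).
    The co-face at a face of rank [n - 2] is infinite since the product of the two last
    generators has infinite order modulo a factor.

    Finally [W] is transitive on the flags through facets of a given type ([act_flags]).  By
    rigidity, an automorphism outside [W] must exchange the types of facets, and then [P]
    and [Q] are isomorphic.  Conversely an isomorphism may be chosen to match base flags;
    it then matches the distinguished generators, extends the identification of the
    amalgamated subgroups, and induces an involution of [W] exchanging the factors
    ([amalgam_swap]), hence an involution of the poset that normalises [W]. *)

(** * Subgroups and cosets *)

Section GroupFacts.
Local Open Scope group_scope.
Variable G : groupType.
Implicit Types (A B : set G) (x y : G).

Lemma generated_subgroup A : is_subgroup (generated A).
Proof.
split=> [B [[]]//|x y Ax Ay B hB|x Ax B hB].
  by have [_ h _] := hB.1; apply: h; [exact: Ax | exact: Ay].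
by have [_ _ h] := hB.1; apply: h; exact: Ax.
Qed.

Lemma generated_sub A : A `<=` generated A.
Proof. by move=> x Ax B [_]; exact. Qed.

Lemma generated_min A B : is_subgroup B -> A `<=` B -> generated A `<=` B.
Proof. by move=> sB AB x; exact. Qed.

Lemma subgroup_mulr A k x : is_subgroup A -> A k -> A (k * x) -> A x.
Proof.
by move=> [_ AM AV] Ak Akx; rewrite -(mulKg k x); apply: AM => //; exact: AV.
Qed.

End GroupFacts.

Section MoreGroupFacts.
Local Open Scope group_scope.

Lemma image_generated (G1 G2 : groupType) (f : G1 -> G2) (A : set G1) :
  {morph f : x y / x * y} -> f @` generated A = generated (f @` A).
Proof.
move=> fM.
have f1 : f 1 = 1 by apply: (@mulIg _ (f 1)); rewrite -fM !mul1g.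
have fV x : f x^-1 = (f x)^-1.
  by apply: (@mulIg _ (f x)); rewrite -fM !mulVg f1.
have [g1 gM gV] := generated_subgroup A.
have [h1 hM hV] := generated_subgroup (f @` A).
apply/seteqP; split=> [_ [x Ax <-]|].
  move: x Ax; apply: generated_min => [|x Ax]; last by apply: generated_sub; exists x.
  by split=> [|x y|x] /=; rewrite ?f1 ?fM ?fV; auto.
apply: generated_min => [|_ [x Ax <-]]; last by exists x => //; exact: generated_sub.
split; first by exists 1.
- by move=> _ _ [x Ax <-] [y Ay <-]; exists (x * y); [exact: gM | exact: fM].
- by move=> _ [x Ax <-]; exists x^-1; [exact: gV | exact: fV].
Qed.

Section Cosets.
Variable W : groupType.
Implicit Types (A : set W) (x y w : W).

Lemma right_cosetP A w x : right_coset A w x <-> A (x * w^-1).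
Proof.
split=> [[a Aa <-]|Ax]; first by rewrite mulgK.
by exists (x * w^-1); rewrite ?mulgVK.
Qed.

Lemma right_cosetM A x y : right_coset (right_coset A x) y = right_coset A (x * y).
Proof. by apply/seteqP; split=> z; rewrite !right_cosetP invgM mulgA. Qed.

Lemma right_coset1 A : right_coset A 1 = A.
Proof. by apply/seteqP; split=> z; rewrite right_cosetP invg1 mulg1. Qed.

Lemma right_cosetT x : right_coset [set: W] x = [set: W].
Proof. by apply/seteqP; split=> z // _; rewrite right_cosetP. Qed.

Lemma right_coset_mem A x y : is_subgroup A -> right_coset A x y ->
  right_coset A x = right_coset A y.
Proof.
move=> [A1 AM AV] [a Aa <-]; apply/seteqP; split=> z; rewrite !right_cosetP invgM mulgA.
  by move=> Az; apply: AM => //; exact: AV.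
by move=> /AM /(_ Aa); rewrite mulgVK.
Qed.

Lemma right_coset_refl A x : is_subgroup A -> right_coset A x x.
Proof. by move=> [A1 _ _]; rewrite right_cosetP mulgV. Qed.

End Cosets.
End MoreGroupFacts.

(** * Graded posets and their flags *)

Lemma card_II_surj (T : Type) (C : set T) (k : nat) (f : T -> nat) :
  C #= `I_k -> {in C &, injective f} -> (forall x, C x -> (f x < k)%N) ->
  forall j, (j < k)%N -> exists2 x, C x & f x = j.
Proof.
move=> Ck finj fk j jk; apply: contrapT => nj.
(* closing the gap left by a missing value [j] squeezes [k] elements into [k.-1] *)
pose h i := (i - (j < i))%N.
have hinj : {in C &, injective (h \o f)}.
  move=> x y xC yC /= hxy; apply: finj => //.
  have fx : f x <> j by move=> e; apply: nj; exists x => //; apply: set_mem.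
  have fy : f y <> j by move=> e; apply: nj; exists y => //; apply: set_mem.
  by move: hxy; rewrite /h; case: (ltnP j (f x)); case: (ltnP j (f y)); lia.
have : `I_k #<= `I_k.-1.
  rewrite (card_le_trans (B := C)) //; first by rewrite card_eq_le in Ck; case/andP: Ck.
  apply: (@card_le_trans _ _ _ ((h \o f) @` C)).
    by have := inj_card_eq hinj; rewrite card_eq_le => /andP[].
  apply: subset_card_le => _ [x Cx <-] /=.
  have fx : f x <> j by move=> e; apply: nj; exists x.
  by have := fk _ Cx; rewrite /h; case: (ltnP j (f x)); lia.
by rewrite card_le_II; lia.
Qed.

Lemma card_I2P (T : Type) (A : set T) :
  A #= `I_2 <-> exists a b, a <> b /\ A = [set a; b].
Proof.
split=> [/card_set_bijP[f [fA finj fsurj]]|[a [b [ab ->]]]].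
  have [a Aa fa] := fsurj 0%N isT; have [b Ab fb] := fsurj 1%N isT.
  exists a, b; split=> [e|]; first by rewrite e fb in fa.
  apply/seteqP; split=> [x Ax|x [->|->]//].
  have := fA _ Ax; rewrite /=; case efx: (f x) => [|[|//]] _.
    by left; apply: finj; rewrite ?inE ?fa.
  by right; apply: finj; rewrite ?inE ?fb.
apply/card_set_bijP; exists (fun x => `[< x = b >] : nat); split.
- by move=> x _ /=; case: asboolP.
- by move=> x y; rewrite !inE => -[->|->] [->|->];
    do 2 (case: asboolP => //); move=> *; subst.
- move=> [|[|//]] _ /=.
    by exists a; [left | case: asboolP].
  by exists b; [right | case: asboolP].
Qed.

Lemma chain_extend (X : rankedRel) (C : set X) :
  (forall F : X, le F F) -> total_on C le -> exists2 D, is_flag D & C `<=` D.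
Proof.
move=> lexx totC.
have [|A [totA maxA]] := @Zorn_bigcup X (fun D => total_on (C `|` D) le).
  move=> F FP totF x y [Cx|[A FA Ax]] [Cy|[B FB By]].
  - exact: totC.
  - by apply: (FP _ FB); [left | right].
  - by apply: (FP _ FA); [right | left].
  - have [AB|BA] := totF _ _ FA FB.
      by apply: (FP _ FB); right => //; exact: AB.
    by apply: (FP _ FA); right => //; exact: BA.
exists (C `|` A); last by move=> x; left.
split=> // D totD CAD x Dx; apply: contrapT => nx.
apply: (maxA (A `|` [set x])).
  split=> [y Ay|h]; first by left.
  by apply: nx; right; apply: h; right.
suff: C `|` (A `|` [set x]) `<=` D.
  by move=> sub y z Hy Hz; apply: totD; exact: sub.
by move=> y [Cy|[Ay|->//]]; apply: CAD; [left | right].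
Qed.

(** What the polytope axioms say about ranks, with density in place of the size of
    flags: unlike the latter it passes at once to sections.  The top rank is an integer,
    so that a section [F/F], of top rank [-1], is covered. *)
Record graded (m : int) (X : rankedRel) : Prop := Graded {
  graded_po : is_partial_order X;
  graded_lt : forall F G : X, lt F G -> rank F < rank G;
  graded_range : forall F : X, -1 <= rank F <= m;
  graded_bot : exists2 F : X, is_least F & rank F = -1;
  graded_top : exists2 F : X, is_greatest F & rank F = m;
  graded_dense : forall (F G : X) j, lt F G -> rank F < j < rank G ->
    exists H, [/\ rank H = j, lt F H & lt H G]
}.

Section GradedTheory.
Variables (m : int) (X : rankedRel).
Hypothesis hX : graded m X.
Implicit Types (F G H : X) (C D : set X).

Lemma le_refl F : le F F. Proof. by have [r _ _] := graded_po hX; exact: r. Qed.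
Lemma le_anti F G : le F G -> le G F -> F = G.
Proof. by have [_ a _] := graded_po hX; exact: a. Qed.
Lemma le_tr F G H : le F G -> le G H -> le F H.
Proof. by have [_ _ t] := graded_po hX; exact: t. Qed.
Lemma lt_le F G : lt F G -> le F G. Proof. by case. Qed.

Lemma le_eq_or_lt F G : le F G -> F = G \/ lt F G.
Proof. by move=> FG; have [->|ne] := pselect (F = G); [left | right]. Qed.

Lemma le_rank F G : le F G -> rank F <= rank G.
Proof. by move=> /le_eq_or_lt[->//|/(graded_lt hX)/ltW]. Qed.

Lemma le_rank_eq F G : le F G -> rank F = rank G -> F = G.
Proof. by move=> /le_eq_or_lt[->//|/(graded_lt hX)]; lia. Qed.

Lemma le_rank_lt F G : le F G -> rank F < rank G -> lt F G.
Proof. by move=> FG r; split=> // e; rewrite e ltxx in r. Qed.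

Lemma chain_inj C F G : total_on C le -> C F -> C G -> rank F = rank G -> F = G.
Proof.
by move=> t CF CG e; have [/le_rank_eq->|/le_rank_eq->] := t _ _ CF CG.
Qed.

Lemma chain_le C F G : total_on C le -> C F -> C G -> rank F <= rank G -> le F G.
Proof.
move=> t CF CG e; have [//|GF] := t _ _ CF CG.
have := le_rank GF => e'; rewrite (@le_rank_eq _ _ GF); [exact: le_refl | lia].
Qed.

Lemma chain_lt C F G : total_on C le -> C F -> C G -> rank F < rank G -> lt F G.
Proof. by move=> t CF CG e; apply: le_rank_lt => //; apply: (chain_le t) => //; lia. Qed.

(** A maximal chain missing rank [j] would have a largest element of rank below [j] and
    a least one of rank above [j]; a face of rank [j] between them extends it. *)
Lemma flagP C : is_flag C <->
  total_on C le /\ forall j, -1 <= j <= m -> exists2 F, C F & rank F = j.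
Proof.
split=> [[totC maxC]|[totC allC]]; last first.
  split=> // D totD CD G DG; have [F CF rF] := allC _ (graded_range hX G).
  by rewrite (chain_inj totD DG (CD _ CF)).
have add H : (forall F, C F -> le F H \/ le H F) -> C H.
  move=> hH; apply: (maxC (C `|` [set H])); last by right.
    move=> x y [Cx|->] [Cy|->]; [exact: totC|exact: hH| |by left; exact: le_refl].
    by have [] := hH _ Cy; [right|left].
  by move=> x; left.
split=> // j jm.
have [b bl rb] := graded_bot hX; have [t tg rt] := graded_top hX.
have Cb : C b by apply: add => F _; right; exact: bl.
have Ct : C t by apply: add => F _; left; exact: tg.
apply: contrapT => nj.
pose below (k : nat) := `[< exists2 F, C F & rank F = k%:Z - 1 /\ rank F <= j >].
pose above (k : nat) := `[< exists2 F, C F & rank F = j + k%:Z >].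
have exb : exists k, below k by exists 0%N; apply/asboolP; exists b; rewrite ?rb //; lia.
have exa : exists k, above k.
  by exists `|m - j|%N; apply/asboolP; exists t; rewrite ?rt //; lia.
have bound k : below k -> (k <= `|(j + 1)%R|%N)%N.
  by move=> /asboolP[F _ [rF Fj]]; lia.
case: (ex_maxnP exb bound) => k /asboolP[A CA [rA Aj]] maxA.
case: (ex_minnP exa) => l /asboolP[B CB rB] minB.
have nA : rank A <> j by move=> e; apply: nj; exists A.
have nB : rank B <> j by move=> e; apply: nj; exists B.
have [H [rH AH HB]] : exists H, [/\ rank H = j, lt A H & lt H B].
  by apply: (graded_dense hX); [apply: (chain_lt totC) => //; lia | lia].
apply: nj; exists H => //; apply: add => F CF.
have := graded_range hX F => rF.
have [Fj|jF] := lerP (rank F) j.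
  left; apply: le_tr (lt_le AH); apply: (chain_le totC) => //.
  have : (`|(rank F + 1)%R|%N <= k)%N by apply: maxA; apply/asboolP; exists F => //; lia.
  lia.
right; apply: le_tr (lt_le HB) _; apply: (chain_le totC) => //.
have : (l <= `|(rank F - j)%R|%N)%N by apply: minB; apply/asboolP; exists F => //; lia.
lia.
Qed.

End GradedTheory.

Definition diamond (X : rankedRel) : Prop :=
  forall (j : int) (F G : X), lt F G -> rank F = j - 1 -> rank G = j + 1 ->
    [set H : X | [/\ rank H = j, lt F H & lt H G]] #= `I_2.

Definition sections_connected (X : rankedRel) : Prop :=
  forall F G : X, le F G -> flag_connected (section F G).

(** Density comes from flags having [n + 2] elements: the rank is injective on a flag
    through [F] and [G] and so takes every value from [-1] to [n] on it. *)
Lemma polytopeP (n : nat) (X : rankedRel) :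
  is_polytope n X <-> [/\ graded n%:Z X, diamond X & sections_connected X].
Proof.
split=> [[po [ltr rng] [[b [bl _]] [t [tg _]] cards] dia con]|[gX dia con]].
  have [le_r anti tr] := po.
  have rF (F : X) : -1 <= rank F <= n%:Z.
    have : range (@rank X) (rank F) by exists F.
    by rewrite rng.
  have ler (F G : X) : le F G -> rank F <= rank G.
    move=> FG; have [->|ne] := pselect (F = G); first exact: lexx.
    by apply: ltW; apply: ltr; split.
  split=> //; split=> //.
  - exists b => //; have : range (@rank X) (-1) by rewrite rng /=; lia.
    by move=> [F _ rF1]; have := ler _ _ (bl F); have := rF b; lia.
  - exists t => //; have : range (@rank X) n%:Z by rewrite rng /=; lia.
    by move=> [F _ rF1]; have := ler _ _ (tg F); have := rF t; lia.
  - move=> F G j FG jr.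
    have [||C fC sub] := @chain_extend X [set F; G]; first exact: le_r.
      move=> x y [->|->] [->|->]; [left|left|right|left]; try exact: le_r.
        by case: FG.
      by case: FG.
    have totC := fC.1.
    have finj : {in C &, injective (fun H : X => `|(rank H + 1)%R|%N)}.
      move=> x y /set_mem Cx /set_mem Cy e; apply: contrapT => ne.
      have := rF x; have := rF y.
      have [xy|yx] := totC _ _ Cx Cy.
        by have := ltr x y (conj xy ne); lia.
      by have := ltr y x (conj yx (fun e => ne (esym e))); lia.
    have [||H CH rH] := @card_II_surj _ _ _ _ (cards _ fC) finj _ `|(j + 1)%R|%N.
    + by move=> x _; have := rF x; lia.
    + by have := rF F; have := rF G; lia.
    have rHj : rank H = j by have := rF H; have := rF F; lia.
    exists H; split=> //.
      have [[//|HF] ne] : (le F H \/ le H F) /\ F <> H.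
        by split; [apply: totC => //; apply: sub; left | move=> e; subst H; lia].
      by have := ler _ _ HF; lia.
    have [[//|HF] ne] : (le H G \/ le G H) /\ H <> G.
      by split; [apply: totC => //; apply: sub; right | move=> e; subst H; lia].
    by have := ler _ _ HF; lia.
have [b bl rb] := graded_bot gX; have [t tg rt] := graded_top gX.
have ex_flag : exists C : set X, is_flag C.
  have [||C fC _] := @chain_extend X set0; [exact: le_refl gX|by []|by exists C].
split=> //.
- exact: graded_po gX.
- split; first exact: graded_lt gX.
  apply/seteqP; split=> [_ [F _ <-]|j /= jr]; first exact: graded_range gX F.
  have [C fC] := ex_flag; have [_ /(_ _ jr)[F _ rF]] := (flagP gX C).1 fC.
  by exists F.
- split.
  + by exists b; split=> // F Fl; apply: (le_anti gX); auto.
  + by exists t; split=> // F Fl; apply: (le_anti gX); auto.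
  + move=> C /(flagP gX)[totC allC].
    apply/card_set_bijP; exists (fun H : X => `|(rank H + 1)%R|%N); split.
    * by move=> F _ /=; have := graded_range gX F; lia.
    * move=> F G /set_mem CF /set_mem CG e; apply: (chain_inj gX totC) => //.
      by have := graded_range gX F; have := graded_range gX G; lia.
    * move=> k /= kn; have [|F CF rF] := allC (k%:Z - 1); first by lia.
      by exists F; rewrite // rF; lia.
Qed.

(** * Isomorphisms *)

Definition is_iso (X Y : rankedRel) (f : X -> Y) : Prop :=
  bijective f /\ forall F G, le (f F) (f G) <-> le F G.

Lemma is_iso_of_cancel (X Y : rankedRel) (f : X -> Y) (g : Y -> X) :
  cancel f g -> cancel g f -> (forall F G, le F G -> le (f F) (f G)) ->
  (forall F G, le F G -> le (g F) (g G)) -> is_iso f.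
Proof.
move=> fK gK fle gle; split; first by exists g.
by move=> F G; split=> [/gle|/fle//]; rewrite !fK.
Qed.

Lemma iso_inv (X Y : rankedRel) (f : X -> Y) :
  is_iso f -> exists g, [/\ cancel f g, cancel g f & is_iso g].
Proof.
move=> [[g fK gK] fle]; exists g; split=> //; split; first by exists f.
by move=> F G; rewrite -fle !gK.
Qed.

Lemma iso_comp (X Y Z : rankedRel) (f : X -> Y) (g : Y -> Z) :
  is_iso f -> is_iso g -> is_iso (g \o f).
Proof.
move=> [bf fle] [bg gle]; split; first exact: bij_comp.
by move=> F G /=; rewrite gle fle.
Qed.

Lemma iso_inj (X Y : rankedRel) (f : X -> Y) : is_iso f -> injective f.
Proof. by move=> [/bij_inj]. Qed.

Lemma iso_lt (X Y : rankedRel) (f : X -> Y) F G :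
  is_iso f -> lt (f F) (f G) = lt F G.
Proof.
move=> isof; apply/propext; split=> -[/isof.2 FG ne]; split=> // e; apply: ne; rewrite ?e //.
exact: iso_inj isof _ _ e.
Qed.

Lemma aut_is_iso (X : rankedRel) (f : aut X) : is_iso f.
Proof.
split; last exact: aut_le.
by exists (aut_inv_fun f); [exact: aut_funK | exact: aut_inv_funK].
Qed.

Lemma aut_of_iso (X : rankedRel) (f : X -> X) : is_iso f -> exists a : aut X, a =1 f.
Proof. by move=> [[g fK gK] fle]; exists (Aut fK gK fle). Qed.

Definition in_section (X : rankedRel) (F G H : X) (p : le F H /\ le H G) :
  section F G := exist (fun H => le F H /\ le H G) H p.

Lemma section_eq (X : rankedRel) (F G : X) (A B : section F G) :
  sval A = sval B -> A = B.
Proof. by case: A B => [A pA] [B pB] /= e; apply: eq_exist. Qed.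

Section IsoFlags.
Variables (X Y : rankedRel) (f : X -> Y).
Hypothesis isof : is_iso f.

Lemma iso_flag C : is_flag C -> is_flag (f @` C).
Proof.
have [g [fK gK isog]] := iso_inv isof.
move=> [totC maxC]; split.
  by move=> _ _ [x Cx <-] [y Cy <-]; rewrite !isof.2; exact: totC.
move=> D totD CD y Dy; exists (g y) => //.
apply: (maxC (g @` D)); [|move=> x Cx|by exists y].
  by move=> _ _ [a Da <-] [b Db <-]; rewrite !isog.2; exact: totD.
by exists (f x) => //; apply: CD; exists x.
Qed.

Lemma iso_adjacent C D : flag_adjacent C D -> flag_adjacent (f @` C) (f @` D).
Proof.
have finj := iso_inj isof.
move=> [fC fD [F [G [CD DC]]]]; split; try exact: iso_flag.
have imD (A B : set X) H : A `\` B = [set H] -> (f @` A) `\` (f @` B) = [set f H].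
  move=> AB; apply/seteqP; split=> [_ [[x Ax <-] nB]|_ ->].
    suff -> : x = H by [].
    have : (A `\` B) x by split=> // Bx; apply: nB; exists x.
    by rewrite AB.
  have [AH nBH] : (A `\` B) H by rewrite AB.
  by split; [exists H | move=> [x Bx /finj e]; apply: nBH; rewrite -e].
by exists (f F), (f G); split; exact: imD.
Qed.

End IsoFlags.

Section IsoTransfer.
Variables (X Y : rankedRel) (f : X -> Y).
Hypothesis isof : is_iso f.

Lemma iso_flag_connected : flag_connected X -> flag_connected Y.
Proof.
have [g [fK gK isog]] := iso_inv isof.
have fgK (C : set Y) : f @` (g @` C) = C.
  apply/seteqP; split=> [_ [_ [x Cx <-] <-]|x Cx]; first by rewrite gK.
  by exists (g x); [exists x | exact: gK].
move=> con C D fC fD; rewrite -(fgK C) -(fgK D).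
have gflag E := @iso_flag _ _ g isog E.
elim: (con _ _ (gflag _ fC) (gflag _ fD)) => [A B /(iso_adjacent isof)|A|A B E _ h1 _ h2].
- exact: rt_step.
- exact: rt_refl.
- exact: rt_trans h1 h2.
Qed.

Lemma iso_section F G : exists h : section F G -> section (f F) (f G),
  is_iso h /\ forall A, sval (h A) = f (sval A).
Proof.
have [g [fK gK isog]] := iso_inv isof.
have p (A : section F G) : le (f F) (f (sval A)) /\ le (f (sval A)) (f G).
  by rewrite !isof.2; exact: (svalP A).
have q (A : section (f F) (f G)) : le F (g (sval A)) /\ le (g (sval A)) G.
  by rewrite -!isof.2 gK; exact: (svalP A).
exists (fun A => in_section (p A)); split=> //.
apply: (@is_iso_of_cancel _ _ _ (fun A => in_section (q A))).
- by move=> A; apply: section_eq; rewrite /= fK.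
- by move=> A; apply: section_eq; rewrite /= gK.
- by move=> A B; rewrite /= isof.2.
- by move=> A B; rewrite /= isog.2.
Qed.

End IsoTransfer.

Section IsoRanked.
Variables (X Y : rankedRel) (f : X -> Y).
Hypothesis isof : is_iso f.
Hypothesis frank : forall F, rank (f F) = rank F.

Lemma iso_graded m : graded m X -> graded m Y.
Proof.
have [g [fK gK isog]] := iso_inv isof.
have grank F : rank (g F) = rank F by rewrite -frank gK.
move=> gX; split.
- split=> [F|F G|F G H]; rewrite -?isog.2; first exact: le_refl gX _.
    by move=> FG GF; rewrite -(gK F) (le_anti gX FG GF) gK.
  exact: le_tr gX _ _ _.
- by move=> F G; rewrite -(iso_lt _ _ isog) -!grank; exact: graded_lt gX _ _.
- by move=> F; rewrite -grank; exact: graded_range gX _.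
- have [b bl rb] := graded_bot gX; exists (f b); last by rewrite frank.
  by move=> F; rewrite -isog.2 fK.
- have [b bl rb] := graded_top gX; exists (f b); last by rewrite frank.
  by move=> F; rewrite -isog.2 fK.
- move=> F G j; rewrite -(iso_lt _ _ isog) -!grank => FG jr.
  have [H [rH FH HG]] := graded_dense gX FG jr.
  by exists (f H); rewrite frank -!(iso_lt _ _ isog) fK.
Qed.

Lemma iso_diamond : diamond X -> diamond Y.
Proof.
have [g [fK gK isog]] := iso_inv isof.
have grank F : rank (g F) = rank F by rewrite -frank gK.
move=> dX j F G; rewrite -(iso_lt _ _ isog) -!grank => FG rF rG.
have := dX j _ _ FG rF rG; set A := (A in A #= _) => /card_I2P [a [b [ab AE]]].
apply/card_I2P; exists (f a), (f b); split; first by move/(iso_inj isof).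
have AP x : A x <-> x = a \/ x = b by rewrite AE.
apply/seteqP; split=> [x [rx Fx xG]|x hx].
  have /AP : A (g x) by rewrite /A /= grank !(iso_lt _ _ isog).
  by move=> [e|e]; [left | right]; rewrite /= -(gK x) e.
have : A (g x) by apply/AP; case: hx => ->; rewrite fK; auto.
by rewrite /A /= grank !(iso_lt _ _ isog).
Qed.

Lemma iso_polytope n : is_polytope n X -> is_polytope n Y.
Proof.
move=> /polytopeP[gX dX cX]; apply/polytopeP; split.
- exact: iso_graded.
- exact: iso_diamond.
- move=> F G FG; have [g [fK gK isog]] := iso_inv isof.
  have [h [isoh _]] := iso_section isof (g F) (g G).
  rewrite -(gK F) -(gK G); apply: (iso_flag_connected isoh).
  by apply: cX; rewrite isog.2.
Qed.

End IsoRanked.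

(** Only the order is assumed to be preserved; the rank of a face is the length of a
    saturated chain below it, which a strictly increasing map cannot shorten. *)
Lemma iso_rank_le (m m' : int) (X Y : rankedRel) (f : X -> Y) (F : X) :
  graded m X -> graded m' Y -> is_iso f -> rank F <= rank (f F).
Proof.
move=> gX gY isof; have [b bl rb] := graded_bot gX.
have [k] : exists k : nat, rank F = k%:Z - 1.
  by exists `|(rank F + 1)%R|%N; have := graded_range gX F; lia.
elim: k F => [|k IHk] F rF; first by have := graded_range gY (f F); lia.
have bF : lt b F by apply: (le_rank_lt (bl F)); lia.
have [G GF rG] : exists2 G : X, lt G F & rank G = k%:Z - 1.
  case: k {IHk} rF => [|k] rF; first by exists b; rewrite ?rb.
  have [|H [rH _ HF]] := graded_dense gX (j := k.+1%:Z - 1) bF; first by lia.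
  by exists H.
have : lt (f G) (f F) by rewrite iso_lt.
by move=> /(graded_lt gY); have := IHk _ rG; lia.
Qed.

Lemma iso_rank (m : int) (X Y : rankedRel) (f : X -> Y) (F : X) :
  graded m X -> graded m Y -> is_iso f -> rank (f F) = rank F.
Proof.
move=> gX gY isof; have [g [fK gK isog]] := iso_inv isof.
have := iso_rank_le F gX gY isof; have := iso_rank_le (f F) gY gX isog.
by rewrite fK; lia.
Qed.

Lemma aut_rank (m : int) (X : rankedRel) (f : aut X) (F : X) :
  graded m X -> rank (f F) = rank F.
Proof. by move=> gX; exact: (iso_rank _ gX gX (aut_is_iso f)). Qed.

Lemma iso_regular (n : nat) (X Y : rankedRel) (f : X -> Y) :
  is_iso f -> (forall F, rank (f F) = rank F) -> is_regular n X -> is_regular n Y.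
Proof.
move=> isof frank [pX trX]; split; first exact: iso_polytope isof frank _ pX.
have [g [fK gK isog]] := iso_inv isof => C D fC fD.
have [a aCD] := trX _ _ (iso_flag isog fC) (iso_flag isog fD).
have [b bE] := aut_of_iso (iso_comp (iso_comp isog (aut_is_iso a)) isof).
exists b; apply/seteqP; split=> [_ [y Cy <-]|y Dy].
  rewrite bE /=; have : (g @` D) (a (g y)) by rewrite -aCD; exists (g y) => //; exists y.
  by move=> [z Dz <-]; rewrite gK.
have : (a @` (g @` C)) (g y) by rewrite aCD; exists y.
move=> [_ [x Cx <-] e]; exists x => //.
by rewrite bE /= e gK.
Qed.

(** * Sections and the gluing of flags *)

Section Sections.
Variables (m : int) (X : rankedRel).
Hypothesis gX : graded m X.

Lemma section_lt (F G : X) (A B : section F G) : lt A B = lt (sval A) (sval B).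
Proof.
apply/propext; split=> -[AB ne]; split=> // e; apply: ne; last by rewrite e.
exact: section_eq.
Qed.

Lemma section_graded (F G : X) : le F G ->
  graded (rank G - rank F - 1) (section F G).
Proof.
move=> FG; split.
- split=> [A|A B AB BA|A B C AB BC]; first exact: le_refl gX _.
    by apply: section_eq; exact: (le_anti gX AB BA).
  exact: (le_tr gX AB BC).
- by move=> A B; rewrite section_lt => /(graded_lt gX) /=; lia.
- move=> [A [FA AG]] /=; have := le_rank gX FA; have := le_rank gX AG; lia.
- exists (in_section (conj (le_refl gX F) FG)); last by rewrite /=; lia.
  by move=> [A [FA AG]].
- exists (in_section (conj FG (le_refl gX G))); last by rewrite /=; lia.
  by move=> [A [FA AG]].
- move=> A B j; rewrite section_lt => AB jr.
  have [|H [rH AH HB]] := graded_dense gX (j := j + rank F + 1) AB.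
    by move: jr => /=; lia.
  have pH : le F H /\ le H G.
    split; first exact: (le_tr gX (svalP A).1 (lt_le AH)).
    exact: (le_tr gX (lt_le HB) (svalP B).2).
  by exists (in_section pH); rewrite !section_lt /=; split=> //; lia.
Qed.

Lemma section_section (F G : X) (A B : section F G) :
  exists h : section A B -> section (sval A) (sval B),
    is_iso h /\ forall x, sval (h x) = sval (sval x).
Proof.
have p (x : section A B) : le (sval A) (sval (sval x)) /\ le (sval (sval x)) (sval B).
  exact: svalP x.
have q (x : section (sval A) (sval B)) : le F (sval x) /\ le (sval x) G.
  split; first exact: (le_tr gX (svalP A).1 (svalP x).1).
  exact: (le_tr gX (svalP x).2 (svalP B).2).
have r (x : section (sval A) (sval B)) : le A (in_section (q x)) /\ le (in_section (q x)) B.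
  exact: svalP x.
exists (fun x => in_section (p x)); split=> //.
apply: (@is_iso_of_cancel _ _ _ (fun x => in_section (r x))) => //.
  by move=> x; do 2! apply: section_eq.
by move=> x; apply: section_eq.
Qed.

Lemma section_diamond (F G : X) : diamond X -> diamond (section F G).
Proof.
move=> dX j A B; rewrite section_lt => AB /= rA rB.
have : [set H : X | [/\ rank H = j + rank F + 1, lt (sval A) H & lt H (sval B)]] #= `I_2.
  by apply: dX => //; lia.
set S := (S in S #= _) => /card_I2P[a [b [ab SE]]].
have SP x : S x -> le F x /\ le x G.
  move=> [_ Ax xB]; split; first exact: (le_tr gX (svalP A).1 (lt_le Ax)).
  exact: (le_tr gX (lt_le xB) (svalP B).2).
have Sa : S a by rewrite SE; left.
have Sb : S b by rewrite SE; right.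
apply/card_I2P; exists (in_section (SP _ Sa)), (in_section (SP _ Sb)); split.
  by move=> /(congr1 sval).
apply/seteqP; split=> [x [rx]|_ [->|->]]; rewrite ?section_lt.
- move=> Ax xB; have : S (sval x) by split=> //; move: rx => /=; lia.
  by rewrite SE => -[e|e]; [left | right]; apply: section_eq.
- by case: Sa => ra Aa aB; split; rewrite ?section_lt //=; lia.
- by case: Sb => ra Aa aB; split; rewrite ?section_lt //=; lia.
Qed.

Lemma section_connected (F G : X) :
  sections_connected X -> sections_connected (section F G).
Proof.
move=> cX A B AB; have [h [isoh _]] := section_section A B.
have [g [_ _ isog]] := iso_inv isoh.
by apply: (iso_flag_connected isog); exact: cX.
Qed.

(** Exchanging the part of a flag between two of its faces: this is how galleries of a
    section become galleries of the poset. *)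
Definition glue (C : set X) (A B : X) (S : set (section A B)) : set X :=
  [set F | C F /\ (rank F <= rank A \/ rank B <= rank F)] `|` [set sval F | F in S].

Lemma glue_flag C A B S : is_flag C -> C A -> C B -> le A B ->
  @is_flag (section A B) S -> is_flag (glue C S).
Proof.
move=> fC CA CB AB fS; have gS := section_graded AB.
have [totC allC] := (flagP gX _).1 fC; have [totS allS] := (flagP gS _).1 fS.
apply/(flagP gX); split.
  have out F : C F -> rank F <= rank A \/ rank B <= rank F -> forall s : section A B,
      le F (sval s) \/ le (sval s) F.
    move=> CF [FA|BF] s.
      by left; apply: (le_tr gX _ (svalP s).1); exact: (chain_le gX totC).
    by right; apply: (le_tr gX (svalP s).2); exact: (chain_le gX totC).
  move=> x y [[Cx rx]|[s Ss <-]] [[Cy ry]|[t St <-]].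
  - exact: totC.
  - exact: out.
  - by have [] := out _ Cy ry s; [right | left].
  - exact: totS.
move=> j jr; have [F CF rF] := allC _ jr.
have [lo|hi] := pselect (rank F <= rank A \/ rank B <= rank F).
  by exists F => //; left.
have [|s Ss rs] := allS (j - rank A - 1); first by lia.
by exists (sval s); [right; exists s | move: rs => /=; lia].
Qed.

Lemma glue_adjacent C A B S T : is_flag C -> C A -> C B -> le A B ->
  @flag_adjacent (section A B) S T -> flag_adjacent (glue C S) (glue C T).
Proof.
move=> fC CA CB AB [fS fT [F [G [ST TS]]]].
split; [exact: glue_flag | exact: glue_flag|].
have gS := section_graded AB.
have diff (S' T' : set (section A B)) H : is_flag S' -> is_flag T' ->
    S' `\` T' = [set H] -> glue C S' `\` glue C T' = [set sval H].
  move=> fS' fT' D; have [S'H nT'H] : (S' `\` T') H by rewrite D.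
  have [_ allT] := (flagP gS _).1 fT'.
  have [AH HB] := svalP H.
  apply/seteqP; split=> [x [[out|[s Ss <-]] nx]|_ ->].
  - by case: nx; left.
  - suff -> : s = H by [].
    have : (S' `\` T') s by split=> // Ts; apply: nx; right; exists s.
    by rewrite D.
  split=> [|[[_ [HA|BH]]|[t Tt /section_eq e]]]; first by right; exists H.
  - have [|t Tt rt] := allT (-1); first by have := le_rank gX AB; lia.
    apply: nT'H; suff <- : t = H by [].
    apply: section_eq.
    apply: etrans (esym (le_rank_eq gX (svalP t).1 _)) (le_rank_eq gX AH _).
      by move: rt => /=; lia.
    by have := le_rank gX AH; lia.
  - have [|t Tt rt] := allT (rank B - rank A - 1); first by have := le_rank gX AB; lia.
    apply: nT'H; suff <- : t = H by [].
    apply: section_eq.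
    apply: etrans (le_rank_eq gX (svalP t).2 _) (esym (le_rank_eq gX HB _)).
      by move: rt => /=; lia.
    by have := le_rank gX HB; lia.
  - by apply: nT'H; rewrite -e.
by exists (sval F), (sval G); split; exact: diff.
Qed.

End Sections.

Lemma isomorphic_sym (X Y : rankedRel) : isomorphic X Y -> isomorphic Y X.
Proof. by move=> [f /iso_inv[g [_ _ isog]]]; exists g. Qed.

Lemma isomorphic_trans (X Y Z : rankedRel) :
  isomorphic X Y -> isomorphic Y Z -> isomorphic X Z.
Proof. by move=> [f isof] [g isog]; exists (g \o f); exact: iso_comp. Qed.

Lemma isomorphic_section (X Y : rankedRel) (f : X -> Y) (F G : X) :
  is_iso f -> isomorphic (section F G) (section (f F) (f G)).
Proof. by move=> isof; have [h [isoh _]] := iso_section isof F G; exists h. Qed.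

(** * Strong flag-connectedness *)

Definition adjacent_over (X : rankedRel) (E C D : set X) : Prop :=
  [/\ flag_adjacent C D, E `<=` C & E `<=` D].

Section Strong.
Variables (m : int) (X : rankedRel).
Hypothesis gX : graded m X.

Lemma graded_m : -1 <= m.
Proof. by have [b _ rb] := graded_bot gX; have := graded_range gX b; lia. Qed.

Definition restrict (C : set X) (A B : X) : set (section A B) := [set s | C (sval s)].

Lemma restrict_flag C A B : is_flag C -> C A -> C B -> le A B ->
  @is_flag (section A B) (restrict C (A := A) (B := B)).
Proof.
move=> /(flagP gX)[totC allC] CA CB AB; apply/(flagP (section_graded gX AB)).
split=> [x y Cx Cy|j jr]; first exact: totC.
have [|F CF rF] := allC (j + rank A + 1).
  by have := graded_range gX A; have := graded_range gX B; lia.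
have pF : le A F /\ le F B by split; apply: (chain_le gX totC) => //; lia.
by exists (in_section pF) => //=; lia.
Qed.

Lemma glue_restrict C A B : is_flag C -> C A -> C B -> le A B ->
  glue C (restrict C (A := A) (B := B)) = C.
Proof.
move=> fC CA CB AB; have totC := fC.1.
apply/seteqP; split=> [F [[]//|[s Cs <-]//]|F CF].
have [lo|hi] := pselect (rank F <= rank A \/ rank B <= rank F); first by left.
have pF : le A F /\ le F B by split; apply: (chain_le gX totC) => //; lia.
by right; exists (in_section pF).
Qed.

Hypothesis cX : sections_connected X.

(** [C] is turned into [D] from the bottom up, one gap at a time.  Let [A] be the last
    of the initial faces that [C] and [D] share and [B] the next common one; the section
    [B/A] is flag-connected, and moving inside it keeps all the common faces, hence [E]. *)
Lemma strong_connected (E C D : set X) : is_flag C -> is_flag D ->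
  E `<=` C -> E `<=` D -> clos_refl_trans _ (adjacent_over E) C D.
Proof.
move=> + fD + ED; have [totD allD] := (flagP gX _).1 fD.
have mX := graded_m.
(* [m - k] bounds the ranks up to which the two flags already agree *)
suff main (k : nat) : k%:Z <= m + 1 -> forall C, is_flag C -> E `<=` C ->
    (forall F, rank F <= m - k%:Z -> (C F <-> D F)) ->
    clos_refl_trans _ (adjacent_over E) C D.
  move=> fC EC; apply: (main `|(m + 1)%R|%N) => //; first by lia.
  move=> F rF; have [b bl rb] := graded_bot gX.
  have bF : b = F by apply: (le_rank_eq gX (bl F)); have := graded_range gX F; lia.
  have bot_in (S : set X) : is_flag S -> S b.
    move=> /(flagP gX)[_ /(_ (-1))[|H SH rH]]; first by lia.
    by rewrite (le_rank_eq gX (bl H)) ?rb.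
  by rewrite -bF; split=> _; exact: bot_in.
elim: k => [|k IHk] km {}C fC EC agree.
  suff -> : C = D by exact: rt_refl.
  apply/seteqP; split=> F; apply agree; have := graded_range gX F; lia.
have [totC allC] := (flagP gX _).1 fC.
have [|A CA rA] := allC (m - k.+1%:Z); first by lia.
have DA : D A by apply/agree => //; lia.
pose common (l : nat) := `[< exists F, [/\ C F, D F & rank F = rank A + 1 + l%:Z] >].
have ex_common : exists l, common l.
  have [t tg rt] := graded_top gX.
  have top_in (S : set X) : is_flag S -> S t.
    move=> /(flagP gX)[_ /(_ m)[|H SH rH]]; first by lia.
    by rewrite -(le_rank_eq gX (tg H)) ?rt.
  exists `|(m - rank A - 1)%R|%N; apply/asboolP; exists t.
  by split; [exact: top_in | exact: top_in | lia].
case: (ex_minnP ex_common) => l /asboolP[B [CB DB rB]] minB.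
have AB : le A B by apply: (chain_le gX totC) => //; lia.
have Eout F : E F -> rank F <= rank A \/ rank B <= rank F.
  move=> EF; have [|AF] := lerP (rank F) (rank A); first by left.
  right; have : (l <= `|(rank F - rank A - 1)%R|%N)%N.
    by apply: minB; apply/asboolP; exists F; split; [exact: EC|exact: ED|lia].
  by lia.
have Eglue S : E `<=` glue C (A := A) (B := B) S.
  by move=> F EF; left; split; [exact: EC | exact: Eout].
have fCr := restrict_flag fC CA CB AB.
have fDr := restrict_flag fD DA DB AB.
apply: (rt_trans _ _ _ (glue C (restrict D (A := A) (B := B)))).
  rewrite -{1}(glue_restrict fC CA CB AB).
  elim: (cX AB fCr fDr) => [S T ST|S|S T U _ h1 _ h2].
  - by apply: rt_step; split=> //; apply: (glue_adjacent gX).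
  - exact: rt_refl.
  - exact: rt_trans h1 h2.
apply: IHk; [by lia | by apply: (glue_flag gX) | exact: Eglue |].
move=> F rF; split.
  move=> [[CF [FA|BF]]|[s Ds <-]//]; first by apply/agree => //; lia.
  by rewrite (chain_inj gX totC CF CB) //; lia.
move=> DF; have [FA|AF] := lerP (rank F) (rank A).
  by left; split; [apply/agree => //; lia | left].
have pF : le A F /\ le F B by split; apply: (chain_le gX totD) => //; lia.
by right; exists (in_section pF).
Qed.

End Strong.

Lemma section_polytope (n k : nat) (X : rankedRel) (F G : X) :
  is_polytope n X -> le F G -> rank G - rank F - 1 = k%:Z -> is_polytope k (section F G).
Proof.
move=> /polytopeP[gX dX cX] FG kE; apply/polytopeP; split.
- by rewrite -kE; exact: (section_graded gX).
- exact: (section_diamond gX).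
- exact: (section_connected gX).
Qed.

(** * Rigidity and distinguished generators *)

Definition differ_at (X : rankedRel) (j : int) (C D : set X) : Prop :=
  C <> D /\ forall F : X, rank F <> j -> (C F <-> D F).

Section Differ.
Variables (m : int) (X : rankedRel).
Hypothesis gX : graded m X.
Implicit Types C D : set X.

Lemma flag_adjacent_differ C D : flag_adjacent C D -> exists j, differ_at j C D.
Proof.
move=> [fC fD [F [G [CD DC]]]].
have [totC allC] := (flagP gX _).1 fC; have [totD allD] := (flagP gX _).1 fD.
have [CF nDF] : (C `\` D) F by rewrite CD.
have [DG nCG] : (D `\` C) G by rewrite DC.
have [H DH rH] := allD _ (graded_range gX F).
have HG : H = G.
  suff : (D `\` C) H by rewrite DC.
  split=> // CH; apply: nDF.
  by rewrite -(chain_inj gX totC CH CF rH).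
subst H; exists (rank F); split=> [e|H rFH]; first by rewrite e in CF.
split=> [CH|DH']; apply: contrapT => nH.
  by have : (C `\` D) H by []; rewrite CD => e; rewrite e in rFH.
by have : (D `\` C) H by []; rewrite DC => e; rewrite e rH in rFH.
Qed.

Lemma differ_faces j C D : is_flag C -> is_flag D -> differ_at j C D ->
  exists c d, [/\ C c, D d, rank c = j, rank d = j & c <> d].
Proof.
move=> fC fD [ne agree].
have [totC allC] := (flagP gX _).1 fC; have [totD allD] := (flagP gX _).1 fD.
have [jr|njr] := boolP (-1 <= j <= m); last first.
  case: ne; apply/seteqP; split=> F; apply agree => e;
    by have := graded_range gX F; rewrite e => h; rewrite h in njr.
have [c Cc rc] := allC _ jr; have [d Dd rd] := allD _ jr.
exists c, d; split=> // e; subst d.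
case: ne; apply/seteqP; split=> F HF.
  have [e|/eqP nr] := eqVneq (rank F) j; last by apply/agree.
  by rewrite (chain_inj gX totC HF Cc) ?e.
have [e|/eqP nr] := eqVneq (rank F) j; last by apply/agree.
by rewrite (chain_inj gX totD HF Dd) ?e.
Qed.

Lemma differ_range j C D : is_flag C -> is_flag D -> differ_at j C D -> -1 < j < m.
Proof.
move=> fC fD /(differ_faces fC fD)[c [d [_ _ rc rd cd]]].
have [b bl rb] := graded_bot gX; have [t tg rt] := graded_top gX.
have /eqP nb : j <> -1.
  move=> e; apply: cd.
  by rewrite -(le_rank_eq gX (bl c)) ?rb ?rc // -(le_rank_eq gX (bl d)) // rb rd.
have /eqP nt : j <> m.
  move=> e; apply: cd.
  by rewrite (le_rank_eq gX (tg c)) ?rt ?rc // (le_rank_eq gX (tg d)) // rt rd.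
by have := graded_range gX c; rewrite rc; lia.
Qed.

(** By the diamond condition the face of rank [j] has a single alternative between its
    two neighbours in the flag. *)
Lemma differ_unique j C D D' : diamond X -> is_flag C -> is_flag D -> is_flag D' ->
  differ_at j C D -> differ_at j C D' -> D = D'.
Proof.
move=> dX fC fD fD' CD CD'; have jr := differ_range fC fD CD.
have [c [d [Cc Dd rc rd cd]]] := differ_faces fC fD CD.
have [c' [d' [Cc' Dd' rc' rd' cd']]] := differ_faces fC fD' CD'.
have [totC allC] := (flagP gX _).1 fC; have [totD _] := (flagP gX _).1 fD.
have [totD' _] := (flagP gX _).1 fD'.
have ec : c' = c by apply: (chain_inj gX totC); rewrite ?rc ?rc'.
rewrite {}ec {c' Cc' rc'} in cd'.
have [|F CF rF] := allC (j - 1); first by lia.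
have [|G CG rG] := allC (j + 1); first by lia.
have DF : D F by apply CD.2 => //; lia.
have DG : D G by apply CD.2 => //; lia.
have DF' : D' F by apply CD'.2 => //; lia.
have DG' : D' G by apply CD'.2 => //; lia.
have FG : lt F G by apply: (chain_lt gX totC) => //; lia.
have := dX j F G FG rF rG => /card_I2P[x [y [xy E]]].
have inE (S : set X) s : total_on S le -> S F -> S G -> S s -> rank s = j -> s = x \/ s = y.
  move=> totS SF SG Ss rs; suff : [set H | [/\ rank H = j, lt F H & lt H G]] s.
    by rewrite E.
  by split=> //; apply: (chain_lt gX totS) => //; lia.
have Hc := inE _ _ totC CF CG Cc rc.
have Hd := inE _ _ totD DF DG Dd rd.
have Hd' := inE _ _ totD' DF' DG' Dd' rd'.
have dd' : d = d'.
  by move: Hc Hd Hd' => [?|?] [?|?] [?|?]; subst.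
apply/seteqP; split=> H SH.
  have [e|/eqP nr] := eqVneq (rank H) j; last by apply/CD'.2 => //; apply/CD.2.
  by rewrite (chain_inj gX totD SH Dd) ?e // dd'.
have [e|/eqP nr] := eqVneq (rank H) j; last by apply/CD.2 => //; apply/CD'.2.
by rewrite (chain_inj gX totD' SH Dd') ?e // -dd'.
Qed.

Lemma differ_sym j C D : differ_at j C D -> differ_at j D C.
Proof. by move=> [ne agree]; split=> [e|F rF]; [apply: ne | rewrite agree]. Qed.

Lemma differ_aut j C D (f : aut X) : differ_at j C D -> differ_at j (f @` C) (f @` D).
Proof.
move=> [ne agree].
have fV F (S : set X) : (f @` S) F <-> S (aut_inv_fun f F).
  split=> [[x Sx <-]|SF]; first by rewrite aut_funK.
  by exists (aut_inv_fun f F); rewrite // aut_inv_funK.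
split=> [e|F rF].
  apply: ne; apply/seteqP; split=> F.
    by rewrite -{1}(aut_funK f F) -fV e fV aut_funK.
  by rewrite -{1}(aut_funK f F) -fV -e fV aut_funK.
rewrite !fV; apply: agree; rewrite -(aut_rank f _ gX) aut_inv_funK.
exact: rF.
Qed.

Lemma aut_fix C (f : aut X) : is_flag C -> f @` C = C -> forall F, C F -> f F = F.
Proof.
move=> [totC _] fC F CF; apply: (chain_inj gX totC) => //; last exact: aut_rank gX.
by rewrite -fC; exists F.
Qed.

End Differ.

Lemma image_aut_mul (X : rankedRel) (f g : aut X) (C : set X) :
  (f * g)%g @` C = g @` (f @` C).
Proof. by rewrite -image_comp. Qed.

Lemma image_autV (X : rankedRel) (f : aut X) (C : set X) : f^-1%g @` (f @` C) = C.
Proof.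
rewrite -image_aut_mul mulgV; apply/seteqP.
by split=> [_ [x Cx <-]//|x Cx]; exists x.
Qed.

Section Rigid.
Variables (n : nat) (X : rankedRel).
Hypothesis pX : is_polytope n X.

(** Fixing a flag propagates to the adjacent flags, hence to all of them, and every face
    lies in some flag. *)
Lemma aut_rigid C (f : aut X) : is_flag C -> f @` C = C -> f = 1%g.
Proof.
move=> fC fCC; have /polytopeP[gX dX cX] := pX.
have fixflag D : is_flag D -> f @` D = D.
  move=> fD; have sub0 (S : set X) : set0 `<=` S by [].
  have := strong_connected gX cX fC fD (sub0 C) (sub0 D).
  elim/clos_refl_trans_ind_left => [//|S T _ SS [ST _ _]].
  have [j dST] := flag_adjacent_differ gX ST; have [fS fT _] := ST.
  apply/esym; apply: (differ_unique gX dX fS fT _ dST).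
    exact: iso_flag (aut_is_iso f) _ fT.
  by rewrite -{1}SS; exact: differ_aut gX _ _ _ _ dST.
apply: aut_eq => F.
have [||D fD sub] := @chain_extend X [set F]; first exact: le_refl gX.
  by move=> x y -> ->; left; exact: le_refl gX _.
by rewrite (aut_fix gX fD (fixflag D fD)) //; exact: sub.
Qed.

Lemma aut_flag_image C (f g : aut X) : is_flag C -> f @` C = g @` C -> f = g.
Proof.
move=> fC fg; apply: (can_inj (mulgK g^-1%g)) => /=; rewrite mulgV.
by apply: (aut_rigid fC); rewrite image_aut_mul fg image_autV.
Qed.

Lemma aut_flag_eq C (f g : aut X) : is_flag C -> (forall F, C F -> f F = g F) -> f = g.
Proof.
move=> fC fg; apply: (aut_flag_image fC).
by apply/seteqP; split=> _ [x Cx <-]; exists x; rewrite ?fg.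
Qed.

Variables (Phi : set X) (r : nat -> aut X).
Hypothesis fPhi : is_flag Phi.
Hypothesis hr : forall j, (j < n)%N -> is_distinguished Phi j (r j).

Lemma gen_fix l F : (l < n)%N -> Phi F -> rank F <> l%:Z -> r l F = F.
Proof.
move=> ln PF rF; have /polytopeP[gX _ _] := pX; have [totP _] := fPhi.
have [_ agree] := hr ln; have rE := aut_rank (r l) F gX.
apply: (chain_inj gX totP) => //; apply/agree; first by rewrite rE.
by exists F.
Qed.

Lemma gen_move l F : (l < n)%N -> Phi F -> rank F = l%:Z -> r l F <> F.
Proof.
move=> ln PF rF e; have /polytopeP[gX _ _] := pX; have [totP _] := fPhi.
have [ne _] := hr ln; apply: ne.
suff fix_all G : Phi G -> r l G = G.
  by apply/seteqP; split=> [_ [G PG <-]|G PG]; [rewrite fix_all|exists G; rewrite ?fix_all].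
move=> PG; have [rG|/eqP rG] := eqVneq (rank G) l%:Z; last exact: gen_fix.
by rewrite (chain_inj gX totP PG PF) ?rG ?rF.
Qed.

Definition gens_off (E : set X) : set (aut X) :=
  [set r l | l in [set l | (l < n)%N /\ forall F, E F -> rank F <> l%:Z]].

(** If [g] takes the base flag to [S], then the neighbour [T] of [S] at rank [l] is the
    image of the base flag under [r l * g].  Since [S] and [T] both contain [E], no face
    of [E] has rank [l]. *)
Lemma reach_flag (E D : set X) :
  clos_refl_trans _ (adjacent_over E) Phi D ->
  exists2 g, generated (gens_off E) g & g @` Phi = D.
Proof.
have /polytopeP[gX dX _] := pX; have [g1 gM gV] := generated_subgroup (gens_off E).
elim/clos_refl_trans_ind_left => [|S T _ [g Gg gS] [ST ES ET]].
  by exists 1%g => //; apply/seteqP; split=> [_ [x Cx <-]//|x Cx]; exists x.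
have [j dST] := flag_adjacent_differ gX ST; have [fS fT _] := ST.
have jr := differ_range gX fS fT dST.
have [l lE] : exists l : nat, j = l%:Z by exists `|j|%N; lia.
subst j; have ln : (l < n)%N by lia.
exists (r l * g)%g.
  apply: gM => //; apply: generated_sub; exists l => //; split=> // F EF rF.
  have [c [d [Sc Td rc rd cd]]] := differ_faces gX fS fT dST.
  apply: cd; have [totS _] := fS; have [totT _] := fT.
  by rewrite -(chain_inj gX totS (ES _ EF) Sc) ?rc // (chain_inj gX totT (ET _ EF) Td) ?rd.
rewrite image_aut_mul; rewrite -gS in dST fS.
apply: (differ_unique gX dX fS _ fT _ dST).
  by do 2! apply: (iso_flag (aut_is_iso _)).
apply: (differ_aut gX); apply: differ_sym; exact: hr.
Qed.

(** An element fixing [E] moves the base flag to a flag through [E], which strong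
    connectedness reaches by a gallery through [E]; rigidity identifies the element with
    the product of generators read off this gallery. *)
Lemma stabilizer_generated (E : set X) (g : aut X) : E `<=` Phi ->
  (forall F, E F -> g F = F) <-> generated (gens_off E) g.
Proof.
move=> EP; have /polytopeP[gX dX cX] := pX; split=> [gE|].
  have fg := iso_flag (aut_is_iso g) fPhi.
  have [|h Hh hg] := @reach_flag E (g @` Phi).
    apply: (strong_connected gX cX) => // F EF.
    by exists F; [exact: EP | exact: gE].
  suff -> : g = h by [].
  exact: (aut_flag_image fPhi (esym hg)).
move: g; apply: generated_min.
  split=> [//|x y xE yE F EF|x xE F EF].
    by rewrite /= xE ?yE.
  by rewrite /= -{1}(xE _ EF) aut_funK.
by move=> _ [l [ln lE] <-] F EF; apply: gen_fix => //; [exact: EP | exact: lE].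
Qed.

(** By rigidity it suffices to compare both products on the base flag, where only the
    faces of rank [i] and [j] move. *)
Lemma gen_comm i j : (i.+1 < j)%N -> (j < n)%N -> (r i * r j = r j * r i)%g.
Proof.
move=> ij jn; have /polytopeP[gX dX cX] := pX.
have [totP allP] := (flagP gX _).1 fPhi.
(* a neighbour of the [a]-face of the base flag is fixed by distant generators *)
have key a b F : (a < n)%N -> (b < n)%N -> (a.+1 < b)%N \/ (b.+1 < a)%N ->
    Phi F -> rank F = a%:Z -> r b (r a F) = r a F.
  move=> an bn ab PF rF.
  have [|A PA rA] := allP (a%:Z - 1); first by lia.
  have [|B PB rB] := allP (a%:Z + 1); first by lia.
  have AF : lt A F by apply: (chain_lt gX totP) => //; lia.
  have FB : lt F B by apply: (chain_lt gX totP) => //; lia.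
  have AB : lt A B by apply: (chain_lt gX totP) => //; lia.
  have /card_I2P[x [y [xy E]]] := dX _ _ _ AB rA rB.
  have inE H : lt A H -> lt H B -> rank H = a%:Z -> H = x \/ H = y.
    move=> AH HB rH; suff : [set H | [/\ rank H = a%:Z, lt A H & lt H B]] H.
      by rewrite E.
    by [].
  have fixA c : (c < n)%N -> c%:Z <> a%:Z - 1 -> r c A = A.
    by move=> cn ca; apply: gen_fix => //; lia.
  have fixB c : (c < n)%N -> c%:Z <> a%:Z + 1 -> r c B = B.
    by move=> cn ca; apply: gen_fix => //; lia.
  have step c H : (c < n)%N -> c%:Z <> a%:Z - 1 -> c%:Z <> a%:Z + 1 ->
      [/\ lt A H, lt H B & rank H = a%:Z] ->
      [/\ lt A (r c H), lt (r c H) B & rank (r c H) = a%:Z].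
    move=> cn c1 c2 [AH HB rH]; have isoc := aut_is_iso (r c).
    split; last by rewrite (aut_rank _ _ gX).
      by rewrite -(fixA c) // (iso_lt _ _ isoc).
    by rewrite -(fixB c) // (iso_lt _ _ isoc).
  have hF : [/\ lt A F, lt F B & rank F = a%:Z] by [].
  have h1 : [/\ lt A (r a F), lt (r a F) B & rank (r a F) = a%:Z] by apply: step => //; lia.
  have h2 : [/\ lt A (r b (r a F)), lt (r b (r a F)) B & rank (r b (r a F)) = a%:Z].
    by apply: step => //; lia.
  have ne1 : r a F <> F by exact: gen_move.
  have ne2 : r b (r a F) <> F.
    move=> e; apply: ne1; apply: (iso_inj (aut_is_iso (r b))).
    by rewrite e gen_fix //; lia.
  case: hF h1 h2 => [f1 f2 f3] [g1 g2 g3] [k1 k2 k3].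
  by have [e1|e1] := inE _ f1 f2 f3; have [e2|e2] := inE _ g1 g2 g3;
    have [e3|e3] := inE _ k1 k2 k3; congruence.
have fi F : Phi F -> rank F <> i%:Z -> r i F = F by move=> *; apply: gen_fix => //; lia.
have fj F : Phi F -> rank F <> j%:Z -> r j F = F by move=> *; apply: gen_fix => //; lia.
apply: (aut_flag_eq fPhi) => F PF /=.
have [ei|/eqP ni] := eqVneq (rank F) i%:Z.
  by rewrite (fj F) ?key //; lia.
rewrite (fi F) //.
have [ej|/eqP nj] := eqVneq (rank F) j%:Z; last by rewrite fj ?fi.
by rewrite key //; lia.
Qed.

End Rigid.

(** * Galleries *)

Lemma flag_adjacent_sym (X : rankedRel) (C D : set X) : flag_adjacent C D -> flag_adjacent D C.
Proof. by move=> [fC fD [F [G [CD DC]]]]; split=> //; exists G, F. Qed.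

Definition gallery (X : rankedRel) : set X -> set X -> Prop :=
  clos_refl_trans _ (@flag_adjacent X).

Lemma gallery_sym (X : rankedRel) (C D : set X) : gallery C D -> gallery D C.
Proof.
elim=> [S T /flag_adjacent_sym|S|S T V _ h1 _ h2].
- exact: rt_step.
- exact: rt_refl.
- exact: rt_trans h2 h1.
Qed.

Section Galleries.
Variables (m : int) (X : rankedRel).
Hypothesis gX : graded m X.

Lemma flag_exchange (C : set X) (F F' : X) : is_flag C -> C F -> rank F' = rank F ->
  F' <> F -> (forall H, C H -> rank H < rank F -> le H F') ->
  (forall H, C H -> rank F < rank H -> le F' H) ->
  flag_adjacent C ((C `\ F) `|` [set F']).
Proof.
move=> fC CF rF' ne lo hi; have [totC allC] := (flagP gX C).1 fC.
have cmp H : C H -> H <> F -> le H F' \/ le F' H.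
  move=> CH HF; have [r|r|r] := ltgtP (rank H) (rank F).
  - by left; exact: lo.
  - by right; exact: hi.
  - by case: HF; exact: (chain_inj gX totC).
have nCF' : ~ C F' by move=> CF'; apply: ne; exact: (chain_inj gX totC).
split=> //.
  apply/(flagP gX); split.
    move=> x y [[Cx nx]|->] [[Cy ny]|->].
    - exact: totC.
    - exact: cmp.
    - by apply/or_comm; exact: cmp.
    - by left; exact: le_refl gX _.
  move=> j jr; have [H CH rH] := allC _ jr.
  have [HF|HF] := pselect (H = F); last by exists H => //; left.
  by exists F'; [right | rewrite rF' -HF].
exists F, F'; split; apply/seteqP; split=> H.
- by move=> [CH nH]; apply: contrapT => HF; apply: nH; left.
- by move=> ->; split=> // -[[_]|/esym/ne//]; apply.
- by move=> [[[CH _]|->//] nC]; case: nC.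
- by move=> ->; split=> //; right.
Qed.

(** A flag through [f] is determined by its part below [f], since only the greatest face
    lies above. *)
Lemma gallery_coatom (b f : X) (C D : set X) : is_least b -> rank f = m - 1 ->
  flag_connected (section b f) -> is_flag C -> is_flag D -> C f -> D f -> gallery C D.
Proof.
move=> bl rf con fC fD Cf Df.
have bf := bl f; have [t tg rt] := graded_top gX.
have rb : rank b = -1.
  have [b' bl' rb'] := graded_bot gX; rewrite -rb'; congr rank.
  by apply: (le_anti gX); [exact: bl | exact: bl'].
have mX := graded_m gX.
have bot_in (S : set X) : is_flag S -> S b.
  move=> /(flagP gX)[_ /(_ (-1))[|H SH rH]]; first by lia.
  by rewrite (le_rank_eq gX (bl H)) ?rb.
have top_in (S : set X) : is_flag S -> S t.
  move=> /(flagP gX)[_ /(_ m)[|H SH rH]]; first by lia.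
  by rewrite -(le_rank_eq gX (tg H)) ?rt.
have Cb := bot_in _ fC; have Db := bot_in _ fD.
have [totC _] := fC; have [totD _] := fD.
have glueD : glue C (restrict D (A := b) (B := f)) = D.
  have outer (S T : set X) F : is_flag S -> is_flag T -> S f -> T f -> S F ->
      rank F <= rank b \/ rank f <= rank F -> T F.
    move=> fS fT Sf Tf SF; rewrite rb rf => rF.
    have rFr := graded_range gX F.
    have [e|e] := eqVneq (rank F) (-1).
      rewrite (_ : F = b); first exact: bot_in.
      by apply: (chain_inj gX fS.1) => //; [exact: bot_in | rewrite rb].
    have [e'|e'] := eqVneq (rank F) m.
      rewrite (_ : F = t); first exact: top_in.
      by apply: (chain_inj gX fS.1) => //; [exact: top_in | rewrite rt].
    by rewrite (_ : F = f) //; apply: (chain_inj gX fS.1) => //; lia.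
  apply/seteqP; split=> [F [[CF rF]|[s Ds <-]//]|F DF].
    exact: (outer C D).
  have [lo|hi] := pselect (rank F <= rank b \/ rank f <= rank F).
    by left; split=> //; exact: (outer D C).
  have pF : le b F /\ le F f by split; apply: (chain_le gX totD) => //; lia.
  by right; exists (in_section pF).
have fCr := restrict_flag gX fC Cb Cf bf; have fDr := restrict_flag gX fD Db Df bf.
rewrite -glueD -{1}(glue_restrict gX fC Cb Cf bf).
elim: (con _ _ fCr fDr) => [S T ST|S|S T V _ h1 _ h2].
- by apply: rt_step; apply: (glue_adjacent gX).
- exact: rt_refl.
- exact: rt_trans h1 h2.
Qed.

End Galleries.

(** * Normal forms in amalgamated products *)

Section Run.
Variables (G1 G2 : groupType) (H : set G1) (phi : G1 -> G2).
Variables (T : Type) (ok : T -> Prop) (a1 : G1 -> T -> T) (a2 : G2 -> T -> T).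

Hypothesis ok1 : forall x t, ok t -> ok (a1 x t).
Hypothesis ok2 : forall y t, ok t -> ok (a2 y t).
Hypothesis a1_1 : forall t, ok t -> a1 1%g t = t.
Hypothesis a2_1 : forall t, ok t -> a2 1%g t = t.
Hypothesis a1M : forall x y t, ok t -> a1 (x * y)%g t = a1 x (a1 y t).
Hypothesis a2M : forall x y t, ok t -> a2 (x * y)%g t = a2 x (a2 y t).
Hypothesis a_glue : forall h t, H h -> ok t -> a1 h t = a2 (phi h) t.

Definition run (u : seq (G1 + G2)) (t : T) : T :=
  foldr (fun l => match l with inl x => a1 x | inr y => a2 y end) t u.

Lemma run_ok u t : ok t -> ok (run u t).
Proof. by move=> tok; elim: u => //= -[x|y] u IHu; [exact: ok1 | exact: ok2]. Qed.

Lemma run_cat u v t : run (u ++ v) t = run u (run v t).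
Proof. exact: foldr_cat. Qed.

Lemma run_eq u v t : amalgam_eq H phi u v -> ok t -> run u t = run v t.
Proof.
move=> uv; elim: uv t => {u v} //=.
- by move=> u v _ IH t tok; rewrite IH.
- by move=> u v w _ IH1 _ IH2 t tok; rewrite IH1 // IH2.
- move=> u u' v v' _ IHu _ IHv t tok; rewrite !run_cat (IHv _ tok) IHu //.
  exact: run_ok.
- by move=> x y t tok; rewrite a1M.
- by move=> x y t tok; rewrite a2M.
- by move=> h Hh t tok; exact: a_glue.
Qed.

(** Two actions of the factors that agree on the amalgamated subgroup define an action of
    the amalgamated product.  It is read off the word chosen by [repr]; by [run_eq] any
    word would do. *)
Definition amalgam_run (w : amalgam H phi) (t : T) : T := run (repr w) t.

Lemma amalgam_run1 t : ok t -> amalgam_run 1%g t = t.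
Proof. by move=> tok; rewrite /amalgam_run (run_eq (amalgam_reprK _ _ _)). Qed.

Lemma amalgam_run_ok w t : ok t -> ok (amalgam_run w t).
Proof. exact: run_ok. Qed.

Lemma amalgam_runM v w t : ok t ->
  amalgam_run (v * w)%g t = amalgam_run v (amalgam_run w t).
Proof.
move=> tok; rewrite /amalgam_run (run_eq (amalgam_reprK _ _ _)) //.
by rewrite /run foldr_cat.
Qed.

Lemma amalgam_run_inl x t : ok t -> amalgam_run (amalgam_inl H phi x) t = a1 x t.
Proof. by move=> tok; rewrite /amalgam_run (run_eq (amalgam_reprK _ _ _)). Qed.

Lemma amalgam_run_inr y t : ok t -> amalgam_run (amalgam_inr H phi y) t = a2 y t.
Proof. by move=> tok; rewrite /amalgam_run (run_eq (amalgam_reprK _ _ _)). Qed.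

End Run.

Section AmalgamFacts.
Variables (G1 G2 : groupType) (H : set G1) (phi : G1 -> G2).
Notation W := (amalgam H phi).
Local Open Scope group_scope.

Lemma amalgam_inlM x y :
  amalgam_inl H phi (x * y) = (amalgam_inl H phi x * amalgam_inl H phi y)%g :> W.
Proof.
apply/esym; apply: etrans (amalgam_piM _ _ _ _) _.
by apply/amalgam_piP; exact: amalgam_mul1.
Qed.

Lemma amalgam_inrM x y :
  amalgam_inr H phi (x * y) = (amalgam_inr H phi x * amalgam_inr H phi y)%g :> W.
Proof.
apply/esym; apply: etrans (amalgam_piM _ _ _ _) _.
by apply/amalgam_piP; exact: amalgam_mul2.
Qed.

Lemma amalgam_inl_glue h : H h -> amalgam_inl H phi h = amalgam_inr H phi (phi h) :> W.
Proof. by move=> Hh; apply/amalgam_piP; exact: amalgam_glue. Qed.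

Lemma amalgam_ind (A : W -> Prop) : A 1 ->
  (forall x w, A w -> A (amalgam_inl H phi x * w)) ->
  (forall y w, A w -> A (amalgam_inr H phi y * w)) -> forall w, A w.
Proof.
move=> A1 Al Ar; elim/quotW; elim=> [|[x|y] u IHu]; first exact: A1.
  have := Al x _ IHu; congr A; exact: (amalgam_piM _ _ [:: inl x] u).
have := Ar y _ IHu; congr A; exact: (amalgam_piM _ _ [:: inr y] u).
Qed.

End AmalgamFacts.

(** An element of the amalgamated product is [k * t1 * ... * tm] with [k] in the
    amalgamated subgroup and the [ti] nontrivial coset representatives taken alternately
    from the two factors; it is encoded as [(k, [:: t1; ...; tm])].  This section lets one
    factor [G] act on such data from the left: [nf_decode] splits off the largest initial
    part lying in [G], and [nf_encode] normalises it again.  It is used twice, [HG] being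
    the copy in [G] of the amalgamated subgroup [H], and [e], [d] the mutually inverse
    identifications of the two. *)
Section Side.
Local Open Scope group_scope.
Variables (G1 G : groupType) (H : set G1) (HG : set G) (e : G1 -> G) (d : G -> G1).
Hypothesis sH : is_subgroup H.
Hypothesis sHG : is_subgroup HG.
Hypothesis eHG : forall k, H k -> HG (e k).
Hypothesis dH : forall g, HG g -> H (d g).
Hypothesis eM : forall x y, H x -> H y -> e (x * y) = e x * e y.
Hypothesis eK : forall k, H k -> d (e k) = k.
Hypothesis dK : forall g, HG g -> e (d g) = g.

(** The representative depends only on the right coset of [p]. *)
Definition coset_rep (A : set G) (p : G) : G := xget 1 [set q | exists2 k, A k & q = k * p].

Lemma coset_repE p : exists2 k, HG k & coset_rep HG p = k * p.
Proof.
apply: (@xgetPex _ _ [set q | exists2 k, HG k & q = k * p]).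
by exists p; exists 1; rewrite ?mul1g //; case: sHG.
Qed.

Lemma coset_rep_mul k p : HG k -> coset_rep HG (k * p) = coset_rep HG p.
Proof.
have [_ HM HV] := sHG => Hk; congr xget; apply/seteqP; split=> q [h Hh ->].
  by exists (h * k); rewrite ?mulgA //; exact: HM.
by exists (h * k^-1); rewrite -?mulgA ?mulKg //; apply: HM => //; exact: HV.
Qed.

Variables (L : Type) (inj : G -> L) (prj : L -> option G).
Variables (okt : L -> Prop) (side : L -> bool) (s0 : bool).
Hypothesis prj_inj : forall x, prj (inj x) = Some x.
Hypothesis prjP : forall t x, prj t = Some x -> t = inj x.
Hypothesis prj_side : forall t, prj t = None <-> side t <> s0.
Hypothesis okt_inj : forall x, okt (inj x) <-> ~ HG x /\ coset_rep HG x = x.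

Definition starts_off (s : bool) (l : seq L) : Prop :=
  match l with t :: _ => side t <> s | [::] => True end.

Fixpoint okl (l : seq L) : Prop :=
  match l with t :: l' => [/\ okt t, starts_off (side t) l' & okl l'] | [::] => True end.

Definition nf_ok (s : G1 * seq L) : Prop := H s.1 /\ okl s.2.

Definition nf_decode (s : G1 * seq L) : G * seq L :=
  match s.2 with
  | t :: l => if prj t is Some p then (e s.1 * p, l) else (e s.1, s.2)
  | [::] => (e s.1, [::])
  end.

Definition nf_encode (s : G * seq L) : G1 * seq L :=
  if `[< HG s.1 >] then (d s.1, s.2)
  else (d (s.1 * (coset_rep HG s.1)^-1), inj (coset_rep HG s.1) :: s.2).

Definition nf_act (g : G) (s : G1 * seq L) : G1 * seq L :=
  nf_encode (g * (nf_decode s).1, (nf_decode s).2).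

Lemma side_inj x : side (inj x) = s0.
Proof.
by apply: contrapT => /prj_side; rewrite prj_inj.
Qed.

Lemma nf_decode_ok s : nf_ok s -> starts_off s0 (nf_decode s).2 /\ okl (nf_decode s).2.
Proof.
case: s => k [|t l] [/= Hk] //; rewrite /nf_decode /=.
case E: (prj t) => [p|] [tok off lok] /=; last by split=> //; apply/prj_side.
by rewrite -(side_inj p) -(prjP E).
Qed.

Lemma nf_encode_off p : ~ HG p -> HG (p * (coset_rep HG p)^-1).
Proof.
have [_ HM HV] := sHG => np; have [k Hk ->] := coset_repE p.
by rewrite invgM mulVKg; exact: HV.
Qed.

Lemma nf_encode_ok p l : starts_off s0 l -> okl l -> nf_ok (nf_encode (p, l)).
Proof.
move=> off lok; rewrite /nf_encode /=; case: asboolP => Hp.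
  by split=> //=; exact: dH.
split; first by apply: dH; exact: nf_encode_off.
split=> //; last by rewrite side_inj.
have [k Hk kE] := coset_repE p.
apply/okt_inj; split; last by rewrite {1}kE coset_rep_mul.
by rewrite kE => /(subgroup_mulr sHG Hk).
Qed.

Lemma nf_decodeK s : nf_ok s -> nf_encode (nf_decode s) = s.
Proof.
case: s => k [|t l] [/= Hk]; rewrite /nf_decode /nf_encode /=.
  by case: asboolP => [_|[]]; [rewrite eK | exact: eHG].
case E: (prj t) => [p|] [tok off lok] /=; last first.
  by case: asboolP => [_|[]]; [rewrite eK | exact: eHG].
rewrite (prjP E) in tok *; have [np rp] := (okt_inj _).1 tok.
case: asboolP => [/(subgroup_mulr sHG (eHG Hk))//|_].
by rewrite coset_rep_mul ?rp ?mulgK ?eK //; exact: eHG.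
Qed.

Lemma nf_encodeK p l : starts_off s0 l -> nf_decode (nf_encode (p, l)) = (p, l).
Proof.
move=> off; rewrite /nf_encode /=; case: asboolP => Hp; rewrite /nf_decode /=.
  by case: l off => [|t l] /= => [_|/prj_side ->]; rewrite dK.
by rewrite prj_inj dK ?mulgVK //; exact: nf_encode_off.
Qed.

Lemma nf_act_ok g s : nf_ok s -> nf_ok (nf_act g s).
Proof. by move=> /nf_decode_ok[off lok]; exact: nf_encode_ok. Qed.

Lemma nf_act1 s : nf_ok s -> nf_act 1 s = s.
Proof. by move=> sok; rewrite /nf_act mul1g -surjective_pairing nf_decodeK. Qed.

Lemma nf_actM g h s : nf_ok s -> nf_act (g * h) s = nf_act g (nf_act h s).
Proof.
move=> /nf_decode_ok[off lok].
by rewrite {2 3}/nf_act /nf_act nf_encodeK //= mulgA.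
Qed.

Lemma nf_act_base k s : H k -> nf_ok s -> nf_act (e k) s = (k * s.1, s.2).
Proof.
have [_ HM _] := sH.
case: s => k' [|t l] Hk [/= Hk']; rewrite /nf_act /nf_decode /nf_encode /=.
  by move=> _; rewrite -eM //; case: asboolP => [_|[]]; rewrite ?eK //; [exact: HM|exact/eHG/HM].
case E: (prj t) => [p|] [tok off lok] /=; rewrite ?mulgA -eM //; last first.
  by case: asboolP => [_|[]]; rewrite ?eK //; [exact: HM|exact/eHG/HM].
rewrite (prjP E) in tok *; have [np rp] := (okt_inj _).1 tok.
have Hkk := HM _ _ Hk Hk'.
case: asboolP => [/(subgroup_mulr sHG (eHG Hkk))//|_].
by rewrite coset_rep_mul ?rp ?mulgK ?eK //; exact: eHG.
Qed.

(** A letter outside the amalgamated subgroup that meets a normal form starting with the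
    other factor is simply added to it. *)
Lemma nf_act_new g s : nf_ok s -> starts_off s0 s.2 -> ~ HG g ->
  exists k t, nf_act g s = (k, t :: s.2) /\ side t = s0.
Proof.
have [_ HM HV] := sHG.
move=> [Hk _] off ng; have decE : nf_decode s = (e s.1, s.2).
  case: s Hk off => k [|t l] //= Hk; rewrite /nf_decode /=.
  by move=> /prj_side ->.
rewrite /nf_act decE /nf_encode /=; case: asboolP => [Hg|_].
  case: ng; rewrite -(mulgK (e s.1) g); apply: HM => //.
  by apply: HV; exact: eHG.
by do 2! eexists; split; first by []; exact: side_inj.
Qed.

Lemma nf_act_nil g : exists k l, nf_act g (1, [::]) = (k, l) /\
  (l = [::] \/ exists2 t, l = [:: t] & side t = s0).
Proof.
rewrite /nf_act /nf_encode /=; case: asboolP => _; do 2! eexists; split; first by [].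
- by left.
- by [].
by right; eexists; [by [] | exact: side_inj].
Qed.

Lemma nf_act_inj g h : nf_act g (1, [::]) = nf_act h (1, [::]) -> g = h.
Proof.
move=> /(congr1 nf_decode); rewrite /nf_act !nf_encodeK //= => -[].
exact: mulIg.
Qed.

End Side.

Section FreeAmalgam.
Local Open Scope group_scope.
Variable W : groupType.

Definition prodw (u : seq W) : W := foldr (fun x y => x * y) 1 u.

Fixpoint reduced (G : bool -> set W) (K : set W) (s : bool) (u : seq W) : Prop :=
  match u with
  | x :: u' => [/\ G s x, ~ K x & reduced G K (~~ s) u']
  | [::] => True
  end.

(** Normal forms are only used through this property and through the injectivity of the
    two embeddings. *)
Definition free_amalgam (G : bool -> set W) (K : set W) : Prop :=
  forall s t x u, reduced G K s (x :: u) -> G t (prodw (x :: u)) -> u = [::] /\ s = t.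

End FreeAmalgam.

Section NormalForm.
Local Open Scope group_scope.
Variables (G1 G2 : groupType) (H1 : set G1) (H2 : set G2) (phi : G1 -> G2).
Hypothesis sH1 : is_subgroup H1.
Hypothesis sH2 : is_subgroup H2.
Hypothesis isophi : subgroup_iso H1 H2 phi.

Notation W := (amalgam H1 phi).
Notation inl1 := (amalgam_inl H1 phi).
Notation inr2 := (amalgam_inr H1 phi).
Let L := (G1 + G2)%type.

Let side (t : L) := if t is inl _ then true else false.
Let prj1 (t : L) := if t is inl x then Some x else None.
Let prj2 (t : L) := if t is inr y then Some y else None.
Let okt (t : L) :=
  match t with
  | inl x => ~ H1 x /\ coset_rep H1 x = x
  | inr y => ~ H2 y /\ coset_rep H2 y = y
  end.

(** Letting the amalgamated product act on the empty normal form yields a map [ev] that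
    turns the length of a reduced word into the length of a list. *)
Lemma amalgam_evaluation : exists ev : W -> G1 * seq L,
  [/\ injective (fun x => ev (inl1 x)), injective (fun y => ev (inr2 y)),
      (forall s u, reduced (fun b : bool => if b then range inl1 else range inr2)
           (inl1 @` H1) s u ->
         size (ev (prodw u)).2 = size u /\ starts_off side (~~ s) (ev (prodw u)).2) &
      (forall (t : bool) w, (if t then range inl1 else range inr2) w ->
         (size (ev w).2 <= 1)%N /\ starts_off side (~~ t) (ev w).2)].
Proof.
have [phibij phiM] := isophi; have [phifun phiinj phisurj] := phibij.
have [d hd] : {d : G2 -> G1 & forall y, H2 y -> H1 (d y) /\ phi (d y) = y}.
  apply: (@choice _ _ (fun y x => H2 y -> H1 x /\ phi x = y)) => y.
  have [Hy|nHy] := pselect (H2 y); last by exists 1.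
  by have [x Hx <-] := phisurj _ Hy; exists x.
have dK k : H1 k -> d (phi k) = k.
  move=> Hk; have [Hd e] := hd _ (phifun _ Hk).
  by apply: phiinj; rewrite ?inE.
pose a1 := nf_act H1 id id inl prj1.
pose a2 := nf_act H2 phi d inr prj2.
have p1 : forall t x, prj1 t = Some x -> t = inl x by move=> [x|y] z //= [->].
have p2 : forall t y, prj2 t = Some y -> t = inr y by move=> [x|y] z //= [->].
have s1 : forall t, prj1 t = None <-> side t <> true by move=> [x|y].
have s2 : forall t, prj2 t = None <-> side t <> false by move=> [x|y].
have o1 : forall x, okt (inl x) <-> ~ H1 x /\ coset_rep H1 x = x by [].
have o2 : forall x, okt (inr x) <-> ~ H2 x /\ coset_rep H2 x = x by [].
pose ok := nf_ok H1 okt side.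
have ok1 x t : ok t -> ok (a1 x t) by apply: nf_act_ok.
have ok2 x t : ok t -> ok (a2 x t).
  by apply: nf_act_ok => // y Hy; case: (hd _ Hy).
have a1_1 t : ok t -> a1 1%g t = t by apply: nf_act1.
have a2_1 t : ok t -> a2 1%g t = t by apply: nf_act1 => //.
have a1M x y t : ok t -> a1 (x * y)%g t = a1 x (a1 y t) by apply: nf_actM.
have a2M x y t : ok t -> a2 (x * y)%g t = a2 x (a2 y t).
  by apply: nf_actM => // z Hz; case: (hd _ Hz).
have base1 h t : H1 h -> ok t -> a1 h t = (h * t.1, t.2).
  exact: (nf_act_base (e := id) (d := id) sH1 sH1).
have base2 h t : H1 h -> ok t -> a2 (phi h) t = (h * t.1, t.2).
  exact: (nf_act_base (d := d) sH1 sH2).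
have a_glue h t : H1 h -> ok t -> a1 h t = a2 (phi h) t.
  move=> Hh tok; apply: etrans (esym (base2 _ _ Hh tok)).
  exact: (base1 _ _ Hh tok).
pose base : G1 * seq L := (1, [::]).
have okb : ok base by split=> //; case: sH1.
pose ev (w : W) := amalgam_run a1 a2 w base.
have new1 x t : ok t -> starts_off side true t.2 -> ~ H1 x ->
    exists k l, a1 x t = (k, l :: t.2) /\ side l = true.
  by apply: (nf_act_new (e := id) id sH1).
have new2 y t : ok t -> starts_off side false t.2 -> ~ H2 y ->
    exists k l, a2 y t = (k, l :: t.2) /\ side l = false.
  by apply: (nf_act_new (e := phi) d sH2).
have evl x w : ev (inl1 x * w) = a1 x (ev w).
  by rewrite /ev (amalgam_runM ok1 ok2) // (amalgam_run_inl ok1 ok2) //; apply: amalgam_run_ok.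
have evr x w : ev (inr2 x * w) = a2 x (ev w).
  by rewrite /ev (amalgam_runM ok1 ok2) // (amalgam_run_inr ok1 ok2) //; apply: amalgam_run_ok.
have ev1 : ev 1 = base by rewrite /ev (amalgam_run1 ok1 ok2).
have evok w : ok (ev w) by apply: amalgam_run_ok.
have evl1 x : ev (inl1 x) = a1 x base by rewrite -[inl1 x]mulg1 evl ev1.
have evr1 x : ev (inr2 x) = a2 x base by rewrite -[inr2 x]mulg1 evr ev1.
exists ev; split.
- by move=> x y; rewrite !evl1; apply: nf_act_inj.
- move=> x y; rewrite !evr1; apply: nf_act_inj => // z Hz; by case: (hd _ Hz).
- move=> s u; elim: u s => [|x u IHu] s /=; first by rewrite ev1.
  move=> [Gx nKx /IHu[<- off]]; case: s Gx off => -[y _ yx] off; subst x.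
    have ny : ~ H1 y by move=> Hy; apply: nKx; exists y.
    have [//|k [t [e tside]]] := new1 y (ev (prodw u)) (evok _) off.
    by rewrite evl e /= tside.
  have ny : ~ H2 y.
    move=> Hy; have [Hd dE] := hd _ Hy; apply: nKx; exists (d y) => //.
    by rewrite amalgam_inl_glue ?dE.
  have [//|k [t [e tside]]] := new2 y (ev (prodw u)) (evok _) off.
  by rewrite evr e /= tside.
- move=> [] w [x _ <-]; rewrite ?evl1 ?evr1 /a1 /a2 /base.
    have [k [l [-> [->//|[t -> ts]]]]] := nf_act_nil H1 id id (inj := inl) (prj := prj1)
      (side := side) (s0 := true) (fun _ => erefl) s1 x.
    by rewrite /= ts.
  have [k [l [-> [->//|[t -> ts]]]]] := nf_act_nil H2 phi d (inj := inr) (prj := prj2)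
    (side := side) (s0 := false) (fun _ => erefl) s2 x.
  by rewrite /= ts.
Qed.

(** Inserting the letters of a reduced word one by one lengthens the normal form
    at each step, whereas an element of a factor has a normal form of length at
    most one. *)
Theorem amalgam_free :
  free_amalgam (fun b : bool => if b then range inl1 else range inr2) (inl1 @` H1).
Proof.
have [ev [_ _ evr evt]] := amalgam_evaluation.
move=> s t x u red /evt[le1 off1]; have [sz off] := evr _ _ red.
have u0 : u = [::] by case: u sz {red off off1} le1 => //= y u ->.
subst u; split=> //; move: off off1; rewrite /=.
by case: (ev _).2 sz => [//|a l] _ /=; case: (side a) s t {red le1} => -[] [].
Qed.

Lemma amalgam_inl_inj : injective inl1.
Proof.
have [ev [i1 _ _ _]] := amalgam_evaluation.
by move=> x y e; apply: i1; rewrite /= e.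
Qed.

Lemma amalgam_inr_inj : injective inr2.
Proof.
have [ev [_ i2 _ _]] := amalgam_evaluation.
by move=> x y e; apply: i2; rewrite /= e.
Qed.

End NormalForm.

(** * Subgroups generated by parts of the factors *)

Section FactorSubgroups.
Local Open Scope group_scope.
Variables (W : groupType) (G : bool -> set W) (K : set W).
Hypothesis sG : forall b, is_subgroup (G b).
Hypothesis sK : is_subgroup K.
Hypothesis KG : forall b, K `<=` G b.
Hypothesis free : free_amalgam G K.

Lemma K_factors x : G true x -> G false x -> K x.
Proof.
move=> Gt Gf; apply: contrapT => nK.
have red : reduced G K true [:: x; x^-1].
  split=> //; split=> //; first by case: (sG false) => _ _; apply.
  move=> Kx; apply: nK; rewrite -[x]invgK; by case: sK => _ _; apply.
have [] // := @free _ true _ _ red.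
by rewrite /prodw /= mulg1 mulgV; case: (sG true).
Qed.

Lemma reduced_sub (A B : bool -> set W) s u : (forall b, A b `<=` B b) ->
  reduced A K s u -> reduced B K s u.
Proof. by move=> AB; elim: u s => //= x u IHu s [/AB Bx nx /IHu]. Qed.

Lemma reduced_mul s k x u : G s k -> K k -> reduced G K s (x :: u) ->
  reduced G K s (k * x :: u).
Proof.
move=> Gk Kk [Gx nx red]; split=> //; first by case: (sG s) => _ GM _; exact: GM.
by move=> /(subgroup_mulr sK Kk).
Qed.

Lemma reduced_catrev s (u w : seq W) : reduced G K s u -> reduced G K (~~ s) w ->
  exists s', reduced G K s' (catrev [seq x^-1 | x <- u] w).
Proof.
elim: u s w => [|x u IHu] s w /=; first by exists (~~ s).
move=> [Gx nx red] redw; apply: (IHu (~~ s)) => //; rewrite negbK; split=> //.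
  by case: (sG s) => _ _; apply.
by move=> Kx; apply: nx; rewrite -[x]invgK; case: sK => _ _; apply.
Qed.

Lemma prodw_catrev (u w : seq W) : prodw (catrev [seq x^-1 | x <- u] w) = (prodw u)^-1 * prodw w.
Proof.
elim: u w => [|x u IHu] w /=; first by rewrite invg1 mul1g.
by rewrite IHu /= invgM mulgA.
Qed.

(** Having the same trace on [K], the two subgroups generate an amalgam of their own over
    this trace. *)
Definition compatible (A : bool -> set W) : Prop :=
  [/\ forall b, is_subgroup (A b), forall b, A b `<=` G b &
      forall b x, A b x -> K x -> A (~~ b) x].

Definition join (A : bool -> set W) : set W := generated [set x | exists b, A b x].

Lemma compatible_K A x : compatible A -> K x -> forall b c, A b x -> A c x.
Proof.
move=> [_ _ AK] Kx b c Ax; have [<-//|/eqP bc] := eqVneq b c.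
by have -> : c = ~~ b by [case: b c bc {Ax} => -[]]; exact: AK.
Qed.

(** Such normal forms are stable under left multiplication by each [A b]: the new letter
    is absorbed by [k], merged with the first letter, or put in front.  A merged letter
    falling into [K] is in both [A b] and goes back into [k]. *)
Lemma join_word A x : compatible A -> join A x ->
  exists k s u, [/\ A true k, K k, reduced A K s u & x = k * prodw u].
Proof.
move=> cA; have [sA AG AK] := cA; have [K1 KM KV] := sK.
have A1 b : A b 1 by case: (sA b).
have AM b y z : A b y -> A b z -> A b (y * z) by case: (sA b) => _ h _; exact: h.
have AV b y : A b y -> A b y^-1 by case: (sA b) => _ _; exact.
pose F x := exists k s u, [/\ A true k, K k, reduced A K s u & x = k * prodw u].
have FA b a y : A b a -> F y -> F (a * y).
  move=> Aa [k [s [u [Ak Kk red ->]]]]; rewrite mulgA.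
  have Aak : A b (a * k) by apply: AM => //; exact: (compatible_K cA Kk _ Ak).
  have [Kak|nKak] := pselect (K (a * k)).
    by exists (a * k), s, u; split=> //; exact: (compatible_K cA Kak _ Aak).
  case: u red => [|z u] red.
    by exists 1, b, [:: a * k]; rewrite /= mul1g.
  have [sb|nsb] := eqVneq s b; last first.
    exists 1, b, [:: a * k, z & u]; rewrite mul1g; split=> //; split=> //.
    by rewrite (_ : ~~ b = s) //; move: nsb; case: (s); case: (b).
  subst s; case: red => Az nz red.
  have Aakz := AM _ _ _ Aak Az.
  have [Kz|nKz] := pselect (K (a * k * z)).
    exists (a * k * z), (~~ b), u; split=> //; first exact: (compatible_K cA Kz _ Aakz).
    by rewrite /= !mulgA.
  by exists 1, b, (a * k * z :: u); rewrite /= mul1g !mulgA.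
move=> Jx; suff [h _] : (forall y, F y -> F (x * y)) /\ (forall y, F y -> F (x^-1 * y)).
  by rewrite -[x]mulg1; apply: h; exists 1, true, [::]; rewrite mulg1.
move: x Jx; apply: generated_min.
  split.
  - by split=> y; rewrite ?invg1 mul1g.
  - move=> y z [h1 h2] [h3 h4]; split=> t Ft; first by rewrite -mulgA; apply: h1; apply: h3.
    by rewrite invgM -mulgA; apply: h4; apply: h2.
  - by move=> y [h1 h2]; rewrite /= invgK.
by move=> a [b Aa]; split=> y; apply: (FA b) => //; exact: AV.
Qed.

(** In the word of [x^-1 * y] the letters of [x] and [y] can only cancel from the middle
    outwards.  The third hypothesis realises each cancellation by an element [z] common to
    both families, and dividing [x] and [y] by [z] shortens them without changing
    [x^-1 * y].  When nothing cancels any more, the word is reduced, and being in a factor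
    it has at most one letter. *)
Lemma join_quotient A B : compatible A -> compatible B ->
  (forall b x y, A b x -> B b y -> K (x^-1 * y) ->
     exists z, [/\ A b z, B b z & K (z^-1 * x)]) ->
  forall b x y, join A x -> join B y -> G b (x^-1 * y) ->
  exists p q, [/\ A b p, B b q & x^-1 * y = p^-1 * q].
Proof.
move=> cA cB AB b x0 y0 /(join_word cA)[k [s [u [Ak Kk redu ->]]]].
move=> /(join_word cB)[l [t [v [Bl Kl redv ->]]]].
have [sA AG AK] := cA; have [sB BG BK] := cB; have [K1 KM KV] := sK.
have AM c y' z : A c y' -> A c z -> A c (y' * z) by case: (sA c) => _ h _; exact: h.
have BM c y' z : B c y' -> B c z -> B c (y' * z) by case: (sB c) => _ h _; exact: h.
have AV c z : A c z -> A c z^-1 by case: (sA c) => _ _; exact.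
have BV c z : B c z -> B c z^-1 by case: (sB c) => _ _; exact.
have GM c y' z : G c y' -> G c z -> G c (y' * z) by case: (sG c) => _ h _; exact: h.
have GV c z : G c z -> G c z^-1 by case: (sG c) => _ _; exact.
have [N] := ubnP (size u + size v).
elim: N => // N IHN in k l s t u v Ak Kk redu Bl Kl redv * => /ltnSE sz Gxy.
have Gk c : G c k by exact: KG.
have Gl c : G c l by exact: KG.
have Ak' c : A c k by exact: (compatible_K cA Kk _ Ak).
have Bl' c : B c l by exact: (compatible_K cB Kl _ Bl).
have redGu := reduced_sub AG redu; have redGv := reduced_sub BG redv.
case: u redu redGu sz Gxy => [|x u] redu redGu sz Gxy.
  case: v redv redGv sz Gxy => [|y v] redv redGv sz Gxy.
    by exists k, l; rewrite /= !mulg1.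
  have Kkl : K (k^-1 * l) by apply: KM => //; exact: KV.
  have redkl := reduced_mul (KG _ Kkl) Kkl redGv.
  have [|v0 tb] := @free _ b _ _ redkl; first by move: Gxy; rewrite /= mulg1 !mulgA.
  subst v t; exists k, (l * y); split=> //; last by rewrite /= !mulg1.
  by apply: BM => //; case: redv.
case: v redv redGv sz Gxy => [|y v] redv redGv sz Gxy.
  have Klk : K (l^-1 * k) by apply: KM => //; exact: KV.
  have redlk := reduced_mul (KG _ Klk) Klk redGu.
  have [|u0 sb] := @free _ b _ _ redlk.
    by move/GV: Gxy; rewrite /= mulg1 invgM invgK !mulgA.
  subst u s; exists (k * x), l; split=> //; last by rewrite /= !mulg1.
  by apply: AM => //; case: redu.
have Akx : A s (k * x) by apply: AM => //; case: redu.
have Bly : B t (l * y) by apply: BM => //; case: redv.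
have [st|nst] := eqVneq s t; last first.
  have Kkl : K (k^-1 * l) by apply: KM => //; exact: KV.
  have redkl := reduced_mul (KG _ Kkl) Kkl redGv.
  have ts : t = ~~ s by move: nst; case: (s); case: (t).
  rewrite ts in redkl; have [s' red] := reduced_catrev redGu redkl.
  exfalso; move: (size_cat (rev [seq x^-1 | x <- x :: u]) (k^-1 * l * y :: v)).
  rewrite -catrevE size_rev size_map.
  have : G b (prodw (catrev [seq x^-1 | x <- x :: u] (k^-1 * l * y :: v))).
    by rewrite prodw_catrev; move: Gxy; rewrite /= !invgM !mulgA.
  by case: (catrev _ _) red => [//|a w] red /(@free _ _ _ _ red)[-> _] /=; lia.
subst t; have Kdec := pselect (K ((k * x)^-1 * (l * y))).
case: Kdec => [Kq|nKq].
  have [z [Az Bz Kz]] := AB _ _ _ Akx Bly Kq.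
  have Kz' : K (z^-1 * (l * y)).
    rewrite (_ : z^-1 * (l * y) = z^-1 * (k * x) * ((k * x)^-1 * (l * y))).
      exact: KM.
    by rewrite -!mulgA; congr (_ * _); rewrite mulgA mulVKg.
  have Azx : A s (z^-1 * (k * x)) by apply: AM => //; exact: AV.
  have Bzy : B s (z^-1 * (l * y)) by apply: BM => //; exact: BV.
  case: redu => _ _ redu; case: redv => _ _ redv.
  have e : (k * prodw (x :: u))^-1 * (l * prodw (y :: v)) =
      (z^-1 * (k * x) * prodw u)^-1 * (z^-1 * (l * y) * prodw v).
    by rewrite /= !invgM !invgK !mulgA mulgK.
  rewrite e; apply: (IHN _ _ (~~ s) (~~ s) u v) => //.
  - exact: (compatible_K cA Kz _ Azx).
  - exact: (compatible_K cB Kz' _ Bzy).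
  - by move: sz => /=; lia.
  - by rewrite -e.
have Gq : G s ((k * x)^-1 * (l * y)).
  by apply: GM; [apply/GV/AG | exact: BG].
have redm : reduced G K s ((k * x)^-1 * (l * y) :: v).
  by split=> //; case: redGv.
have [s' red] : exists s', reduced G K s' (catrev [seq x^-1 | x <- u] ((k * x)^-1 * (l * y) :: v)).
  by apply: (reduced_catrev (s := ~~ s)); [case: redGu | rewrite negbK].
have Gw : G b (prodw (catrev [seq x^-1 | x <- u] ((k * x)^-1 * (l * y) :: v))).
  by rewrite prodw_catrev; move: Gxy; rewrite /= !invgM !mulgA.
move: (size_cat (rev [seq x^-1 | x <- u]) ((k * x)^-1 * (l * y) :: v)).
rewrite -catrevE size_rev size_map.
case E: (catrev _ _) red Gw => [|a w] red Gw; first by case: (u) E => //=; lia.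
have [w0 _] := @free _ _ _ _ red Gw; subst w => /= sz0.
have u0 : u = [::] by case: (u) sz0 => //= ? ?; lia.
have v0 : v = [::] by case: (v) sz0 => //= ? ?; lia.
subst u v; exists (k * x), (l * y).
have [|_ sb] := @free _ b _ _ redm; first by move: Gxy; rewrite /= !mulg1 .
by subst s; split=> //; rewrite /= !mulg1.
Qed.

Lemma join_factor B b y : compatible B -> join B y -> G b y -> B b y.
Proof.
move=> cB Jy Gy; have [sB BG BK] := cB.
have c1 : compatible (fun _ => [set 1 : W]).
  split=> [c|c _ ->|c _ ->//]; last by case: (sG c).
  by split=> [//|_ _ -> ->|_ ->]; rewrite ?mulg1 ?invg1.
have [||||p [q [-> Bq]]] := join_quotient c1 cB _ (b := b) (x := 1) (y := y).
- move=> c _ z -> Bz _; exists 1; split=> //; first by case: (sB c).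
  by rewrite mulVg; case: sK.
- by apply: generated_sub; exists true.
- exact: Jy.
- by rewrite invg1 mul1g.
by rewrite invg1 !mul1g => ->.
Qed.

End FactorSubgroups.

(** * Base stabilizers in the amalgam *)

Section Universal.
Variables (n : nat) (X : bool -> rankedRel) (W : groupType).
(** The two polytopes and everything attached to them are indexed by a boolean, so that
    arguments are given once for both; [io b] embeds the automorphism group of [X b] as a
    factor [G b] of [W], and [base b r] is the base face of rank [r]. *)
Variables (Phi : forall b, set (X b)) (gen : forall b, nat -> aut (X b)).
Variables (base : forall b, int -> X b) (io : forall b, aut (X b) -> W).
Arguments Phi : clear implicits.
Hypothesis hn : (0 < n)%N.
Hypothesis regX : forall b, is_regular n (X b).
Hypothesis fPhi : forall b, is_flag (Phi b).
Hypothesis hgen : forall b j, (j < n)%N -> is_distinguished (Phi b) j (gen b j).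
Hypothesis base_in : forall b (r : int), -1 <= r <= n%:Z -> Phi b (base b r).
Hypothesis base_rank : forall b (r : int), -1 <= r <= n%:Z -> rank (base b r) = r.
Hypothesis ioM : forall b, {morph io (b := b) : x y / (x * y)%g}.
Hypothesis io_inj : forall b, injective (io (b := b)).
Hypothesis io_match : forall j, (j.+1 < n)%N -> io (gen true j) = io (gen false j).
Hypothesis W_gen : forall A : set W, is_subgroup A -> (forall b g, A (io (b := b) g)) ->
  forall w, A w.

Let G (b : bool) : set W := range (io (b := b)).
Let alpha (j : nat) : W := io (gen true j).
Let beta : W := io (gen false n.-1).
Let K : set W := ridge_subgroup n alpha.
Let U : rankedRel := coset_poset n (G true) (G false) alpha beta.

Hypothesis free : free_amalgam G K.

Lemma pX b : is_polytope n (X b). Proof. by case: (regX b). Qed.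
Lemma gX b : graded n%:Z (X b). Proof. by have /polytopeP[] := pX b. Qed.

Lemma io1 b : io (b := b) 1%g = 1%g.
Proof. by apply: (@mulIg _ (io (b := b) 1%g)); rewrite -ioM !mul1g. Qed.

Lemma ioV b (g : aut (X b)) : io g^-1%g = (io g)^-1%g.
Proof. by apply: (@mulIg _ (io g)); rewrite -ioM !mulVg io1. Qed.

Lemma sG b : is_subgroup (G b).
Proof.
split; first by exists 1%g; rewrite ?io1.
- by move=> _ _ [x _ <-] [y _ <-]; exists (x * y)%g; rewrite ?ioM.
- by move=> _ [x _ <-]; exists x^-1%g; rewrite ?ioV.
Qed.

Lemma sK : is_subgroup K. Proof. exact: generated_subgroup. Qed.

Definition stab (b : bool) (r : int) : set W :=
  [set io g | g in [set g : aut (X b) | g (base b r) = base b r]].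

Lemma stabP b r (g : aut (X b)) : stab b r (io g) <-> g (base b r) = base b r.
Proof. by split=> [[h hr /io_inj <-]|]//; exists g. Qed.

Lemma stab_subgroup b r : is_subgroup (stab b r).
Proof.
split; first by exists 1%g; rewrite ?io1.
- by move=> _ _ [x hx <-] [y hy <-]; exists (x * y)%g; rewrite ?ioM //= hx hy.
- move=> _ [x hx <-]; exists x^-1%g; rewrite ?ioV //=.
  by rewrite -{1}hx aut_funK.
Qed.

Lemma stab_sub b r : stab b r `<=` G b.
Proof. by move=> _ [g _ <-]; exists g. Qed.

Lemma io_gen b c l : (l.+1 < n)%N -> io (gen b l) = io (gen c l).
Proof. by case: b c => -[] // ln; rewrite io_match. Qed.

Lemma stab_gen b l r : (l < n)%N -> -1 <= r <= n%:Z -> r <> l%:Z ->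
  stab b r (io (gen b l)).
Proof.
move=> ln rn rl; apply/stabP; apply: (gen_fix (pX b) (fPhi b) (@hgen b) ln).
  exact: base_in.
by rewrite base_rank.
Qed.

(** Besides single faces this is needed for a face together with the base facet: the
    generators of that stabilizer are common to both polytopes. *)
Lemma stab_chain b (E : set int) : (forall r, E r -> -1 <= r <= n%:Z) ->
  [set io g | g in [set g : aut (X b) | forall r, E r -> g (base b r) = base b r]] =
  generated [set io (gen b l) | l in [set l | (l < n)%N /\ ~ E l%:Z]].
Proof.
move=> En; set Q := [set g | _].
have -> : Q = generated (gens_off n (gen b) (base b @` E)).
  apply/seteqP; split=> g.
    move=> gE; apply/(stabilizer_generated (pX b) (fPhi b) (@hgen b)).
      by move=> _ [r Er <-]; apply: base_in; exact: En.
    by move=> _ [r Er <-]; exact: gE.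
  move/(stabilizer_generated (pX b) (fPhi b) (@hgen b)) => h r Er.
  apply: h; last by exists r.
  by move=> _ [s Es <-]; apply: base_in; exact: En.
rewrite image_generated; last exact: ioM.
congr generated; apply/seteqP; split=> [_ [_ [l [ln lE] <-] <-]|_ [l [ln lE] <-]].
  exists l => //; split=> // El; apply: (lE (base b l%:Z)); first by exists l%:Z.
  by rewrite base_rank //; exact: En.
exists (gen b l) => //; exists l => //; split=> // _ [r Er <-].
by rewrite base_rank; [move=> e; apply: lE; rewrite -e | exact: En].
Qed.

Lemma stabE b r : -1 <= r <= n%:Z ->
  stab b r = generated [set io (gen b l) | l in [set l | (l < n)%N /\ l%:Z <> r]].
Proof.
move=> rn; rewrite -(stab_chain b (E := [set r])); last by move=> _ ->.
by congr image; apply/seteqP; split=> g gr; [move=> _ -> | exact: gr].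
Qed.

Lemma K_stab b : K = stab b (n%:Z - 1).
Proof.
rewrite stabE; last by lia.
congr generated; apply/seteqP; split=> [_ [l ln <-]|_ [l [ln lr] <-]].
  by exists l; [split; move: ln => /=; lia | rewrite (io_gen b true)].
have ln' : (l.+1 < n)%N by lia.
by exists l; rewrite // /alpha (io_gen true b).
Qed.

Lemma KG b : K `<=` G b.
Proof. by rewrite (K_stab b); exact: stab_sub. Qed.

(** An element of [K] fixing the base face of rank [r] fixes it together with the base
    facet, so it is a product of generators that belong to both polytopes. *)
Lemma stab_compatible r : -1 <= r <= n%:Z -> compatible G K (fun b => stab b r).
Proof.
move=> rn; split=> [b|b|b x]; [exact: stab_subgroup | exact: stab_sub |].
rewrite (K_stab b) => -[g gr <-] /stabP gn.
have : [set io g | g in [set g : aut (X b) |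
    forall s, [set r; n%:Z - 1] s -> g (base b s) = base b s]] (io g).
  by exists g => // s [->|->].
rewrite stab_chain; last by move=> s [->|->] //; lia.
move: (io g); apply: generated_min; first exact: stab_subgroup.
move=> _ [l [ln nE] <-]; have nr : l%:Z <> r by move=> e; apply: nE; left.
have nn : l%:Z <> n%:Z - 1 by move=> e; apply: nE; right.
by rewrite (io_gen b (~~ b)); [apply: stab_gen => //; auto | lia].
Qed.

Lemma low_join j : (j.+1 < n)%N ->
  low_subgroup n alpha beta j = join (fun b => stab b j%:Z).
Proof.
move=> jn.
apply/seteqP; split; apply: generated_min; try exact: generated_subgroup.
  move=> _ [[l [ln lj] <-]|->]; apply: generated_sub.
    by exists true; apply: stab_gen => //; lia.
  by exists false; apply: stab_gen => //; lia.
move=> x [b]; rewrite stabE; last by lia.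
apply: generated_min; first exact: generated_subgroup.
move=> _ [l [ln lj] <-]; apply: generated_sub.
have lj' : l <> j by move=> e; apply: lj; rewrite e.
case: b; first by left; exists l.
have [ln1|nl] := ltnP l.+1 n; first by left; exists l; rewrite // -io_match.
by right; rewrite /beta /= (_ : l = n.-1) //; lia.
Qed.

(** By hypothesis [x^-1] and [y^-1] take the base facet to the same facet [F], which is
    therefore incident with the base faces of rank [i] and [j].  The inverse [z] of an
    automorphism taking the base flag to a flag through these three faces is as wanted. *)
Lemma stab_facet b i j x y : -1 <= i <= n%:Z -> -1 <= j <= n%:Z ->
  stab b i x -> stab b j y -> K (x^-1 * y)%g ->
  exists z, [/\ stab b i z, stab b j z & K (z^-1 * x)%g].
Proof.
move=> ir jr [f fi <-] [g gj <-]; rewrite (K_stab b) -ioV -ioM => /stabP /= fgn.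
set B := base b (n%:Z - 1) in fgn *.
have FE : (f^-1%g : aut (X b)) B = (g^-1%g : aut (X b)) B.
  by apply: (iso_inj (aut_is_iso g)); apply: etrans fgn _; rewrite /= aut_inv_funK.
set F := (f^-1%g : aut (X b)) B in FE.
have rB : rank B = n%:Z - 1 by rewrite base_rank //; lia.
have rF : rank F = n%:Z - 1 by rewrite (aut_rank _ _ (gX b)).
have [totP _] := fPhi b.
have below k : -1 <= k <= n%:Z -> forall h : aut (X b), h (base b k) = base b k ->
    (h^-1%g : aut (X b)) B = F -> le (base b k) F \/ le F (base b k).
  move=> kr h hk <-; have hk' : (h^-1%g : aut (X b)) (base b k) = base b k.
    by rewrite -{1}hk /= aut_funK.
  rewrite -hk' !(aut_is_iso _).2; apply: totP; apply: base_in => //; lia.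
have bi := below i ir f fi erefl; have bj := below j jr g gj (esym FE).
have bij : le (base b i) (base b j) \/ le (base b j) (base b i).
  by apply: totP; exact: base_in.
have rfl := le_refl (gX b).
have [||D fD sub] := @chain_extend (X b) [set base b i; base b j; F]; first exact: rfl.
  move=> u v [[->|->]|->] [[->|->]|->];
    first [exact: bij | exact: bi | exact: bj | by apply/or_comm | by left; exact: rfl].
have [_ trans] := regX b; have [h hD] := trans _ _ (fPhi b) fD.
have totD := fD.1.
have hF H k : -1 <= k <= n%:Z -> D H -> rank H = k -> h (base b k) = H.
  move=> kr DH rH; apply: (chain_inj (gX b) totD) => //.
    by rewrite -hD; exists (base b k) => //; exact: base_in.
  by rewrite (aut_rank _ _ (gX b)) base_rank.
have hi : h (base b i) = base b i.
  by apply: hF => //; [apply: sub; left; left | rewrite base_rank].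
have hj : h (base b j) = base b j.
  by apply: hF => //; [apply: sub; left; right | rewrite base_rank].
have hB : h B = F by apply: hF => //; [lia | apply: sub; right].
exists (io h^-1%g); split; try apply/stabP => /=.
- by rewrite -{1}hi aut_funK.
- by rewrite -{1}hj aut_funK.
rewrite -ioV invgK -ioM; apply/stabP => /=.
by rewrite hB /F /= aut_inv_funK.
Qed.

Lemma last_notK b : ~ K (io (gen b n.-1)).
Proof.
rewrite (K_stab b) => /stabP; apply: (gen_move (pX b) (fPhi b) (@hgen b)).
- lia.
- by apply: base_in; lia.
- by rewrite base_rank; lia.
Qed.

(** * Faces as cosets *)

(** One subgroup per rank; [b] selects the type of facet and only matters for [r = n]. *)
Definition fsub (b : bool) (r : int) : set W :=
  if (r < 0) || (n%:Z < r) then setT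
  else if r < n%:Z - 1 then low_subgroup n alpha beta `|r|%N
  else if r == n%:Z - 1 then K else G b.

Lemma fsub_out b r : r < 0 \/ n%:Z < r -> fsub b r = setT.
Proof. by rewrite /fsub => -[->//|->]; rewrite orbT. Qed.

Lemma fsub_low b j : (j.+1 < n)%N -> fsub b j%:Z = low_subgroup n alpha beta j.
Proof. by move=> jn; rewrite /fsub ifF ?ifT //; lia. Qed.

Lemma fsub_ridge b : fsub b (n%:Z - 1) = K.
Proof. by rewrite /fsub eqxx ltxx ifF //; lia. Qed.

Lemma fsub_facet b : fsub b n%:Z = G b.
Proof. by rewrite /fsub !ifF //; lia. Qed.

Lemma fsub_lt b c r : r <> n%:Z -> fsub b r = fsub c r.
Proof.
move=> rn; rewrite /fsub; case: ifP => // h1; case: ifP => // h2; case: ifP => //; lia.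
Qed.

Lemma fsub_subgroup b r : is_subgroup (fsub b r).
Proof.
rewrite /fsub; case: ifP => _; first by [].
case: ifP => _; first exact: generated_subgroup.
by case: ifP => _; [exact: sK | exact: sG].
Qed.

Lemma fsub_cases (r : int) : -1 <= r <= n%:Z + 1 ->
  [\/ r = -1 \/ r = n%:Z + 1, exists2 j, (j.+1 < n)%N & r = j%:Z,
      r = n%:Z - 1 | r = n%:Z].
Proof.
move=> rn; have [->|h1] := eqVneq r (-1); first by constructor 1; left.
have [->|h2] := eqVneq r (n%:Z + 1); first by constructor 1; right.
have [->|h3] := eqVneq r n%:Z; first by constructor 4.
have [->|h4] := eqVneq r (n%:Z - 1); first by constructor 3.
by constructor 2; exists `|r|%N; lia.
Qed.

Lemma faceP (u : U) : -1 <= rank u <= n%:Z + 1 /\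
  exists b w, coset_set u = right_coset (fsub b (rank u)) w.
Proof.
case: u => r A /=; case=> [|j w jn|w|w|w|]; split; try lia.
- by exists true, 1%g; rewrite fsub_out ?right_cosetT //; left; lia.
- by exists true, w; rewrite fsub_low.
- by exists true, w; rewrite fsub_ridge.
- by exists true, w; rewrite fsub_facet.
- by exists false, w; rewrite fsub_facet.
- by exists true, 1%g; rewrite fsub_out ?right_cosetT //; right; lia.
Qed.

Lemma face_coset b r w : -1 <= r <= n%:Z + 1 ->
  is_coset_face n (G true) (G false) alpha beta r (right_coset (fsub b r) w).
Proof.
move=> /fsub_cases[[->|->]|[j jn ->]|->|->].
- by rewrite fsub_out ?right_cosetT; [exact: coset_face_least | left; lia].
- by rewrite fsub_out ?right_cosetT; [exact: coset_face_greatest | right; lia].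
- by rewrite fsub_low //; exact: coset_face_low.
- by rewrite fsub_ridge; exact: coset_face_ridge.
- by rewrite fsub_facet; case: b; [exact: coset_face_facetP | exact: coset_face_facetQ].
Qed.

Lemma face_at_subproof b r w : exists u : U, -1 <= r <= n%:Z + 1 ->
  rank u = r /\ coset_set u = right_coset (fsub b r) w.
Proof.
have [rn|rn] := boolP (-1 <= r <= n%:Z + 1); last first.
  by exists (CosetFace (coset_face_least n (G true) (G false) alpha beta)).
by exists (CosetFace (face_coset b w rn)).
Qed.

(** For [r] outside the range of ranks the value is arbitrary. *)
Definition face_at b r w : U := projT1 (cid (face_at_subproof b r w)).

Lemma face_at_rank b r w : -1 <= r <= n%:Z + 1 -> rank (face_at b r w) = r.
Proof. by move=> rn; case: (projT2 (cid (face_at_subproof b r w)) rn). Qed.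

Lemma face_at_set b r w : -1 <= r <= n%:Z + 1 ->
  coset_set (face_at b r w) = right_coset (fsub b r) w.
Proof. by move=> rn; case: (projT2 (cid (face_at_subproof b r w)) rn). Qed.

Lemma face_eq (u v : U) : rank u = rank v -> coset_set u = coset_set v -> u = v.
Proof.
case: u v => [r A pA] [s B pB] /= e1 e2; subst s B.
by congr CosetFace; exact: Prop_irrelevance.
Qed.

Lemma face_rank (u : U) : -1 <= rank u <= n%:Z + 1. Proof. by case: (faceP u). Qed.

Lemma face_nonempty (u : U) : exists x, coset_set u x.
Proof.
have [_ [b [w ->]]] := faceP u; exists w.
by apply: right_coset_refl; exact: fsub_subgroup.
Qed.

Lemma face_through (u : U) x : coset_set u x -> exists b, u = face_at b (rank u) x.
Proof.
have [ru [b [w uE]]] := faceP u => ux; exists b.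
apply: face_eq; rewrite ?face_at_rank ?face_at_set //.
by rewrite uE; apply: right_coset_mem; [exact: fsub_subgroup | rewrite -uE].
Qed.

Lemma face_at_mem b r x : -1 <= r <= n%:Z + 1 -> coset_set (face_at b r x) x.
Proof. by move=> rn; rewrite face_at_set //; apply: right_coset_refl; exact: fsub_subgroup. Qed.

Lemma face_at_in b r x y : -1 <= r <= n%:Z + 1 ->
  coset_set (face_at b r x) y <-> fsub b r (y * x^-1)%g.
Proof. by move=> rn; rewrite face_at_set // right_cosetP. Qed.

Lemma face_at_lt b c r x : r <> n%:Z -> -1 <= r <= n%:Z + 1 -> face_at b r x = face_at c r x.
Proof. by move=> rn rr; apply: face_eq; rewrite ?face_at_rank ?face_at_set // (fsub_lt b c). Qed.

Lemma face_through_lt b (u : U) x : coset_set u x -> rank u <> n%:Z -> u = face_at b (rank u) x.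
Proof.
by move=> /face_through[c uE] ru; rewrite {1}uE (face_at_lt c b) //; exact: face_rank.
Qed.

Lemma face_at_eq b r x y : -1 <= r <= n%:Z + 1 -> coset_set (face_at b r x) y ->
  face_at b r x = face_at b r y.
Proof.
move=> rn; rewrite face_at_set // => xy; apply: face_eq; rewrite ?face_at_rank ?face_at_set //.
by apply: right_coset_mem => //; exact: fsub_subgroup.
Qed.

Lemma le_common (u v : U) x : coset_set u x -> coset_set v x -> rank u < rank v -> le u v.
Proof. by move=> ux vx r; left; split=> //; exists x. Qed.

Lemma le_cases (u v : U) : le u v ->
  u = v \/ rank u < rank v /\ exists x, coset_set u x /\ coset_set v x.
Proof.
move=> [[r [x [ux vx]]]|[r s]]; last by left; exact: face_eq.
by right; split=> //; exists x.
Qed.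

(** Generators of index below [j] commute with those of index above [j], and the subgroup
    of rank [j] is the product [L * M] of what the two sorts generate; [L] lies in all
    subgroups of higher rank, [M] in all those of lower rank. *)
Lemma fsub_split b c d i j k x : -1 <= i -> i < j -> j < k -> k <= n%:Z + 1 ->
  fsub b j x -> exists l m, [/\ fsub c k l, fsub d i m & x = (l * m)%g].
Proof.
move=> i1 ij jk kn xj.
have one e r : fsub e r 1%g by case: (fsub_subgroup e r).
have [i0|i0] := ltrP i 0.
  exists 1%g, x; split; rewrite ?mul1g //; rewrite fsub_out //; left; lia.
have [nk|kn'] := ltrP n%:Z k.
  exists x, 1%g; split; rewrite ?mulg1 //; rewrite fsub_out //; right; lia.
have [jn|jn] := lerP (n%:Z - 1) j.
  have jE : j = n%:Z - 1 by lia.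
  have kE : k = n%:Z by lia.
  subst j k; exists x, 1%g; rewrite mulg1; split=> //.
  by rewrite fsub_facet; apply: KG; rewrite -(fsub_ridge b).
have [j' jE] : exists j' : nat, j = j'%:Z by exists `|j|%N; lia.
have [i' iE] : exists i' : nat, i = i'%:Z by exists `|i|%N; lia.
subst i j; have jn' : (j'.+1 < n)%N by lia.
move: xj; rewrite fsub_low // => xj.
pose L := generated [set alpha l | l in [set l | (l < j')%N]].
pose M := generated ([set alpha l | l in [set l | (j' < l < n)%N]] `|` [set beta]).
have [L1 LM LV] : is_subgroup L by exact: generated_subgroup.
have [M1 MM MV] : is_subgroup M by exact: generated_subgroup.
have comm l m : L l -> M m -> (l * m = m * l)%g.
  pose cent A := [set x : W | forall y, A y -> (x * y = y * x)%g].
  have cent_sub A : is_subgroup (cent A).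
    split=> [y _|y z hy hz t At|y hy t At]; first by rewrite mul1g mulg1.
      by rewrite -mulgA (hz t At) mulgA (hy t At) mulgA.
    by apply: (@mulgI _ y); rewrite mulVKg mulgA (hy t At) mulgK.
  have base_comm y : M y -> cent [set alpha l | l in [set l | (l < j')%N]] y.
    move: y; apply: generated_min; first exact: cent_sub.
    move=> _ [[a /= ja <-]|->] _ [c' /= cj <-].
      rewrite /alpha -!ioM; congr io; apply/esym.
      by apply: (gen_comm (pX true) (fPhi true) (@hgen true)); lia.
    rewrite /alpha /beta (io_gen true false); last by lia.
    rewrite -!ioM; congr io; apply/esym.
    by apply: (gen_comm (pX false) (fPhi false) (@hgen false)); lia.
  move=> Ll Mm; suff : cent [set m] l by apply.
  move: l Ll; apply: generated_min; first exact: cent_sub.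
  by move=> _ [a aj <-] _ ->; rewrite (base_comm m Mm) //; exists a.
have Lk : L `<=` fsub c k.
  apply: generated_min; first exact: fsub_subgroup.
  move=> _ [l /= lj <-].
  have [kk|] := ltrP k (n%:Z - 1).
    have [k' kE] : exists k' : nat, k = k'%:Z by exists `|k|%N; lia.
    subst k; rewrite fsub_low; last by lia.
    by apply: generated_sub; left; exists l => //=; lia.
  rewrite le_eqVlt => /orP[/eqP <-|kk]; first rewrite fsub_ridge.
    by apply: generated_sub; exists l => //=; lia.
  have -> : k = n%:Z by lia.
  rewrite fsub_facet /alpha (io_gen true c); last by lia.
  by eexists.
have Mi : M `<=` fsub d i'%:Z.
  apply: generated_min; first exact: fsub_subgroup.
  rewrite fsub_low; last by lia.
  move=> _ [[l /= lj <-]|->]; apply: generated_sub; last by right.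
  by left; exists l => //=; lia.
suff [l [m [Ll Mm ->]]] : exists l m, [/\ L l, M m & x = (l * m)%g].
  by exists l, m; split; [exact: Lk | exact: Mi |].
move: x xj; apply: generated_min.
  split.
  - by exists 1%g, 1%g; rewrite mulg1.
  - move=> _ _ [l [m [Ll Mm ->]]] [l' [m' [Ll' Mm' ->]]].
    exists (l * l')%g, (m * m')%g; split; [exact: LM | exact: MM |].
    by rewrite mulgA -(mulgA l m l') -(comm l' m) // !mulgA.
  - move=> _ [l [m [Ll Mm ->]]]; exists l^-1%g, m^-1%g.
    by split; [exact: LV | exact: MV | rewrite comm // invgM].
move=> _ [[l [ln lj] <-]|->]; last first.
  exists 1%g, beta; rewrite mul1g; split=> //.
  by apply: generated_sub; right.
have [lj'|lj'] := ltnP l j'.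
  by exists (alpha l), 1%g; rewrite mulg1; split=> //; apply: generated_sub; exists l.
exists 1%g, (alpha l); rewrite mul1g; split=> //.
by apply: generated_sub; left; exists l => //=; lia.
Qed.

(** For transitivity, let [x] be common to [u] and [v], and [y] to [v] and [w].  Writing
    [y * x^-1 = l * m] as in [fsub_split], the element [m * x = l^-1 * y] is common to
    [u] and [w]. *)
Lemma U_po : is_partial_order U.
Proof.
split.
- by move=> u; right.
- move=> u v /le_cases[//|[uv _]] /le_cases[//|[vu _]]; lia.
move=> u v w /le_cases[->//|[uv [x [ux vx]]]] /le_cases[<-|[vw [y [vy wy]]]].
  exact: (le_common ux vx).
have [c uE] := face_through ux; have [b vE] := face_through vx.
have [d wE] := face_through wy.
have ru := face_rank u; have rv := face_rank v; have rw := face_rank w.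
have : fsub b (rank v) (y * x^-1)%g by rewrite -face_at_in // -vE.
move=> /(fsub_split d c (i := rank u) (k := rank w))[||||l [m [Ll Mm yx]]] //; try lia.
have e : (l^-1 * y = m * x)%g.
  by apply: (@mulIg _ x^-1%g); rewrite -mulgA yx mulKg mulgK.
apply: (le_common (x := (m * x)%g)); last by lia.
- by rewrite uE face_at_in // mulgK.
- rewrite -e wE face_at_in // mulgK.
  by case: (fsub_subgroup d (rank w)) => _ _; apply.
Qed.

Lemma U_le_rank (u v : U) : le u v -> rank u <= rank v.
Proof. by move=> /le_cases[->//|[/ltW]]. Qed.

(** * The action of the amalgamated product *)

Notation is_U_face := (is_coset_face n (G true) (G false) alpha beta).

Lemma U_face_mul r A w : is_U_face r A -> is_U_face r (right_coset A w).
Proof.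
case=> [|j v jn|v|v|v|]; rewrite ?right_cosetM ?right_cosetT; by constructor.
Qed.

Definition act_face (w : W) (u : U) : U := CosetFace (U_face_mul w (coset_faceP u)).

Lemma act_face_mul v w u : act_face w (act_face v u) = act_face (v * w)%g u.
Proof. by apply: face_eq => //=; rewrite right_cosetM. Qed.

Lemma act_face1 u : act_face 1%g u = u.
Proof. by apply: face_eq => //=; rewrite right_coset1. Qed.

Lemma act_faceK w : cancel (act_face w) (act_face w^-1%g).
Proof. by move=> u; rewrite act_face_mul mulgV act_face1. Qed.

Lemma act_faceVK w : cancel (act_face w^-1%g) (act_face w).
Proof. by move=> u; rewrite act_face_mul mulVg act_face1. Qed.

Lemma act_face_homo w u v : le u v -> le (act_face w u) (act_face w v).
Proof.
move=> /le_cases[->|[r [x [ux vx]]]]; first by right.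
by apply: (le_common (x := (x * w)%g)) => //=; exists x.
Qed.

Lemma act_face_le w u v : le (act_face w u) (act_face w v) <-> le u v.
Proof.
split; last exact: act_face_homo.
by move=> /(act_face_homo w^-1%g); rewrite !act_faceK.
Qed.

Definition act (w : W) : aut U := Aut (act_faceK w) (act_faceVK w) (act_face_le w).

Lemma act_mul v w : act (v * w)%g = (act v * act w)%g.
Proof. by apply: aut_eq => u /=; rewrite act_face_mul. Qed.

Lemma act1 : act 1%g = 1%g.
Proof. by apply: aut_eq => u; exact: act_face1. Qed.

Lemma actV w : act w^-1%g = (act w)^-1%g.
Proof. by apply: (@mulIg _ (act w)); rewrite -act_mul !mulVg act1. Qed.

Lemma act_rank w u : rank (act w u) = rank u. Proof. by []. Qed.

Lemma act_set w u : coset_set (act w u) = right_coset (coset_set u) w. Proof. by []. Qed.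

Lemma act_mkf b r x w : -1 <= r <= n%:Z + 1 -> act w (face_at b r x) = face_at b r (x * w)%g.
Proof.
move=> rn; apply: face_eq.
  by rewrite act_rank !face_at_rank.
by rewrite act_set !face_at_set // right_cosetM.
Qed.

(** * Facets *)

Notation facet b x := (face_at b n%:Z x).
Let bot : U := coset_bot n (G true) (G false) alpha beta.
Let top : U := coset_top n (G true) (G false) alpha beta.

Lemma rank_facet_range : -1 <= n%:Z <= n%:Z + 1. Proof. lia. Qed.
Hint Resolve rank_facet_range : core.

Lemma facet_rank b x : rank (facet b x) = n%:Z. Proof. exact: face_at_rank. Qed.

Lemma bot_le (u : U) : le bot u.
Proof.
have [x ux] := face_nonempty u; have ru := face_rank u.
have [r|r] := eqVneq (rank u) (-1); last first.
  by apply: (le_common (x := x)) => //; rewrite (_ : rank bot = -1) //; lia.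
rewrite (face_through_lt true ux); last by rewrite r; lia.
suff -> : face_at true (rank u) x = bot by have [rfl _ _] := U_po; exact: rfl.
rewrite r; apply: face_eq; first by rewrite face_at_rank //; lia.
by rewrite face_at_set ?fsub_out ?right_cosetT //; lia.
Qed.

Lemma top_ge (u : U) : le u top.
Proof.
have [x ux] := face_nonempty u; have ru := face_rank u.
have [r|r] := eqVneq (rank u) (n%:Z + 1); last first.
  by apply: (le_common (x := x)) => //; rewrite (_ : rank top = n%:Z + 1) //; lia.
rewrite (face_through_lt true ux); last by rewrite r; lia.
suff -> : face_at true (rank u) x = top by have [rfl _ _] := U_po; exact: rfl.
rewrite r; apply: face_eq; first by rewrite face_at_rank //; lia.
by rewrite face_at_set ?fsub_out ?right_cosetT //; lia.
Qed.

(** For low ranks this rests on normal forms: the face subgroup is generated by the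
    stabilizers in both polytopes, and yet it meets a factor in just one of them. *)
Lemma fsub_trace b r (g : aut (X b)) : -1 <= r <= n%:Z ->
  fsub b r (io g) <-> g (base b r) = base b r.
Proof.
move=> rn; rewrite -stabP; have rn' : -1 <= r <= n%:Z + 1 by lia.
have gfix : forall H, is_least H \/ is_greatest H -> g H = H.
  move=> H h; case: h => h.
    apply: (le_anti (gX b)); last exact: h.
    by rewrite -{2}(aut_inv_funK g H) (aut_is_iso g).2; exact: h.
  apply: (le_anti (gX b)); first exact: h.
  by rewrite -{1}(aut_inv_funK g H) (aut_is_iso g).2; exact: h.
case: (fsub_cases rn') => [[rE|rE]|[j jn rE]|rE|rE]; subst r; last 1 first.
- rewrite fsub_facet; split=> [_|]; last exact: stab_sub.
  apply/stabP/gfix; right; have [t tg rt] := graded_top (gX b).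
  suff -> : base b n%:Z = t by [].
  by apply: (le_rank_eq (gX b)); [exact: tg | rewrite rt base_rank].
- rewrite fsub_out; last by left; lia.
  split=> // _; apply/stabP/gfix; left; have [t tg rt] := graded_bot (gX b).
  suff <- : t = base b (-1) by [].
  by apply: (le_rank_eq (gX b)); [exact: tg | rewrite rt base_rank].
- lia.
- rewrite fsub_low // low_join //; split=> [h|]; last by move=> h; apply: generated_sub; exists b.
  apply: (join_factor sG sK KG free (stab_compatible rn) h).
  by eexists.
- by rewrite fsub_ridge (K_stab b).
Qed.

Lemma base_trans b (F : X b) : exists g : aut (X b), g (base b (rank F)) = F.
Proof.
have [_ trans] := regX b; have rfl := le_refl (gX b).
have [||D fD sub] := @chain_extend (X b) [set F]; first exact: rfl.
  by move=> u v -> ->; left.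
have [g gD] := trans _ _ (fPhi b) fD; exists g.
have rF := graded_range (gX b) F.
apply: (chain_inj (gX b) fD.1); last by rewrite (aut_rank _ _ (gX b)) base_rank.
  by rewrite -gD; exists (base b (rank F)) => //; exact: base_in.
exact: sub.
Qed.

Lemma base_trans2 b (F F' : X b) : lt F F' ->
  exists g : aut (X b), g (base b (rank F)) = F /\ g (base b (rank F')) = F'.
Proof.
move=> [FF' _]; have [_ trans] := regX b; have rfl := le_refl (gX b).
have [||D fD sub] := @chain_extend (X b) [set F; F']; first exact: rfl.
  by move=> u v [->|->] [->|->]; [left|left|right|left].
have [g gD] := trans _ _ (fPhi b) fD; exists g.
have gE H : D H -> g (base b (rank H)) = H.
  move=> DH; have rH := graded_range (gX b) H.
  apply: (chain_inj (gX b) fD.1) => //; last by rewrite (aut_rank _ _ (gX b)) base_rank.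
  by rewrite -gD; exists (base b (rank H)) => //; exact: base_in.
by split; apply: gE; apply: sub; [left | right].
Qed.

(** By [emb_mem] this face meets [G b] in the coset of the automorphisms that take the
    base face of the same rank to [F]. *)
Definition emb b (F : X b) : U := face_at b (rank F) (io (projT1 (cid (base_trans F)))).

Lemma rank_range b (F : X b) : -1 <= rank F <= n%:Z + 1.
Proof. by have := graded_range (gX b) F; lia. Qed.

Lemma emb_rank b (F : X b) : rank (emb F) = rank F.
Proof. by rewrite /emb face_at_rank //; exact: rank_range. Qed.

Lemma emb_mem b (F : X b) (g : aut (X b)) :
  coset_set (emb F) (io g) <-> g (base b (rank F)) = F.
Proof.
rewrite /emb; case: (cid _) => h /= hF; have rF := graded_range (gX b) F.
rewrite face_at_in; last exact: rank_range.
rewrite -ioV -ioM fsub_trace //=; split=> [e|->].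
  by apply: etrans _ hF; rewrite -{2}e aut_inv_funK.
by apply: (iso_inj (aut_is_iso h)); rewrite aut_inv_funK hF.
Qed.

Lemma emb_inj b : injective (emb (b := b)).
Proof.
move=> F F' e; have [g gF] := base_trans F.
have : coset_set (emb F') (io g) by rewrite -e emb_mem.
by rewrite emb_mem -(emb_rank F') -e emb_rank gF.
Qed.

Lemma emb_lt b (F F' : X b) : lt F F' -> le (emb F) (emb F').
Proof.
move=> FF'; have [g [gF gF']] := base_trans2 FF'.
apply: (le_common (x := io g)); [by rewrite emb_mem|by rewrite emb_mem|].
by rewrite !emb_rank; exact: (graded_lt (gX b)).
Qed.

Lemma base_le b i j : -1 <= i -> i <= j -> j <= n%:Z -> le (base b i) (base b j).
Proof.
by move=> *; apply: (chain_le (gX b) (fPhi b).1); rewrite ?base_rank //;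
  try apply: base_in; lia.
Qed.

(** Two faces of [U] that meet each other and both meet [G b] have a common element in
    [G b]: a common element [x] is [a * io g0 = c * io g1] with [a], [c] in the face
    subgroups, and [join_quotient] corrects [a] and [c] to elements of [G b]. *)
Lemma emb_le b (F F' : X b) : le (emb F) (emb F') <-> le F F'.
Proof.
split; last first.
  move=> /(le_eq_or_lt)[->|]; last exact: emb_lt.
  by have [rfl _ _] := U_po; exact: rfl.
move=> /le_cases[/emb_inj ->|]; first exact: (le_refl (gX b)).
rewrite !emb_rank => -[r [x [Fx F'x]]].
have rF := graded_range (gX b) F; have rF' := graded_range (gX b) F'.
suff [g [Fg F'g]] : exists g : aut (X b), coset_set (emb F) (io g) /\ coset_set (emb F') (io g).
  rewrite -((emb_mem F g).1 Fg) -((emb_mem F' g).1 F'g) (aut_is_iso g).2.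
  by apply: base_le; lia.
have [g0 g0F] := base_trans F; have [g1 g1F] := base_trans F'.
have E0 : emb F = face_at b (rank F) (io g0).
  have := @face_through_lt b (emb F) (io g0); rewrite emb_rank; apply; last by lia.
  by rewrite emb_mem.
have E1 (y : W) : coset_set (emb F') y <-> fsub b (rank F') (y * (io g1)^-1)%g.
  have : coset_set (emb F') (io g1) by rewrite emb_mem.
  rewrite /emb => /face_at_eq ->; [|exact: rank_range].
  by rewrite face_at_in //; exact: rank_range.
have E0' (y : W) : coset_set (emb F) y <-> fsub b (rank F) (y * (io g0)^-1)%g.
  by rewrite E0 face_at_in //; exact: rank_range.
have Gio (g : aut (X b)) : G b (io g) by exists g.
have [_ GM GV] := sG b.
have [r1|r1] := eqVneq (rank F) (-1).
  exists g1; split; last exact/emb_mem.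
  by apply/E0'; rewrite r1 fsub_out //; left; lia.
have [rn|rn] := eqVneq (rank F') n%:Z.
  exists g0; split; first exact/emb_mem.
  by apply/E1; rewrite rn fsub_facet; apply: GM => //; exact: GV.
have [rn1|rn1] := eqVneq (rank F') (n%:Z - 1).
  have : fsub b (rank F') (x * (io g1)^-1)%g by rewrite -E1.
  rewrite rn1 fsub_ridge => /(@KG b) /GM /(_ (Gio g1)); rewrite mulgVK => -[g _ gx].
  by exists g; rewrite gx.
have [i iE] : exists i : nat, rank F = i%:Z by exists `|rank F|%N; lia.
have [j jE] : exists j : nat, rank F' = j%:Z by exists `|rank F'|%N; lia.
have Ji : join (fun c => stab c (rank F)) (x * (io g0)^-1)%g.
  by have := (E0' x).1 Fx; rewrite iE fsub_low ?low_join //; lia.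
have Jj : join (fun c => stab c (rank F')) (x * (io g1)^-1)%g.
  by have := (E1 x).1 F'x; rewrite jE fsub_low ?low_join //; lia.
have e : ((x * (io g0)^-1)^-1 * (x * (io g1)^-1) = io g0 * (io g1)^-1)%g.
  by rewrite invgM invgK -!mulgA mulKg.
have [||_ [q [[p pF <-] [q' qF qE] pq]]] := join_quotient sG sK KG free
  (stab_compatible rF) (stab_compatible rF') _ Ji Jj (b := b).
- by move=> c y z; exact: stab_facet.
- by rewrite e; apply: GM => //; exact: GV.
subst q; exists (p * g0)%g; split; [apply/E0' | apply/E1]; rewrite ioM.
  by rewrite mulgK; apply/fsub_trace.
by rewrite -mulgA -e pq mulVKg; apply/fsub_trace.
Qed.

Lemma le_facet b (u : U) x : coset_set u x -> rank u < n%:Z -> le u (facet b x).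
Proof. by move=> ux r; apply: (le_common ux); rewrite ?facet_rank //; exact: face_at_mem. Qed.

Lemma emb_through b (F : X b) w : coset_set (emb F) w -> emb F = face_at b (rank F) w.
Proof. by rewrite /emb => /face_at_eq -> //; exact: rank_range. Qed.

Lemma emb_le_facet b (F : X b) : le (emb F) (facet b 1).
Proof.
have [g gF] := base_trans F; have gm : coset_set (emb F) (io g) by apply/emb_mem.
have fg : coset_set (facet b 1%g) (io g).
  by rewrite face_at_in // fsub_facet invg1 mulg1; exists g.
have [r|r] := eqVneq (rank F) n%:Z.
  suff -> : emb F = facet b 1%g by have [rfl _ _] := U_po; exact: rfl.
  by rewrite (face_at_eq _ fg) // (emb_through gm) r.
apply: (le_common gm fg); rewrite emb_rank facet_rank.
by have := graded_range (gX b) F; lia.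
Qed.

Lemma emb_onto b (u : U) : le u (facet b 1) -> exists F : X b, emb F = u.
Proof.
have fio g : coset_set (facet b 1%g) g -> exists h : aut (X b), io h = g.
  by rewrite face_at_in // fsub_facet invg1 mulg1 => -[h _ hg]; exists h.
move=> uf; have ur : rank u <= n%:Z by rewrite -(facet_rank b 1); exact: U_le_rank.
have ru := face_rank u; have ru' : -1 <= rank u <= n%:Z by lia.
have [g ug uE] : exists2 g : aut (X b), coset_set u (io g) & u = face_at b (rank u) (io g).
  case: (le_cases uf) => [->|[r [x [ux /fio[g gx]]]]].
    exists 1%g; rewrite io1 ?facet_rank //; exact: face_at_mem.
  exists g; rewrite gx //; apply: face_through_lt => //.
  by move: r; rewrite facet_rank; lia.
have rF : rank (g (base b (rank u))) = rank u by rewrite (aut_rank _ _ (gX b)) base_rank.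
exists (g (base b (rank u))); rewrite [RHS]uE.
have em : coset_set (emb (g (base b (rank u)))) (io g) by apply/emb_mem; rewrite rF.
by rewrite (emb_through em) rF.
Qed.

Lemma act_emb b (g : aut (X b)) (F : X b) : act (io g) (emb F) = emb (g F).
Proof.
have [h hF] := base_trans F; have hm : coset_set (emb F) (io h) by apply/emb_mem.
have rF := aut_rank g F (gX b).
have hm' : coset_set (emb (g F)) (io h * io g)%g.
  by rewrite -ioM emb_mem rF /= hF.
rewrite -ioM in hm'; rewrite (emb_through hm) (emb_through hm') rF ioM.
by rewrite act_mkf //; exact: rank_range.
Qed.

Lemma bot_section_rank (f : U) (A : section bot f) : rank A = rank (sval A).
Proof. by rewrite (_ : rank A = rank (sval A) - (-1) - 1) //; lia. Qed.

(** The faces below the facet [G b] are the values of [emb]; other facets are translates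
    of this one. *)
Lemma facet_iso b x : exists h : X b -> section bot (facet b x),
  [/\ is_iso h, forall F, rank (h F) = rank F & forall F, sval (h F) = act x (emb F)].
Proof.
have fx : act x (facet b 1) = facet b x by rewrite act_mkf // mul1g.
have p (F : X b) : le bot (act x (emb F)) /\ le (act x (emb F)) (facet b x).
  split; first exact: bot_le.
  by rewrite -fx (aut_is_iso (act x)).2; exact: emb_le_facet.
have q (A : section bot (facet b x)) : exists F : X b, emb F = act x^-1%g (sval A).
  apply: emb_onto; rewrite -(aut_is_iso (act x)).2 fx.
  rewrite (_ : act x (act x^-1%g (sval A)) = sval A); first exact: (svalP A).2.
  exact: act_faceVK.
have [g gE] := choice q.
exists (fun F => in_section (p F)); split=> // [|F]; last first.
  by rewrite bot_section_rank act_rank emb_rank.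
apply: (@is_iso_of_cancel _ _ _ g).
- by move=> F; apply: emb_inj; rewrite gE; exact: act_faceK.
- by move=> A; apply: section_eq; rewrite /= gE; exact: act_faceVK.
- by move=> F F' FF' /=; apply: act_face_homo; apply/emb_le.
- by move=> A B AB; rewrite -emb_le !gE; apply: act_face_homo; exact: AB.
Qed.

Lemma facet_polytope b x : is_polytope n (section bot (facet b x)).
Proof. by have [h [isoh rh _]] := facet_iso b x; exact: iso_polytope isoh rh _ (pX b). Qed.

(** * The polytope axioms *)

Lemma below_facet (v : U) : rank v <= n%:Z -> exists b x, le v (facet b x).
Proof.
move=> rv; have [x vx] := face_nonempty v.
have [r|r] := eqVneq (rank v) n%:Z; last by exists true, x; apply: le_facet => //; lia.
have [b vE] := face_through vx; exists b, x; rewrite {1}vE r.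
by have [rfl _ _] := U_po; exact: rfl.
Qed.

Lemma top_uniq (v : U) : n%:Z < rank v -> v = top.
Proof.
move=> rv; have [//|[]] := le_cases (top_ge v).
by have := face_rank v; rewrite (_ : rank top = n%:Z + 1) //; lia.
Qed.

Lemma U_lt_rank (u v : U) : lt u v -> rank u < rank v.
Proof. by move=> [/le_cases[//|[]]]. Qed.

Lemma U_rank_lt (u v : U) : le u v -> rank u < rank v -> lt u v.
Proof. by move=> uv r; split=> // e; rewrite e ltxx in r. Qed.

(** Everything but the greatest face happens below a facet, where density is known. *)
Lemma U_graded : graded (n.+1)%:Z U.
Proof.
have [rfl anti tr] := U_po.
have dense_facet b x (u v : U) j : le v (facet b x) -> lt u v -> rank u < j < rank v ->
    exists w : U, [/\ rank w = j, lt u w & lt w v].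
  move=> vf uv jr; have /polytopeP[gS _ _] := facet_polytope b x.
  have uf : le u (facet b x) by apply: tr vf; case: uv.
  pose u' : section bot (facet b x) := in_section (conj (bot_le u) uf).
  pose v' : section bot (facet b x) := in_section (conj (bot_le v) vf).
  have uv' : lt u' v' by rewrite section_lt.
  have [|w [rw uw wv]] := graded_dense gS (j := j) uv'.
    by rewrite !bot_section_rank.
  rewrite bot_section_rank in rw; rewrite !section_lt in uw wv.
  by exists (sval w).
split.
- exact: U_po.
- exact: U_lt_rank.
- by move=> u; have := face_rank u; lia.
- by exists bot => // u; exact: bot_le.
- exists top => [u|]; first exact: top_ge.
  by rewrite (_ : rank top = n%:Z + 1) //; lia.
- move=> u v j uv jr; have [rv|rv] := lerP (rank v) n%:Z.
    have [b [x vf]] := below_facet rv; exact: dense_facet vf uv jr.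
  have vE := top_uniq rv; have ru : rank u < n%:Z by have := face_rank v; lia.
  have [x ux] := face_nonempty u.
  have uf : lt u (facet true x) by apply: U_rank_lt; [exact: le_facet | rewrite facet_rank].
  have fv : lt (facet true x) v.
    by apply: U_rank_lt; [rewrite vE; exact: top_ge | rewrite facet_rank].
  have [jn|jn] := eqVneq j n%:Z; first by exists (facet true x); rewrite facet_rank.
  have [|w [rw uw wf]] := dense_facet true x u (facet true x) j (rfl _) uf.
    by rewrite facet_rank; have := face_rank v; lia.
  exists w; split=> //; apply: U_rank_lt; last by rewrite rw; lia.
  by rewrite vE; exact: top_ge.
Qed.

(** Otherwise one factor would contain the other, and the last generator of the smaller
    one would be in both, that is, in [K]. *)
Lemma facet_type b c x y : facet b x = facet c y -> b = c.
Proof.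
move=> e; apply: contrapT => bc.
have /(_ (io (gen b n.-1))) : G b `<=` G c.
  move=> z bz.
  have : coset_set (facet b x) (z * x)%g by rewrite face_at_in // fsub_facet mulgK.
  have : coset_set (facet b x) x by exact: face_at_mem.
  rewrite e !face_at_in // !fsub_facet => xy zxy; have [_ GM GV] := sG c.
  have -> : z = (z * x * y^-1 * (x * y^-1)^-1)%g by rewrite invgM invgK mulgA mulgVK mulgK.
  by apply: GM => //; exact: GV.
move=> h; apply: (@last_notK b).
have cb : c = ~~ b by move: bc; case: (b); case: (c) => // h'; case: h'.
have Gb : G b (io (gen b n.-1)) by exists (gen b n.-1).
have Gc := h Gb.
apply: (K_factors sG sK free); case: b c cb {e bc h x y} Gb Gc => -[] //.
Qed.

Lemma facets_over (u : U) x b (f : U) : rank u = n%:Z - 1 -> coset_set u x ->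
  rank f = n%:Z -> le u f -> (f = facet b x \/ f = facet (~~ b) x).
Proof.
move=> ru ux rf /le_cases[e|[_ [y [uy fy]]]]; first by move: ru; rewrite e; lia.
have [c fE] := face_through fy; rewrite {}fE rf.
suff -> : facet c y = facet c x.
  by have [->|/eqP cb] := eqVneq c b; [left | right; congr face_at; move: cb; case: (c); case: (b)].
apply: face_at_eq => //; rewrite face_at_in // fsub_facet; apply: KG.
rewrite -(fsub_ridge true) -ru -face_at_in; last exact: face_rank.
by rewrite -(face_through_lt true uy) //; lia.
Qed.

(** Below a facet this holds since facets are polytopes; between a ridge [K * x] and the
    greatest face there are the two facets through [x], one of each type. *)
Lemma U_diamond : diamond U.
Proof.
have [rfl anti tr] := U_po.
move=> j u v uv ru rv; have [rvn|rvn] := lerP (rank v) n%:Z.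
  have [b [x vf]] := below_facet rvn; have /polytopeP[_ dS _] := facet_polytope b x.
  have uf : le u (facet b x) by apply: tr vf; case: uv.
  pose u' : section bot (facet b x) := in_section (conj (bot_le u) uf).
  pose v' : section bot (facet b x) := in_section (conj (bot_le v) vf).
  have uv' : lt u' v' by rewrite section_lt.
  have := dS j _ _ uv'; rewrite !bot_section_rank => /(_ ru rv)/card_I2P[].
  move=> a [c [ac E]]; apply/card_I2P; exists (sval a), (sval c).
  split; first by move/section_eq.
  apply/seteqP; split=> [w [rw uw wv]|w].
    have wf : le w (facet b x) by apply: (tr _ _ _ _ vf); case: wv.
    have : [set H : section bot (facet b x) | [/\ rank H = j, lt u' H & lt H v']]
        (in_section (conj (bot_le w) wf)).
      by split; rewrite ?section_lt ?bot_section_rank.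
    by rewrite E => -[<-|<-]; [left | right].
  have inE s : (s = a \/ s = c) -> [/\ rank (sval s) = j, lt u (sval s) & lt (sval s) v].
    move=> hs; have : [set H : section bot (facet b x) | [/\ rank H = j, lt u' H & lt H v']] s.
      by rewrite E.
    by move=> [rs us sv]; rewrite bot_section_rank in rs; rewrite !section_lt in us sv.
  by move=> [->|->]; apply: inE; [left | right].
have vE := top_uniq rvn.
have jn : j = n%:Z by have := face_rank v; lia.
have [x ux] := face_nonempty u.
apply/card_I2P; exists (facet true x), (facet false x); split; first by move/facet_type.
apply/seteqP; split=> [w [rw uw wv]|w].
  by apply: facets_over ux _ _; [rewrite ru jn | rewrite rw | case: uw].
have inE b : [/\ rank (facet b x) = j, lt u (facet b x) & lt (facet b x) v].
  rewrite facet_rank; split=> //; apply: U_rank_lt; rewrite ?facet_rank ?rv ?ru //; try lia.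
    by apply: le_facet => //; lia.
  by rewrite vE; exact: top_ge.
by move=> [->|->].
Qed.

(** The generators of a face subgroup of rank less than [n] lie in one of the factors. *)
Lemma fsub_ind b r (A : set W) : r < n%:Z -> is_subgroup A ->
  (forall c x, fsub b r x -> G c x -> A x) -> fsub b r `<=` A.
Proof.
move=> rn sA h.
have [r0|r0] := ltrP r 0.
  move=> x _; apply: (W_gen sA) => c g.
  by apply: (h c); [rewrite fsub_out //; left | exists g].
have [rn1|rn1] := ltrP r (n%:Z - 1); last first.
  have -> : r = n%:Z - 1 by lia.
  rewrite fsub_ridge => x Kx; apply: (h true); last exact: KG.
  by rewrite (_ : r = n%:Z - 1) ?fsub_ridge //; lia.
have [j jE] : exists j : nat, r = j%:Z by exists `|r|%N; lia.
have jn : (j.+1 < n)%N by lia.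
have sub : fsub b r `<=` join (fun c => stab c j%:Z) by rewrite jE fsub_low // low_join.
move=> x /sub; move: x; apply: generated_min => // x [c hx].
apply: (h c); last exact: stab_sub hx.
rewrite jE fsub_low // low_join //; apply: generated_sub; by exists c.
Qed.

(** Only co-faces need an argument.  Flags of the co-face at [u] through the same facet are
    joined inside this facet.  For [x] in [u], the two facets through [x] share a ridge
    that contains [u].  Finally, multiplying [x] by an element of a factor that stabilizes [u] does
    not change the facet of that type through [x]; such elements generate the stabilizer
    of [u], which is transitive on the facets of each type above [u]. *)
Lemma U_connected : sections_connected U.
Proof.
have [rfl anti tr] := U_po; have gU := U_graded.
have con_facet b x (u v : U) : le u v -> le v (facet b x) -> flag_connected (section u v).
  move=> uv vf; have /polytopeP[_ _ cS] := facet_polytope b x.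
  have uf : le u (facet b x) by exact: tr uv vf.
  pose u' : section bot (facet b x) := in_section (conj (bot_le u) uf).
  pose v' : section bot (facet b x) := in_section (conj (bot_le v) vf).
  have [h [isoh _]] := section_section gU u' v'.
  by apply: (iso_flag_connected isoh); exact: cS.
move=> u v uv; have [rv|rv] := lerP (rank v) n%:Z.
  by have [b [x vf]] := below_facet rv; exact: con_facet uv vf.
have {rv} vE := top_uniq rv; subst v.
have gY := section_graded gU uv; set Y := section u top in gY *.
have rtop : rank top = n%:Z + 1 by [].
have ru := face_rank u; rewrite rtop in gY.
move=> C D fC fD.
have [totC allC] := (flagP gY C).1 fC; have [totD allD] := (flagP gY D).1 fD.
have [run|run] := ltrP n%:Z (rank u).
  have all_eq (s t : Y) : s = t.
    have uE := top_uniq run.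
    have sE (a : Y) : sval a = top.
      by apply: anti; [exact: top_ge | rewrite -{1}uE; exact: (svalP a).1].
    by apply: section_eq; rewrite !sE.
  have [|c Cc _] := allC (-1); first by lia.
  have [|d Dd _] := allD (-1); first by lia.
  suff -> : C = D by exact: rt_refl.
  by apply/seteqP; split=> s _; [rewrite (all_eq s d)|rewrite (all_eq s c)].
pose thr (E : set Y) (f : U) := exists2 s, E s & sval s = f.
pose conn (f f' : U) := forall E E' : set Y, is_flag E -> is_flag E' -> thr E f -> thr E' f' ->
  gallery E E'.
have secr (s : Y) : rank s = rank (sval s) - rank u - 1 by [].
have same f : rank f = n%:Z -> conn f f.
  move=> rf E E' fE fE' [s Es sf] [s' Es' sf'].
  have ss : s' = s by apply: section_eq; rewrite sf sf'.
  rewrite {}ss {s' sf'} in Es'.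
  pose b : Y := in_section (conj (rfl u) uv).
  apply: (gallery_coatom gY (b := b) (f := s)) => //.
  - by move=> t; exact: (svalP t).1.
  - by rewrite secr sf rf; lia.
  have [h [isoh _]] := section_section gU b s.
  have [h' [_ _ isoh']] := iso_inv isoh.
  apply: (iso_flag_connected isoh').
  have [c [x fx]] := below_facet (v := sval s) ltac:(by rewrite sf rf).
  by apply: con_facet fx; exact: (svalP s).1.
have sym f f' : conn f f' -> conn f' f.
  by move=> h E E' fE fE' Ef E'f'; apply: gallery_sym; exact: h.
have ex_flag (s : Y) : exists2 E, is_flag E & E s.
  have rflY := le_refl gY.
  have [||E fE sub] := @chain_extend Y [set s]; first exact: rflY.
    by move=> x y -> ->; left.
  by exists E => //; exact: sub.
have trans f f' f'' : le u f' -> conn f f' -> conn f' f'' -> conn f f''.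
  move=> uf' h h' E E'' fE fE'' Ef E''f''.
  have [E' fE' E's] := ex_flag (in_section (conj uf' (top_ge f'))).
  have E'f' : thr E' f' by eexists; [exact: E's|].
  exact: (rt_trans _ _ _ E') (h _ _ fE fE' Ef E'f') (h' _ _ fE' fE'' E'f' E''f'').
have facetY (s : Y) : rank (sval s) = n%:Z -> exists b y, sval s = facet b y /\
    (rank u < n%:Z -> coset_set u y).
  move=> rs; have [usY _] := svalP s.
  case: (le_cases usY) => [e|[r [y [uy sy]]]].
    have [y sy] := face_nonempty (sval s); have [b sE] := face_through sy.
    by exists b, y; rewrite {1}sE rs e rs ltxx.
  by have [b sE] := face_through sy; exists b, y; rewrite {1}sE rs.
have [|c Cc rc] := allC (n%:Z - rank u - 1); first by lia.
have [|d Dd rd] := allD (n%:Z - rank u - 1); first by lia.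
have rcn : rank (sval c) = n%:Z by move: rc; rewrite secr; lia.
have rdn : rank (sval d) = n%:Z by move: rd; rewrite secr; lia.
suff h : conn (sval c) (sval d) by apply: h => //; [exists c | exists d].
have [un|un] := eqVneq (rank u) n%:Z.
  have uE (s : Y) : rank (sval s) = n%:Z -> sval s = u.
    by move=> rs; case: (le_cases (svalP s).1) => [//|[]]; rewrite un rs ltxx.
  by rewrite (uE c) // (uE d) //; exact: same.
have {un run} run : rank u < n%:Z by lia.
have swap b x : coset_set u x -> conn (facet b x) (facet (~~ b) x).
  move=> ux; set R := face_at true (n%:Z - 1) x.
  have nr : -1 <= n%:Z - 1 <= n%:Z + 1 by lia.
  have rR : rank R = n%:Z - 1 by rewrite face_at_rank.
  have Rx : coset_set R x by exact: face_at_mem.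
  have uR : le u R.
    have [e|e] := eqVneq (rank u) (n%:Z - 1).
      rewrite (face_through_lt true ux) /R ?e; [exact: rfl | lia].
    by apply: (le_common ux Rx); rewrite rR; lia.
  have Rf c' : le R (facet c' x) by apply: le_facet => //; rewrite rR; lia.
  have uf c' : le u (facet c' x) by exact: le_facet.
  pose RY : Y := in_section (conj uR (top_ge R)).
  pose f c' : Y := in_section (conj (uf c') (top_ge (facet c' x))).
  have rf c' : rank (f c') = n%:Z - rank u - 1 by rewrite secr facet_rank.
  have rflY := le_refl gY.
  have [||E fE sub] := @chain_extend Y [set RY; f b]; first exact: rflY.
    by move=> s t [->|->] [->|->]; [left|left|right|left]; try exact: rflY; exact: Rf.
  have [totE allE] := (flagP gY E).1 fE.
  have Ef : E (f b) by apply: sub; right.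
  have ER : E RY by apply: sub; left.
  have adj : flag_adjacent E ((E `\ f b) `|` [set f (~~ b)]).
    apply: (flag_exchange gY) => //; rewrite ?rf //.
    - by move=> /(congr1 sval)/facet_type; case: (b).
    - move=> H EH rH; apply: (le_tr gY (G := RY)); last exact: Rf.
      apply: (chain_le gY totE) => //; rewrite (secr RY) (_ : sval RY = R) // rR; lia.
    - move=> H EH rH; have Ht : sval H = top by apply: top_uniq; move: rH; rewrite secr; lia.
      by have := top_ge (facet (~~ b) x); rewrite -Ht; exact.
  move=> E1 E2 f1 f2 h1 h2; have [_ fE' _] := adj.
  apply: (rt_trans _ _ _ E).
    by apply: (same (facet b x)) h1 _ => //; [exact: facet_rank | exists (f b)].
  apply: (rt_trans _ _ _ _ _ (rt_step _ _ _ _ adj)).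
  apply: (same (facet (~~ b) x)) _ h2 => //; first exact: facet_rank.
  by exists (f (~~ b)) => //; right.
have uf b x : coset_set u x -> le u (facet b x) by move=> ux; exact: le_facet.
have any b c' x : coset_set u x -> conn (facet b x) (facet c' x).
  move=> ux; have [->|/eqP bc] := eqVneq b c'; first exact: same (facet_rank _ _).
  have -> : c' = ~~ b by move: bc; case: (b); case: (c').
  exact: swap.
have uM x s : coset_set u x -> fsub true (rank u) s -> coset_set u (s * x)%g.
  move=> ux hs; rewrite (face_through_lt true ux); last by lia.
  by rewrite face_at_in // mulgK.
pose T : set W := [set s | fsub true (rank u) s /\ forall x, coset_set u x ->
  conn (facet true x) (facet true (s * x)%g)].
have [F1 FM FV] := fsub_subgroup true (rank u).
have sT : is_subgroup T.
  split.
  - by split=> // x ux; rewrite mul1g; exact: same (facet_rank _ _).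
  - move=> s t [Fs hs] [Ft ht]; split; first exact: FM.
    move=> x ux; rewrite -mulgA; apply: (trans _ (facet true (t * x)%g)); last exact/hs/uM.
      exact/uf/uM.
    exact: ht.
  - move=> s [Fs hs]; split; first exact: FV.
    move=> x ux; have := hs (s^-1 * x)%g (uM _ _ ux (FV _ Fs)).
    by rewrite mulVKg => /sym.
have FT : fsub true (rank u) `<=` T.
  apply: fsub_ind => // c' s Fs Gs; split=> // x ux.
  have e : facet c' x = facet c' (s * x)%g.
    by apply: face_at_eq => //; rewrite face_at_in // mulgK fsub_facet.
  apply: (trans _ (facet c' x)); [exact: uf|exact: any|].
  by rewrite e; apply: any; exact: uM.
have [b [y [-> /(_ run) uy]]] := facetY c rcn.
have [b' [y' [-> /(_ run) uy']]] := facetY d rdn.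
have Fs : fsub true (rank u) (y' * y^-1)%g.
  have : coset_set (face_at true (rank u) y) y' by rewrite -(face_through_lt true uy) //; lia.
  by rewrite face_at_in.
have [_ /(_ y uy)] := FT _ Fs; rewrite mulgVK => h.
apply: (trans _ (facet true y)); [exact: uf | exact: any |].
by apply: (trans _ (facet true y')); [exact: uf | exact: h | exact: any].
Qed.

Lemma U_polytope : is_polytope n.+1 U.
Proof. by apply/polytopeP; split; [exact: U_graded|exact: U_diamond|exact: U_connected]. Qed.

(** * Facets, ridges and co-faces *)

(** An element acting trivially fixes the facet [G true], so it is in this factor, and it
    then fixes every face of the polytope [X true]. *)
Lemma act_inj : injective act.
Proof.
move=> v w vw.
have z1 : act (v * w^-1)%g = 1%g by rewrite act_mul vw actV mulgV.
set z := (v * w^-1)%g in z1.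
have actz u : act z u = u by rewrite z1.
have [g _ gz] : G true z.
  have := congr1 (@coset_set _ _ _ _ _ _) (actz (facet true 1%g)).
  rewrite act_mkf // mul1g => e.
  have : coset_set (facet true 1%g) z by rewrite -e; exact: face_at_mem.
  by rewrite face_at_in // fsub_facet invg1 mulg1.
suff g1 : g = 1%g.
  by apply: (@mulIg _ w^-1%g); rewrite mulgV -/z -gz g1 io1.
by apply: aut_eq => F; apply: emb_inj; rewrite -act_emb gz actz.
Qed.

Lemma bot_least (B : U) : is_least B -> B = bot.
Proof. by move=> Bl; have [_ anti _] := U_po; apply: anti => //; exact: bot_le. Qed.

Lemma U_semiregular : is_semiregular n.+1 U.
Proof.
split; first exact: U_polytope.
- move=> B F /bot_least -> rF.
  have [x Fx] := face_nonempty F; have [b FE] := face_through Fx.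
  have rF' : rank F = n%:Z by lia.
  rewrite rF' in FE; rewrite FE; have [h [isoh rh _]] := facet_iso b x.
  exact: iso_regular isoh rh (regX b).
- move=> F F' rF rF'; have [x Fx] := face_nonempty F; have [y Fy] := face_nonempty F'.
  exists (act (x^-1 * y)%g).
  rewrite (face_through_lt true Fx) ?rF; last by lia.
  rewrite (face_through_lt true Fy) ?rF'; last by lia.
  by rewrite act_mkf ?mulVKg //; lia.
Qed.

Definition of_type (b : bool) (F : U) : Prop :=
  rank F = n%:Z /\ exists w, coset_set F = right_coset (G b) w.

Lemma of_typeP b F : of_type b F <-> exists w, F = facet b w.
Proof.
split=> [[rF [w Fw]]|[w ->]].
  by exists w; apply: face_eq; rewrite ?face_at_rank ?face_at_set // fsub_facet.
by split; [exact: facet_rank | exists w; rewrite face_at_set // fsub_facet].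
Qed.

Lemma facet_of_type F : rank F = n%:Z -> exists b, of_type b F.
Proof.
move=> rF; have [x Fx] := face_nonempty F; have [b FE] := face_through Fx.
by exists b; apply/of_typeP; exists x; rewrite FE rF.
Qed.

Lemma of_type_uniq b c F : of_type b F -> of_type c F -> b = c.
Proof. by move=> /of_typeP[x ->] /of_typeP[y /facet_type]. Qed.

Lemma type_isomorphic b F : of_type b F -> isomorphic (section bot F) (X b).
Proof.
move=> /of_typeP[x ->]; have [h [isoh _ _]] := facet_iso b x.
by apply: isomorphic_sym; exists h.
Qed.

(** Below a facet of type [b] the ridge corresponds to a facet of [X b], and all facets of
    the regular polytope [X b] are equivalent. *)
Lemma ridge_isomorphic b (R : U) (B F : X b) : rank R = n%:Z - 1 ->
  is_least B -> rank F = n%:Z - 1 -> isomorphic (section bot R) (section B F).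
Proof.
move=> rR Bl rF; have [x Rx] := face_nonempty R.
have Rf : le R (facet b x) by apply: le_facet => //; lia.
have [h [isoh rh hE]] := facet_iso b x; have [g [hK gK isog]] := iso_inv isoh.
pose R' : section bot (facet b x) := in_section (conj (bot_le R) Rf).
pose B' : section bot (facet b x) := in_section (conj (bot_le bot) (bot_le _)).
have [k [isok _]] := section_section U_graded B' R'.
have e1 : isomorphic (section bot R) (section B' R').
  by apply: isomorphic_sym; exists k.
have e2 := isomorphic_section B' R' isog.
have gB : g B' = B.
  apply: (le_anti (gX b)); last exact: Bl.
  by rewrite -isoh.2 gK; exact: bot_le.
have rgR : rank (g R') = n%:Z - 1 by rewrite -rh gK bot_section_rank.
rewrite gB in e2; apply: isomorphic_trans e1 (isomorphic_trans e2 _).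
have [p pF] := base_trans F; have [q qR] := base_trans (g R').
have aF : (q^-1 * p)%g (g R') = F.
  by rewrite -[RHS]pF -qR /= aut_funK rgR rF.
have aB : (q^-1 * p)%g B = B.
  apply: (le_anti (gX b)); last exact: Bl.
  rewrite -[X in le _ X](aut_inv_funK (q^-1 * p)%g) (aut_is_iso _).2; exact: Bl.
by have := isomorphic_section B (g R') (aut_is_iso (q^-1 * p)%g); rewrite aF aB.
Qed.

Lemma ridge_facet b (R : U) : rank R = n%:Z - 1 ->
  exists! F : U, of_type b F /\ lt R F.
Proof.
move=> rR; have [x Rx] := face_nonempty R.
exists (facet b x); split.
  split; first by apply/of_typeP; exists x.
  by apply: U_rank_lt; [apply: le_facet => //|rewrite facet_rank]; lia.
move=> F [tF [RF _]]; have rF := tF.1.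
have [//|e] := facets_over b rR Rx rF RF.
have tF' : of_type (~~ b) F by apply/of_typeP; exists x.
by have := of_type_uniq tF tF'; case: (b).
Qed.

(** The two last generators, one from each factor, both fix a face of rank [n - 2], and their
    product [z] has infinite order modulo the factor [G true]; its powers move a facet
    above [R] to infinitely many others. *)
Lemma coface_apeirogon (R : U) : rank R = n%:Z - 2 -> is_apeirogon (section R top).
Proof.
move=> rR; have rt : rank top = n%:Z + 1 by [].
split.
  by apply: (section_polytope U_polytope (top_ge R)); rewrite rt rR; lia.
have [x Rx] := face_nonempty R.
pose z : W := (beta * alpha n.-1)%g.
have [F1 FM FV] := fsub_subgroup true (rank R).
have Fz : fsub true (rank R) z.
  have [r0|r0] := ltrP (rank R) 0; first by rewrite fsub_out //; left.
  have [j jE] : exists j : nat, rank R = j%:Z by exists `|rank R|%N; lia.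
  have sub : generated ([set alpha i | i in [set i | (i < n)%N /\ i <> j]] `|` [set beta])
      `<=` fsub true (rank R) by rewrite jE fsub_low //; lia.
  apply: FM; apply: sub; apply: generated_sub; first by right.
  by left; exists n.-1 => //; split; lia.
have Fzk k : fsub true (rank R) (z ^+ k)%g.
  by elim: k => [//|k IHk]; rewrite expgS; exact: FM.
have zf k : le R (facet true (z ^+ k * x)%g).
  apply: le_facet; last by rewrite rR; lia.
  by rewrite (face_through_lt true Rx) ?face_at_in ?mulgK //; [exact: face_rank | rewrite rR; lia].
pose f k : section R top := in_section (conj (zf k) (top_ge (facet true (z ^+ k * x)%g))).
(* the powers of [z] are alternating words, hence never in the factor [G true] *)
have red k : reduced G K false (flatten (nseq k [:: beta; alpha n.-1])).
  elim: k => [//|k IHk] /=; split; [by exists (gen false n.-1) | exact: last_notK|].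
  by split; [exists (gen true n.-1) | exact: last_notK | exact: IHk].
have prod k : prodw (flatten (nseq k [:: beta; alpha n.-1])) = (z ^+ k)%g.
  by elim: k => [//|k IHk] /=; rewrite -/(prodw _) IHk expgS mulgA.
have zk k : (0 < k)%N -> ~ G true (z ^+ k)%g.
  case: k => // k _; rewrite -prod => Gk.
  by have [] := free (red k.+1) Gk.
have zkl k l : (k < l)%N -> f k <> f l.
  move=> kl /(congr1 sval) /= e.
  have : coset_set (facet true (z ^+ k * x)%g) (z ^+ l * x)%g by rewrite e; exact: face_at_mem.
  rewrite face_at_in // fsub_facet invgM mulgA mulgK -expgnFr; last exact: ltnW.
  by apply: zk; rewrite subn_gt0.
have finj : {in [set: nat] &, injective f}.
  move=> k l _ _ e; have [kl|lk|//] := ltngtP k l.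
    exact: (False_ind _ (zkl _ _ kl e)).
  exact: (False_ind _ (zkl _ _ lk (esym e))).
apply/infiniteP; apply: (card_le_trans (B := f @` [set: nat])).
  by have := inj_card_eq finj; rewrite card_eq_le => /andP[].
exact: card_leT.
Qed.

(** * The automorphism group *)

Lemma flag_facet C : is_flag C -> exists b x, C (facet b x).
Proof.
move=> /(flagP U_graded)[_ /(_ n%:Z)[|F CF rF]]; first by lia.
have [b /of_typeP[x Fx]] := facet_of_type rF.
by exists b, x; rewrite -Fx.
Qed.

Lemma facet_flag b x : exists2 C, is_flag C & C (facet b x).
Proof.
have rfl := le_refl U_graded.
have [||C fC sub] := @chain_extend U [set facet b x]; first exact: rfl.
  by move=> u v -> ->; left.
by exists C => //; exact: sub.
Qed.

(** [W] is transitive on the facets of type [b], and the factor [G b], acting on the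
    facet [G b] like the automorphism group of [X b], is transitive on its flags. *)
Lemma act_flags b x y C D : is_flag C -> is_flag D -> C (facet b x) -> D (facet b y) ->
  exists w, act w @` C = D.
Proof.
(* reduce to flags through the base facet of type [b], that is, to flags of [X b] *)
suff main C' D' : is_flag C' -> is_flag D' -> C' (facet b 1) -> D' (facet b 1) ->
    exists w, act w @` C' = D'.
  move=> fC fD Cx Dy.
  have to1 E z : E (facet b z) -> (act z^-1%g @` E) (facet b 1).
    by move=> Ez; exists (facet b z); rewrite // act_mkf // mulgV.
  have [||||w wE] := main (act x^-1%g @` C) (act y^-1%g @` D);
    try exact: (iso_flag (aut_is_iso _)); try exact: to1.
  exists (x^-1 * w * y)%g; rewrite !act_mul !image_aut_mul wE -image_aut_mul -act_mul.
  rewrite mulVg act1; apply/seteqP; split=> [_ [u Du <-]//|u Du]; by exists u.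
have pull E : is_flag E -> E (facet b 1) -> @is_flag (X b) [set F | E (emb F)].
  move=> /(flagP U_graded)[totE allE] E1; apply/(flagP (gX b)); split.
    by move=> F F' EF EF'; rewrite -!emb_le; exact: totE.
  move=> j jr; have [|u Eu ru] := allE j; first by lia.
  have [F FE] : exists F : X b, emb F = u.
    by apply: emb_onto; apply: (chain_le U_graded totE) => //; rewrite facet_rank ru; lia.
  by exists F; rewrite /= ?FE // -emb_rank FE.
move=> fC fD C1 D1; have [_ trans] := regX b.
have [g gCD] := trans _ _ (pull _ fC C1) (pull _ fD D1).
exists (io g).
have fgC := iso_flag (aut_is_iso (act (io g))) fC.
suff sub : act (io g) @` C' `<=` D'.
  by apply/seteqP; split=> //; apply: fgC.2 => //; exact: fD.1.
move=> _ [u Cu <-]; have [ru|ru] := lerP (rank u) n%:Z; last first.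
  have uE := top_uniq ru.
  have [_ /(_ (n%:Z + 1))[|t Dt rt]] := (flagP U_graded D').1 fD; first by lia.
  have tE : t = top by apply: top_uniq; rewrite rt; lia.
  rewrite uE (_ : act (io g) top = t) // tE.
  by apply: top_uniq; rewrite act_rank (_ : rank top = n%:Z + 1) //; lia.
have [F FE] : exists F : X b, emb F = u.
  by apply: emb_onto; apply: (chain_le U_graded fC.1) => //; rewrite facet_rank.
rewrite -FE act_emb; have : (g @` [set F | C' (emb F)]) (g F) by exists F; rewrite //= FE.
by rewrite gCD.
Qed.

Lemma aut_bot (f : aut U) : f bot = bot.
Proof.
have [_ anti _] := U_po; apply: anti; last exact: bot_le.
rewrite -[X in le _ X](aut_inv_funK f) (aut_is_iso f).2; exact: bot_le.
Qed.

Lemma aut_facet_isomorphic (f : aut U) b c x y : f (facet b x) = facet c y ->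
  isomorphic (X b) (X c).
Proof.
move=> fx; have tb : of_type b (facet b x) by apply/of_typeP; exists x.
have tc : of_type c (facet c y) by apply/of_typeP; exists y.
apply: isomorphic_trans (isomorphic_sym (type_isomorphic tb)) _.
apply: isomorphic_trans _ (type_isomorphic tc).
by have := isomorphic_section bot (facet b x) (aut_is_iso f); rewrite aut_bot fx.
Qed.

(** Regularity provides an automorphism taking a facet of one type to a facet of the
    other. *)
Lemma regular_isomorphic : is_regular n.+1 U -> isomorphic (X true) (X false).
Proof.
move=> [_ trans]; have [C fC C1] := facet_flag true 1%g.
have [D fD D1] := facet_flag false 1%g; have [f fCD] := trans _ _ fC fD.
apply: (@aut_facet_isomorphic f _ _ 1%g 1%g).
apply: (chain_inj U_graded fD.1) => //; first by rewrite -fCD; exists (facet true 1%g).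
by rewrite (aut_rank _ _ U_graded) !facet_rank.
Qed.

(** When the polytopes are not isomorphic, an automorphism preserves the types of facets, so
    on some flag it coincides with an element of [W]. *)
Lemma act_onto : ~ isomorphic (X true) (X false) -> range act = [set: aut U].
Proof.
move=> niso; apply/seteqP; split=> // f _.
have [C fC C1] := facet_flag true 1%g; have ff := iso_flag (aut_is_iso f) fC.
have [b [y fCy]] := flag_facet ff.
have fy : f (facet true 1%g) = facet b y.
  apply: (chain_inj U_graded ff.1 _ fCy); first by exists (facet true 1%g).
  by rewrite (aut_rank _ _ U_graded) !facet_rank.
have bt : b = true.
  by case: b fCy fy => // _ fy; case: niso; exact: (@aut_facet_isomorphic f _ _ _ _ fy).
subst b; have [w wE] := act_flags fC ff C1 fCy.
by exists w => //; exact: (aut_flag_image U_polytope fC wE).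
Qed.

(** * The case of isomorphic polytopes *)

(** An automorphism of [W] that exchanges the two factors while fixing [K] pointwise maps
    face subgroups to face subgroups and so acts on [U]. *)
Section Swap.
Variable theta : W -> W.
Hypothesis thetaM : {morph theta : x y / (x * y)%g}.
Hypothesis thetaK : involutive theta.
Hypothesis theta_G : forall b x, G b x -> G (~~ b) (theta x).
Hypothesis theta_alpha : forall j, (j.+1 < n)%N -> theta (alpha j) = alpha j.
Hypothesis theta_beta : theta beta = alpha n.-1.

Lemma theta_alpha_last : theta (alpha n.-1) = beta.
Proof. by rewrite -theta_beta thetaK. Qed.

Lemma theta_generated (A : set W) : (forall x, A x -> A (theta x)) ->
  theta @` generated A = generated A.
Proof.
move=> At; rewrite image_generated //; congr generated.
apply/seteqP; split=> [_ [x Ax <-]|x Ax]; first exact: At.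
by exists (theta x); [exact: At | exact: thetaK].
Qed.

Lemma theta_fsub b r : -1 <= r <= n%:Z + 1 -> theta @` fsub b r = fsub (~~ b) r.
Proof.
move=> /fsub_cases[rE|[j jn ->]|->|->].
- rewrite !fsub_out; try lia.
  by apply/seteqP; split=> // x _; exists (theta x); rewrite ?thetaK.
- rewrite !fsub_low //; apply: theta_generated => _ [[l [ln lj] <-]|->]; last first.
    by rewrite theta_beta; left; exists n.-1 => //; split; lia.
  have [ln1|ln1] := ltnP l.+1 n; first by rewrite theta_alpha //; left; exists l.
  by right; rewrite (_ : l = n.-1) ?theta_alpha_last //=; lia.
- rewrite !fsub_ridge; apply: theta_generated => _ [l ln <-].
  by rewrite theta_alpha //; exists l.
- rewrite !fsub_facet; apply/seteqP; split=> [_ [x Gx <-]|x Gx]; first exact: theta_G.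
  by exists (theta x); rewrite ?thetaK // -[b]negbK; exact: theta_G.
Qed.

Lemma theta_coset A w : theta @` right_coset A w = right_coset (theta @` A) (theta w).
Proof.
apply/seteqP; split=> [_ [_ [a Aa <-] <-]|_ [_ [a Aa <-] <-]].
  by rewrite thetaM; exists (theta a) => //; exists a.
by rewrite -thetaM; exists (a * w)%g => //; exists a.
Qed.

Lemma swap_subproof (u : U) : is_U_face (rank u) (theta @` coset_set u).
Proof.
have [ru [b [w ->]]] := faceP u.
by rewrite theta_coset theta_fsub //; exact: face_coset.
Qed.

Definition swap_face (u : U) : U := CosetFace (swap_subproof u).

Lemma swap_faceK : involutive swap_face.
Proof.
move=> u; apply: face_eq => //=; apply/seteqP.
split=> [_ [_ [x ux <-] <-]|x ux]; first by rewrite thetaK.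
by exists (theta x); [exists x | exact: thetaK].
Qed.

Lemma swap_face_homo u v : le u v -> le (swap_face u) (swap_face v).
Proof.
move=> /le_cases[->|[r [x [ux vx]]]]; first by right.
by apply: (le_common (x := theta x)) => //; exists x.
Qed.

Lemma swap_face_le u v : le (swap_face u) (swap_face v) <-> le u v.
Proof.
split; last exact: swap_face_homo.
by move=> /swap_face_homo; rewrite !swap_faceK.
Qed.

Definition swap : aut U := Aut swap_faceK swap_faceK swap_face_le.

Lemma theta1 : theta 1%g = 1%g.
Proof. by apply: (@mulIg _ (theta 1%g)); rewrite -thetaM !mul1g. Qed.

Lemma swap_facet b x : swap (facet b x) = facet (~~ b) (theta x).
Proof.
apply: face_eq; first by rewrite facet_rank; exact: (facet_rank b x).
rewrite (_ : coset_set (swap (facet b x)) = theta @` coset_set (facet b x)) //.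
by rewrite !face_at_set // theta_coset theta_fsub.
Qed.

Lemma swapK : (swap * swap)%g = 1%g.
Proof. by apply: aut_eq => u; exact: swap_faceK. Qed.

Lemma swapV : swap^-1%g = swap.
Proof. by apply: (@mulIg _ swap); rewrite mulVg swapK. Qed.

Lemma act_swap w : (act w * swap = swap * act (theta w))%g.
Proof. by apply: aut_eq => u; apply: face_eq => //=; exact: theta_coset. Qed.

(** Both types of facets being equivalent now, [W] and [swap] together are transitive on
    flags, and by rigidity nothing else is left. *)
Lemma aut_dichotomy (f : aut U) : (exists w, f = act w) \/ (exists w, f = act w * swap)%g.
Proof.
have [C fC C1] := facet_flag true 1%g; have ff := iso_flag (aut_is_iso f) fC.
have [b [y fCy]] := flag_facet ff; case: b fCy => fCy.
  have [w wE] := act_flags fC ff C1 fCy.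
  by left; exists w; apply/esym; exact: (aut_flag_image U_polytope fC wE).
have fs := iso_flag (aut_is_iso swap) fC.
have C1' : (swap @` C) (facet false 1%g).
  by exists (facet true 1%g); rewrite // swap_facet theta1.
have [w wE] := act_flags fs ff C1' fCy.
right; exists (theta w); rewrite act_swap thetaK; apply/esym.
by apply: (aut_flag_image U_polytope fC); rewrite image_aut_mul.
Qed.

Lemma swap_regular : is_regular n.+1 U.
Proof.
split; first exact: U_polytope.
move=> C D fC fD; have [b [x Cx]] := flag_facet fC; have [c [y Dy]] := flag_facet fD.
have [bc|/eqP bc] := eqVneq b c.
  by subst c; have [w wE] := act_flags fC fD Cx Dy; exists (act w).
have fs := iso_flag (aut_is_iso swap) fC.
have Cs : (swap @` C) (facet c (theta x)).
  exists (facet b x) => //; rewrite swap_facet; congr face_at.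
  by move: bc; case: (b); case: (c).
have [w wE] := act_flags fs fD Cs Dy.
by exists (swap * act w)%g; rewrite image_aut_mul.
Qed.

Lemma swap_notin_act w : act w <> swap.
Proof.
move=> e; have := swap_facet true 1%g; rewrite -e act_mkf //.
by move/facet_type.
Qed.

Lemma swap_semidirect : is_semidirect (range act) [set 1%g; swap] /\
  [set 1%g; swap] #= `I_2.
Proof.
have sAct : is_subgroup (range act).
  split; first by exists 1%g; rewrite ?act1.
  - by move=> _ _ [v _ <-] [w _ <-]; exists (v * w)%g; rewrite ?act_mul.
  - by move=> _ [v _ <-]; exists v^-1%g; rewrite ?actV.
have ne : 1%g <> swap by rewrite -act1; exact: swap_notin_act.
split; last by apply/card_I2P; exists 1%g, swap.
split.
- split=> // _ f [v _ <-]; have swapJ w : (act w ^ swap)%g = act (theta w).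
    by rewrite conjgE swapV act_swap mulgA swapK mul1g.
  have actJ w z : (act w ^ act z)%g = act (w ^ z)%g.
    by rewrite !conjgE -actV -!act_mul.
  case: (aut_dichotomy f) => -[w ->].
    by rewrite actJ; eexists.
  by rewrite conjgM actJ swapJ; eexists.
- split; first by left.
    by move=> _ _ [->|->] [->|->]; rewrite ?mulg1 ?mul1g ?swapK; [left|right|right|left].
  by move=> _ [->|->]; rewrite ?invg1 ?swapV; [left|right].
- apply/seteqP; split=> [_ [[w _ <-] [//|/swap_notin_act//]]|_ ->].
  by split; [exists 1%g; rewrite ?act1 | left].
- apply/seteqP; split=> // f _; case: (aut_dichotomy f) => -[w ->].
    by exists (act w); [exists w | exists 1%g; [left | rewrite mulg1]].
  by exists (act w); [exists w | exists swap => //; right].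
Qed.

End Swap.

(** * The main theorem *)

Theorem universal_structure :
  (isomorphic (X true) (X false) -> exists theta : W -> W,
     [/\ {morph theta : x y / (x * y)%g}, involutive theta,
         forall b x, G b x -> G (~~ b) (theta x),
         forall j, (j.+1 < n)%N -> theta (alpha j) = alpha j &
         theta beta = alpha n.-1]) ->
  [/\ [/\ is_semiregular n.+1 U, acts_by_right_mul act,
          {morph act : v w / (v * w)%g} & injective act],
      [/\ forall F : U, rank F = n%:Z -> of_type true F \/ of_type false F,
          forall F : U, of_type true F -> isomorphic (section bot F) (X true),
          forall F : U, of_type false F -> isomorphic (section bot F) (X false) &
          forall R : U, rank R = n%:Z - 1 ->
            [/\ forall B F : X true, is_least B -> rank F = n%:Z - 1 ->
                  isomorphic (section bot R) (section B F),
                forall B F : X false, is_least B -> rank F = n%:Z - 1 ->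
                  isomorphic (section bot R) (section B F),
                exists! F : U, of_type true F /\ lt R F &
                exists! F : U, of_type false F /\ lt R F]],
      forall R : U, rank R = n%:Z - 2 -> is_apeirogon (section R top) &
      [/\ is_regular n.+1 U <-> isomorphic (X true) (X false),
          isomorphic (X true) (X false) ->
            exists C : set (aut U), is_semidirect (range act) C /\ C #= `I_2 &
          ~ isomorphic (X true) (X false) -> range act = [set: aut U]]].
Proof.
move=> hswap; split.
- by split; [exact: U_semiregular | by [] | exact: act_mul | exact: act_inj].
- split; [|exact: type_isomorphic|exact: type_isomorphic|].
    by move=> F /facet_of_type[[] tF]; [left | right].
  move=> R rR; split; [| | exact: ridge_facet | exact: ridge_facet];
    by move=> B F; exact: ridge_isomorphic.
- exact: coface_apeirogon.
- split; last exact: act_onto.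
    split; first exact: regular_isomorphic.
    by move=> /hswap[theta [tM tK tG ta tb]]; exact: (swap_regular tM tK tG ta tb).
  move=> /hswap[theta [tM tK tG ta tb]].
  by eexists; exact: (swap_semidirect tM tK tG ta tb).
Qed.

End Universal.

Lemma base_faces (n : nat) (X : rankedRel) (C : set X) : is_polytope n X -> is_flag C ->
  exists base : int -> X, forall r, -1 <= r <= n%:Z -> C (base r) /\ rank (base r) = r.
Proof.
move=> /polytopeP[gX _ _] fC; have [_ allC] := (flagP gX C).1 fC.
have [b _ _] := graded_bot gX.
have h (r : int) : exists F : X, -1 <= r <= n%:Z -> C F /\ rank F = r.
  have [rn|rn] := boolP (-1 <= r <= n%:Z); last by exists b.
  by have [F CF rF] := allC _ rn; exists F.
by have [base hb] := choice h; exists base.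
Qed.

Section Conjugation.
Variables (X Y : rankedRel) (f : X -> Y) (f' : Y -> X).
Hypothesis fK : cancel f f'.
Hypothesis f'K : cancel f' f.
Hypothesis isof : is_iso f.

Definition conj_aut (g : aut X) : aut Y.
Proof.
exists (fun F => f (g (f' F))) (fun F => f (aut_inv_fun g (f' F))).
- by move=> F; rewrite fK aut_funK f'K.
- by move=> F; rewrite fK aut_inv_funK f'K.
- by move=> F G; rewrite isof.2 (aut_is_iso g).2 -isof.2 !f'K.
Defined.

Lemma conj_autE g F : conj_aut g F = f (g (f' F)). Proof. by []. Qed.

Lemma conj_autM : {morph conj_aut : g h / (g * h)%g}.
Proof. by move=> g h; apply: aut_eq => F; rewrite !conj_autE /= fK. Qed.

Lemma conj_aut_flag g C : conj_aut g @` (f @` C) = f @` (g @` C).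
Proof.
apply/seteqP; split=> [_ [_ [x Cx <-] <-]|_ [_ [x Cx <-] <-]].
  by rewrite conj_autE fK; exists (g x) => //; exists x.
by exists (f x); [exists x | rewrite conj_autE fK].
Qed.

End Conjugation.

(** Regularity of [Q] corrects any isomorphism by an automorphism. *)
Lemma isomorphic_flag (n : nat) (P Q : rankedRel) (Phi : set P) (Psi : set Q) :
  is_regular n P -> is_regular n Q -> is_flag Phi -> is_flag Psi -> isomorphic P Q ->
  exists f : P -> Q, is_iso f /\ f @` Phi = Psi.
Proof.
move=> [pP _] [pQ trQ] fPhi fPsi [f isof].
have [q qE] := trQ _ _ (iso_flag isof fPhi) fPsi.
by exists (q \o f); split; [exact: iso_comp isof (aut_is_iso q) | rewrite -qE image_comp].
Qed.

(** Both sides take [Psi] to the flag differing from it exactly in its [j]-face; by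
    rigidity they are equal. *)
Lemma conj_distinguished (n : nat) (P Q : rankedRel) (Phi : set P) (Psi : set Q)
    (f : P -> Q) (f' : Q -> P) (fK : cancel f f') (f'K : cancel f' f) (isof : is_iso f)
    (j : nat) (r : aut P) (s : aut Q) :
  is_polytope n P -> is_polytope n Q -> is_flag Phi -> is_flag Psi -> f @` Phi = Psi ->
  is_distinguished Phi j r -> is_distinguished Psi j s ->
  conj_aut fK f'K isof r = s.
Proof.
move=> pP pQ fPhi fPsi fE hr hs.
have /polytopeP[gP _ _] := pP; have /polytopeP[gQ dQ cQ] := pQ.
set c := conj_aut _ _ _ r.
have frank F : rank (f' F) = rank F by rewrite -(iso_rank _ gP gQ isof) f'K.
have mem (C : set P) F : (f @` C) F <-> C (f' F).
  by split=> [[x Cx <-]|CF]; [rewrite fK | exists (f' F)].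
have dc : differ_at j%:Z (c @` Psi) Psi.
  rewrite -fE /c conj_aut_flag; case: hr => ne agree; split=> [e|F rF].
    apply: ne; apply/seteqP; split=> F.
      by rewrite -{1}(fK F) -mem e mem fK.
    by rewrite -{1}(fK F) -mem -e mem fK.
  by rewrite !mem; apply: agree; rewrite frank.
have fc := iso_flag (aut_is_iso c) fPsi; have fs := iso_flag (aut_is_iso s) fPsi.
have e : c @` Psi = s @` Psi.
  exact: (differ_unique gQ dQ fPsi fc fs (differ_sym dc) (differ_sym hs)).
exact: (aut_flag_image pQ fPsi e).
Qed.

Section SwapFactors.
Local Open Scope group_scope.
Variables (G1 G2 : groupType) (H : set G1) (phi : G1 -> G2).
Variables (c : G1 -> G2) (c' : G2 -> G1).
Hypothesis cM : {morph c : x y / x * y}.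
Hypothesis cK : cancel c c'.
Hypothesis c'K : cancel c' c.
Hypothesis c_phi : forall h, H h -> phi h = c h.

Notation inl1 := (amalgam_inl H phi).
Notation inr2 := (amalgam_inr H phi).

(** Replacing the letters of a word by [c] and its inverse respects the gluing, because
    [c] extends the identification [phi] of the amalgamated subgroups. *)
Lemma amalgam_swap : exists theta : amalgam H phi -> amalgam H phi,
  [/\ {morph theta : x y / x * y}, involutive theta,
      forall x, theta (inl1 x) = inr2 (c x) & forall y, theta (inr2 y) = inl1 (c' y)].
Proof.
pose W := amalgam H phi.
have c'M : {morph c' : x y / x * y}.
  by move=> x y; apply: (can_inj cK); rewrite cM !c'K.
have c1 : c 1 = 1 by apply: (@mulIg _ (c 1)); rewrite -cM !mul1g.
have c'1 : c' 1 = 1 by rewrite -c1 cK.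
have l1 : inl1 1 = 1 by apply: (@mulIg _ (inl1 1)); rewrite -amalgam_inlM !mul1g.
have r1 : inr2 1 = 1 by apply: (@mulIg _ (inr2 1)); rewrite -amalgam_inrM !mul1g.
pose a1 x (z : W) : W := inr2 (c x) * z.
pose a2 y (z : W) : W := inl1 (c' y) * z.
pose ok (z : W) := True.
have okT t : ok t by exact: I.
have ok1 x t : ok t -> ok (a1 x t) by [].
have ok2 x t : ok t -> ok (a2 x t) by [].
have a1_1 t : ok t -> a1 1 t = t by move=> _; rewrite /a1 c1 r1 mul1g.
have a2_1 t : ok t -> a2 1 t = t by move=> _; rewrite /a2 c'1 l1 mul1g.
have a1M x y t : ok t -> a1 (x * y) t = a1 x (a1 y t).
  by move=> _; rewrite /a1 cM amalgam_inrM mulgA.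
have a2M x y t : ok t -> a2 (x * y) t = a2 x (a2 y t).
  by move=> _; rewrite /a2 c'M amalgam_inlM mulgA.
have a_glue h t : H h -> ok t -> a1 h t = a2 (phi h) t.
  move=> Hh _; rewrite /a1 /a2 (c_phi Hh) cK -(c_phi Hh).
  by rewrite (amalgam_inl_glue _ Hh).
pose theta (w : W) : W := amalgam_run a1 a2 w 1.
have runM (v w : W) t : amalgam_run a1 a2 (v * w) t = amalgam_run a1 a2 v (amalgam_run a1 a2 w t).
  exact: (amalgam_runM ok1 ok2 a1_1 a2_1 a1M a2M a_glue v w (okT t)).
have runl x t : amalgam_run a1 a2 (inl1 x) t = inr2 (c x) * t.
  by rewrite (amalgam_run_inl ok1 ok2 a1_1 a2_1 a1M a2M a_glue) //; exact: okT.
have runr y t : amalgam_run a1 a2 (inr2 y) t = inl1 (c' y) * t.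
  by rewrite (amalgam_run_inr ok1 ok2 a1_1 a2_1 a1M a2M a_glue) //; exact: okT.
have run1 t : amalgam_run a1 a2 (1 : W) t = t.
  by rewrite (amalgam_run1 ok1 ok2 a1_1 a2_1 a1M a2M a_glue) //; exact: okT.
have thl x : theta (inl1 x) = inr2 (c x) by rewrite /theta runl mulg1.
have thr y : theta (inr2 y) = inl1 (c' y) by rewrite /theta runr mulg1.
have runE (w : W) t : amalgam_run a1 a2 w t = theta w * t.
  rewrite /theta; elim/amalgam_ind: w => [|x w IHw|y w IHw].
  - by rewrite !run1 mul1g.
  - by rewrite !runM !runl IHw mulgA.
  - by rewrite !runM !runr IHw mulgA.
have thM : {morph theta : x y / x * y}.
  by move=> v w; rewrite {1}/theta runM runE.
exists theta; split=> //; elim/amalgam_ind => [|x w IHw|y w IHw].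
- by rewrite /theta !run1.
- by rewrite !thM IHw thl thr cK.
- by rewrite !thM IHw thr thl c'K.
Qed.

End SwapFactors.

Theorem theorem5p5 (n : nat) (P Q : rankedRel)
    (hn : (0 < n)%N)
    (hP : is_regular n P) (hQ : is_regular n Q)
    (Phi : set P) (hPhi : is_flag Phi)
    (Psi : set Q) (hPsi : is_flag Psi)
    (rho : nat -> aut P)
    (hrho : forall j, (j < n)%N -> is_distinguished Phi j (rho j))
    (sigma : nat -> aut Q)
    (hsigma : forall j, (j < n)%N -> is_distinguished Psi j (sigma j))
    (phi : aut P -> aut Q)
    (hphi : matches_facets n rho sigma phi) :
  let U := universal n rho sigma phi in
  let bot : U := coset_bot _ _ _ _ _ in
  let top : U := coset_top _ _ _ _ _ in
  exists act : Pi n rho phi -> aut U,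
  [/\ (* (1) *)
      [/\ is_semiregular n.+1 U,
          acts_by_right_mul act,
          {morph act : v w / (v * w)%g} &
          injective act],
      (* (2) *)
      [/\ forall F : U, rank F = n%:Z -> typeP F \/ typeQ F,
          forall F : U, typeP F -> isomorphic (section bot F) P,
          forall F : U, typeQ F -> isomorphic (section bot F) Q &
          forall R : U, rank R = n%:Z - 1 ->
            [/\ forall B K : P, is_least B -> rank K = n%:Z - 1 ->
                  isomorphic (section bot R) (section B K),
                forall B K : Q, is_least B -> rank K = n%:Z - 1 ->
                  isomorphic (section bot R) (section B K),
                exists! F : U, typeP F /\ lt R F &
                exists! F : U, typeQ F /\ lt R F]],
      (* (3) *)
      forall R : U, rank R = n%:Z - 2 -> is_apeirogon (section R top) &
      (* (4) *)
      [/\ is_regular n.+1 U <-> isomorphic P Q,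
          isomorphic P Q ->
            exists C : set (aut U), is_semidirect (range act) C /\ C #= `I_2 &
          ~ isomorphic P Q -> range act = [set: aut U]]].
Proof.
move=> U bot top.
have [phi_iso phi_gen] := hphi; have [phi_bij phiM] := phi_iso.
have [pP _] := hP; have [pQ _] := hQ.
have [baseP hbaseP] := base_faces pP hPhi.
have [baseQ hbaseQ] := base_faces pQ hPsi.
pose W := Pi n rho phi.
pose inl1 := amalgam_inl (facet_group n rho) phi : aut P -> W.
pose inr2 := amalgam_inr (facet_group n rho) phi : aut Q -> W.
pose X b := if b then P else Q.
pose Flags b : set (X b) := if b return set (X b) then Phi else Psi.
pose gen b : nat -> aut (X b) := if b return nat -> aut (X b) then rho else sigma.
pose base b : int -> X b := if b return int -> X b then baseP else baseQ.
pose io b : aut (X b) -> W := if b return aut (X b) -> W then inl1 else inr2.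
have regX b : is_regular n (X b) by case: b.
have fFlags b : is_flag (Flags b) by case: b.
have hgen b j : (j < n)%N -> is_distinguished (Flags b) j (gen b j).
  by case: b; [exact: hrho | exact: hsigma].
have base_in b r : -1 <= r <= n%:Z -> Flags b (base b r).
  by case: b; [case/hbaseP | case/hbaseQ].
have base_rank b r : -1 <= r <= n%:Z -> rank (base b r) = r.
  by case: b; [case/hbaseP | case/hbaseQ].
have ioM b : {morph io b : x y / (x * y)%g}.
  by case: b => x y; [exact: amalgam_inlM | exact: amalgam_inrM].
have sH1 : is_subgroup (facet_group n rho) by exact: generated_subgroup.
have sH2 : is_subgroup (facet_group n sigma) by exact: generated_subgroup.
have io_inj b : injective (io b).
  case: b; [exact: (amalgam_inl_inj sH1 sH2 phi_iso) | exact: (amalgam_inr_inj sH1 sH2 phi_iso)].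
have rho_facet j : (j.+1 < n)%N -> facet_group n rho (rho j).
  by move=> jn; apply: generated_sub; exists j.
have io_match j : (j.+1 < n)%N -> io true (gen true j) = io false (gen false j).
  move=> jn; rewrite /io /gen -phi_gen //.
  exact: amalgam_inl_glue (rho_facet _ jn).
have W_gen (A : set W) : is_subgroup A -> (forall b g, A (io b g)) -> forall w, A w.
  move=> [A1 AM _] Aio; elim/amalgam_ind => [//|x w Aw|y w Aw]; apply: AM => //.
    exact: (Aio true).
  exact: (Aio false).
have free : free_amalgam (fun b => range (io b))
    (ridge_subgroup n (fun j => io true (gen true j))).
  have -> : (fun b => range (io b)) = (fun b : bool => if b then range inl1 else range inr2).
    by apply: funext => -[].
  have -> : ridge_subgroup n (fun j => io true (gen true j)) = inl1 @` facet_group n rho.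
    by rewrite /facet_group image_generated ?image_comp //; exact: amalgam_inlM.
  exact: (amalgam_free sH1 sH2 phi_iso).
exists (act n gen io).
apply: (universal_structure hn regX fFlags hgen base_in base_rank ioM io_inj
  io_match W_gen free).
move=> isoPQ; have [f [isof fE]] := isomorphic_flag hP hQ hPhi hPsi isoPQ.
have [f' [fK f'K isof']] := iso_inv isof.
pose c := conj_aut fK f'K isof.
have c_gen j : (j < n)%N -> c (rho j) = sigma j.
  move=> jn; apply: (conj_distinguished fK f'K isof pP pQ hPhi hPsi fE).
    exact: hrho.
  exact: hsigma.
pose c' := conj_aut f'K fK isof'.
have cM : {morph c : g h / (g * h)%g} by exact: conj_autM.
have cK : cancel c c' by move=> g; apply: aut_eq => F; rewrite !conj_autE !fK.
have c'K : cancel c' c by move=> g; apply: aut_eq => F; rewrite !conj_autE !f'K.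
(* two morphisms that agree on the generators *)
have c_phi h : facet_group n rho h -> phi h = c h.
  have [F1 FM FV] := sH1.
  have phi1 : phi 1%g = 1%g by apply: (@mulIg _ (phi 1%g)); rewrite -phiM // !mul1g.
  have c1 : c 1%g = 1%g by apply: (@mulIg _ (c 1%g)); rewrite -cM !mul1g.
  have sub : is_subgroup [set g | facet_group n rho g /\ phi g = c g].
    split=> [//|x y [Hx xE] [Hy yE]|x [Hx xE]]; first by rewrite /= c1.
      by split; [exact: FM | rewrite phiM // cM xE yE].
    split; first exact: FV.
    apply: (@mulIg _ (phi x)); rewrite -phiM //; last exact: FV.
    by rewrite mulVg phi1 xE -cM mulVg c1.
  move=> Hh; suff [] : facet_group n rho h /\ phi h = c h by [].
  move: h Hh; apply: (generated_min sub) => _ [j jn <-].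
  by split; [exact: rho_facet | rewrite phi_gen // c_gen //; exact: ltnW].
have [theta [tM tK tl tr]] := amalgam_swap cM cK c'K c_phi.
exists theta; split=> //.
- case=> _ [g _ <-]; first by exists (c g) => //; exact/esym/tl.
  by exists (c' g) => //; exact/esym/tr.
- move=> j jn; rewrite [LHS]tl c_gen; last exact: ltnW.
  by rewrite -phi_gen //; apply/esym; exact: amalgam_inl_glue (rho_facet _ jn).
- have e : c (rho n.-1) = sigma n.-1 by apply: c_gen; rewrite prednK.
  exact: etrans (tr (sigma n.-1)) (congr1 inl1 (etrans (congr1 c' (esym e)) (cK _))).
Qed.
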